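(* Consider the $n\times n$ system $\frac{dY}{dz}=A(z,t)Y$ satisfying Assumption 1 (see context), and let $F_k(t)$, $k\ge1$, be the coefficients, uniquely determined and holomorphic on $\mathcal U_{\epsilon_0}(0)\setminus\Delta$, of its formal solution $G_0(t)\big(I+\sum_{k\ge1}F_k(t)z^{-k}\big)z^{B_1(t)}e^{\Lambda(t)z}$, $t\notin\Delta$. The coefficients $F_k(t)$ are holomorphic at a point $t_\Delta\in\Delta$ if and only if there exists a neighbourhood of $t_\Delta$ where $$(\widehat A_1)_{ab}(t)\qquad\text{(i)}$$ and, for every $l\ge2$, $$\big[(\widehat A_1)_{aa}(t)-(\widehat A_1)_{bb}(t)+l-1\big](F_{l-1})_{ab}(t)+\sum_{\gamma\ne a}(\widehat A_1)_{a\gamma}(t)(F_{l-1})_{\gamma b}(t)+\sum_{j=1}^{l-2}\big(\widehat A_{l-j}(t)F_j(t)\big)_{ab}+(\widehat A_l)_{ab}(t)\qquad\text{(ii)}$$ vanish as fast as $\mathcal O(u_a(t)-u_b(t))$ in the neighbourhood, for those indices $a\neq b\in\{1,\dots,n\}$ such that $u_a(t)$ and $u_b(t)$ coalesce when $t$ approaches a point of $\Delta$ in the neighbourhood. In particular, the $F_k(t)$'s are holomorphic in the whole $\mathcal U_{\epsilon_0}(0)$ if and only if the expressions (i) and (ii) (for the indices $a\ne b$ of coalescing eigenvalues, and every $l\ge 2$) are zero along $\Delta$.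
   Context: Setting. $t\in\mathbb C^m$, $\mathcal U_{\epsilon_0}(0)=\{|t|\le\epsilon_0\}$, $|t|=\max_i|t_i|$, with $\epsilon_0>0$ sufficiently small. $A(z,t)=\sum_{j\ge0}A_j(t)z^{-j}$ is holomorphic for $|z|\ge N_0>0$, $|t|\le\epsilon_0$, with uniformly convergent expansion and holomorphic coefficients $A_j(t)$. Assumption 1: there is a holomorphic invertible $G_0(t)$ on $\mathcal U_{\epsilon_0}(0)$ with $G_0(t)^{-1}A_0(t)G_0(t)=\Lambda(t)=\mathrm{diag}(u_1(t),\dots,u_n(t))$, where the $u_a$ are holomorphic (and $A_0(0)=\Lambda(0)$, $G_0(0)=I$). $\Delta=\{t\in\mathcal U_{\epsilon_0}(0):u_a(t)=u_b(t)\text{ for some }a\neq b\}$ is the coalescence locus (no two $u_a,u_b$, $a\ne b$, being identically equal). $\widehat A_k(t)=G_0(t)^{-1}A_k(t)G_0(t)$, $B_1(t)=\mathrm{diag}(\widehat A_1(t))$ (diagonal part). The $F_l$ are determined, for $t\notin\Delta$, by $(F_1)_{ab}=-\dfrac{(\widehat A_1)_{ab}}{u_a-u_b}$ for $a\ne b$; for $l\ge2$ and $a\neq b$, $$(F_l)_{ab}=-\frac1{u_a-u_b}\Big\{\big[(\widehat A_1)_{aa}-(\widehat A_1)_{bb}+l-1\big](F_{l-1})_{ab}+\sum_{\gamma\ne a}(\widehat A_1)_{a\gamma}(F_{l-1})_{\gamma b}+\sum_{j=1}^{l-2}(\widehat A_{l-j}F_j)_{ab}+(\widehat A_l)_{ab}\Big\};$$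 and, for $l\ge2$, $$(l-1)(F_{l-1})_{aa}=-\sum_{b\ne a}(\widehat A_1)_{ab}(F_{l-1})_{ba}-\sum_{j=1}^{l-2}(\widehat A_{l-j}F_j)_{aa}-(\widehat A_l)_{aa}.$$
   Formalization: ''Zero along Δ'' in the last sentence is taken as vanishing like O(u_a−u_b) near each point of Δ (pointwise it fails: Λ=diag(t²,0), Â₁=diag(−1,0)+tE₁₂); pointwise vanishing is proved necessary, and sufficient on |t|<ε₀ if the u_a−u_b have only simple zeros. *)

(* Defs.v *)
From HB Require Import structures.
From mathcomp Require Import all_boot all_order all_algebra.
From mathcomp Require Import complex.
From mathcomp Require Import all_classical all_reals all_analysis.

Set Implicit Arguments.
Unset Strict Implicit.
Unset Printing Implicit Defensive.

Import Order.TTheory GRing.Theory Num.Theory.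
Import numFieldNormedType.Exports.

Local Open Scope classical_set_scope.
Local Open Scope ring_scope.
Local Open Scope complex_scope.

(* Holomorphic functions.  Points of C^m are row vectors over R[i], whose      *)
(* library norm is the maximum norm |t| = max_i |t_i|; it takes its values in  *)
(* R[i], hence the coercions r%:C of real radii.  R[i] is regarded as a normed *)
(* space over itself through R[i]^o.  `differentiable' over R[i] is complex    *)
(* Frechet differentiability, so being differentiable near a point is being    *)
(* holomorphic there.                                                          *)

HB.instance Definition _ (R : rcfType) := PseudoPointedMetric.copy R[i] R[i]^o.

Definition polydisc (R : realType) (m : nat) (r : R) : set 'rV[R[i]]_m :=
  [set t | `|t| <= r%:C].

Definition open_polydisc (R : realType) (m : nat) (r : R) : set 'rV[R[i]]_m :=
  [set t | `|t| < r%:C].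

Definition holomorphic_at (R : realType) (V W : normedModType R[i])
    (f : V -> W) (x : V) : Prop :=
  \forall y \near x, differentiable f y.

(* A function f given off Z is holomorphic on S when it agrees off Z with one  *)
(* function that is holomorphic at every point of S.                           *)
Definition holomorphic_off_on (R : realType) (V W : normedModType R[i])
    (Z : set V) (f : V -> W) (S : set V) : Prop :=
  exists g : V -> W, forall x, S x ->
    holomorphic_at g x /\ \forall y \near x, ~ Z y -> g y = f y.

(* The eigenvalues u_1, ..., u_n are the entries of a row vector u t.          *)
Definition coalescence (R : realType) (m n : nat)
    (u : 'rV[R[i]]_m -> 'rV[R[i]]_n) : set 'rV[R[i]]_m :=
  [set t | exists a b, a != b /\ u t 0 a = u t 0 b].

Definition hatA (R : realType) (m n : nat)
    (Aj : nat -> 'rV[R[i]]_m -> 'M[R[i]]_n) (G0 : 'rV[R[i]]_m -> 'M[R[i]]_n)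
    (k : nat) (t : 'rV[R[i]]_m) : 'M[R[i]]_n :=
  invmx (G0 t) *m Aj k t *m G0 t.

Definition diag_part (R : realType) (n : nat) (M : 'M[R[i]]_n) : 'M[R[i]]_n :=
  diag_mx (\row_a M a a).

(* (sum_k S_k z^-k) z^B e^(L z) is a formal solution of                        *)
(* dY/dz = (sum_j A_j z^-j) Y, for diagonal B and L.  The derivative of        *)
(* z^B e^(L z) is (B/z + L) z^B e^(L z); cancelling this invertible factor,    *)
(* the equation between the coefficients of z^-l is                            *)
(*   S_l L + S_(l-1) B - (l-1) S_(l-1) = sum_(j <= l) A_(l-j) S_j,             *)
(* where the terms in S_(l-1) are absent for l = 0.                            *)
Definition formal_solution (R : realType) (n : nat)
    (A S : nat -> 'M[R[i]]_n) (B L : 'M[R[i]]_n) : Prop :=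
  forall l : nat,
    S l *m L + (if l is k.+1 then S k *m B - k%:R *: S k else 0)
    = \sum_(j < l.+1) A (l - j)%N *m S j.

(* The expression (ii), for l >= 2, at one value of t.                         *)
Definition obstruction (R : realType) (n : nat) (Ah F : nat -> 'M[R[i]]_n)
    (l : nat) (a b : 'I_n) : R[i] :=
  (Ah 1%N a a - Ah 1%N b b + (l.-1)%:R) * F l.-1 a b
  + \sum_(g < n | g != a) Ah 1%N a g * F l.-1 g b
  + \sum_(1 <= j < l.-1) (Ah (l - j)%N *m F j) a b
  + Ah l a b.

Definition bigO_on (R : realType) (T : Type) (S : set T) (f g : T -> R[i]) :
    Prop :=
  exists K : R, forall t, S t -> `|f t| <= K%:C * `|g t|.

(* (i) and (ii) are O(u_a - u_b) on V, for the pairs a != b coalescing in V.   *)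
(* F, hence (ii), is only meaningful off the coalescence locus.                *)
Definition vanish_as_gaps (R : realType) (m n : nat)
    (u : 'rV[R[i]]_m -> 'rV[R[i]]_n) (Ah F : nat -> 'rV[R[i]]_m -> 'M[R[i]]_n)
    (V : set 'rV[R[i]]_m) : Prop :=
  forall a b : 'I_n, a != b -> (exists2 t, V t & u t 0 a = u t 0 b) ->
    bigO_on V (fun t => Ah 1%N t a b) (fun t => u t 0 a - u t 0 b) /\
    forall l : nat, (2 <= l)%N ->
      bigO_on (V `\` coalescence u)
        (fun t => obstruction (Ah^~ t) (F^~ t) l a b)
        (fun t => u t 0 a - u t 0 b).

(* Pointwise vanishing of (i) and (ii) at the points of S where u_a = u_b; the *)
(* value of (ii) at such a point is its limit from outside the locus.  This is *)
(* weaker than O(u_a - u_b) where u_a - u_b has multiple zeros: for m = 1,     *)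
(* u_a - u_b = t^2, the function t is zero along the locus.                    *)
Definition zero_along (R : realType) (m n : nat)
    (u : 'rV[R[i]]_m -> 'rV[R[i]]_n) (Ah F : nat -> 'rV[R[i]]_m -> 'M[R[i]]_n)
    (S : set 'rV[R[i]]_m) : Prop :=
  forall (t : 'rV[R[i]]_m) (a b : 'I_n), S t -> a != b -> u t 0 a = u t 0 b ->
    Ah 1%N t a b = 0 /\
    forall l : nat, (2 <= l)%N ->
      (obstruction (Ah^~ s) (F^~ s) l a b : R[i]^o)
        @[s --> within (~` coalescence u) (nbhs t)] --> (0 : R[i]^o).

(* u_a - u_b vanishes to first order only, at each point of S where it does.   *)
Definition simple_coalescence (R : realType) (m n : nat)
    (u : 'rV[R[i]]_m -> 'rV[R[i]]_n) (S : set 'rV[R[i]]_m) : Prop :=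
  forall (t : 'rV[R[i]]_m) (a b : 'I_n), S t -> a != b -> u t 0 a = u t 0 b ->
    exists v : 'rV[R[i]]_m, 'D_v u t 0 a != 'D_v u t 0 b.

(* Main.v *)
(* By the recursion, every entry of F_k is a holomorphic function divided by a
   power of the product of the gaps u_a - u_b. Such a function extends
   holomorphically across Delta near a point as soon as it is bounded near that
   point off Delta: it is recovered by Cauchy's formula on circles x + s v,
   |s| = 1, in a direction v for which the product of the gaps vanishes at most
   at the center. The circles do not depend on k, so that all the F_k extend to
   one and the same ball. It remains to compare boundedness with (i) and (ii):
   these are (u_b - u_a) (F_l)_{ab}, hence O(u_a - u_b) exactly when (F_l)_{ab}
   is bounded, and the diagonal entries and the entries of non-coalescing pairs
   stay bounded by the recursion. If u_a - u_b has only simple zeros, a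
   holomorphic function vanishing on its zero set is O(u_a - u_b). *)
Require Import Defs.
From HB Require Import structures.
From mathcomp Require Import all_boot all_order all_algebra.
From mathcomp Require Import complex.
From mathcomp Require Import all_classical all_reals all_analysis.
From mathcomp Require Import ring lra.

Set Implicit Arguments.
Unset Strict Implicit.
Unset Printing Implicit Defensive.

Import Order.TTheory GRing.Theory Num.Theory.
Import numFieldNormedType.Exports.

Local Open Scope classical_set_scope.
Local Open Scope ring_scope.
Local Open Scope complex_scope.

(** * Modulus and generalized limits *)

(** Everything rests on means over the unit circle, taken as limits along one ultrafilter of
    averages over roots of unity of order a power of 2. Such a limit exists for every bounded
    function, is linear and respects bounds, so means can be manipulated freely; estimates enter
    only where a mean has to be computed. In several variables the obstacle is that Delta may be
    singular and that the gaps may vanish to any order. On a one-dimensional slice where the product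
    of the gaps is not identically zero, its zeros are isolated and the singularities of the
    quotient are removable; the mean over the slice is then holomorphic in the center of the slice.
    A second obstacle is that the neighbourhood on which F_k is bounded may shrink with k. The
    Cauchy integral is therefore identified with the quotient only very near the given point, and
    the identity theorem carries the equation to a ball whose radius is fixed beforehand. *)

Section RealNorm.
Context {R : realType}.

(** The norm takes its values in R[i], whose order is partial; its real part moves all estimates to
    R, where [lra] and [nra] apply. *)
Definition nm (V : normedZmodType R[i]) (x : V) : R := complex.Re `|x|.

Lemma nmE (V : normedZmodType R[i]) (x : V) : `|x| = (nm x)%:C.
Proof. by rewrite /nm RRe_real ?normr_real. Qed.

Lemma nm_ge0 (V : normedZmodType R[i]) (x : V) : 0 <= nm x.
Proof. by rewrite -ler0c -nmE. Qed.

Lemma nm0 (V : normedZmodType R[i]) : nm (0 : V) = 0.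
Proof. by rewrite /nm normr0. Qed.

Lemma nm_eq0 (V : normedZmodType R[i]) (x : V) : (nm x == 0) = (x == 0).
Proof. by rewrite -(normr_eq0 x) nmE eq_complex /= eqxx andbT. Qed.

Lemma nm_gt0 (V : normedZmodType R[i]) (x : V) : (0 < nm x) = (x != 0).
Proof. by rewrite lt_def nm_ge0 andbT nm_eq0. Qed.

Lemma nmN (V : normedZmodType R[i]) (x : V) : nm (- x) = nm x.
Proof. by rewrite /nm normrN. Qed.

Lemma nmC (V : normedZmodType R[i]) (x y : V) : nm (x - y) = nm (y - x).
Proof. by rewrite -nmN opprB. Qed.

Lemma nmD (V : normedZmodType R[i]) (x y : V) : nm (x + y) <= nm x + nm y.
Proof. by rewrite -lecR rmorphD /= -!nmE ler_normD. Qed.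

Lemma nmB (V : normedZmodType R[i]) (x y : V) : nm (x - y) <= nm x + nm y.
Proof. by rewrite -(nmN y) nmD. Qed.

Lemma nm_sub (V : normedZmodType R[i]) (x y z : V) :
  nm (x - z) <= nm (x - y) + nm (y - z).
Proof. by rewrite -[x - z](subrKA y) nmD. Qed.

Lemma nm_lbB (V : normedZmodType R[i]) (x y : V) : nm x - nm y <= nm (x - y).
Proof. by rewrite lerBlDr -{1}(subrK y x) nmD. Qed.

Lemma nmZ (V : normedModType R[i]) (a : R[i]) (x : V) :
  nm (a *: x) = nm a * nm x.
Proof. by apply: complexI; rewrite rmorphM /= -!nmE normrZ. Qed.

Lemma nmM (a b : R[i]) : nm (a * b) = nm a * nm b.
Proof. by apply: complexI; rewrite rmorphM /= -!nmE normrM. Qed.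

Lemma nm1 : nm (1 : R[i]) = 1.
Proof. by rewrite /nm normr1. Qed.

Lemma nmX (a : R[i]) k : nm (a ^+ k) = nm a ^+ k.
Proof. by elim: k => [|k IH]; rewrite ?expr0 ?nm1 // !exprS nmM IH. Qed.

Lemma nmV (a : R[i]) : nm a^-1 = (nm a)^-1.
Proof. by apply: complexI; rewrite -nmE normfV nmE fmorphV. Qed.

Lemma nm_real (x : R) : nm (x%:C) = `|x|.
Proof. by rewrite /nm normc_def /= expr0n /= addr0 sqrtr_sqr. Qed.

Lemma nm_nat k : nm (k%:R : R[i]) = k%:R.
Proof. by rewrite -(rmorph_nat (real_complex R)) nm_real normr_nat. Qed.

Lemma nm_sum (V : normedZmodType R[i]) (I : Type) (r : seq I) (P : pred I)
    (F : I -> V) :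
  nm (\sum_(i <- r | P i) F i) <= \sum_(i <- r | P i) nm (F i).
Proof.
elim/big_ind2: _ => [|a b c d ab cd|//]; first by rewrite nm0.
by rewrite (le_trans (nmD _ _)) ?lerD.
Qed.

Lemma nm_sqr (z : R[i]) : nm z ^+ 2 = complex.Re z ^+ 2 + complex.Im z ^+ 2.
Proof. by apply: complexI; rewrite rmorphXn /= -nmE -add_Re2_Im2. Qed.

Lemma Re_le_nm (z : R[i]) : `|complex.Re z| <= nm z.
Proof.
rewrite -ler_sqr ?nnegrE ?nm_ge0 // nm_sqr real_normK ?num_real //.
by rewrite lerDl sqr_ge0.
Qed.

Lemma Im_le_nm (z : R[i]) : `|complex.Im z| <= nm z.
Proof.
rewrite -ler_sqr ?nnegrE ?nm_ge0 // nm_sqr real_normK ?num_real //.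
by rewrite lerDr sqr_ge0.
Qed.

Lemma nm_le_ReIm (z : R[i]) : nm z <= `|complex.Re z| + `|complex.Im z|.
Proof.
rewrite -ler_sqr ?nnegrE ?nm_ge0 ?addr_ge0 // nm_sqr sqrrD.
rewrite !real_normK ?num_real // lerD2r lerDl pmulrn_lge0 // mulr_ge0 //.
Qed.

Lemma le0_small (V : normedZmodType R[i]) (x : V) (C : R) :
  (forall e : R, 0 < e -> nm x <= C * e) -> x = 0.
Proof.
move=> H; apply/eqP; rewrite -nm_eq0 eq_le nm_ge0 andbT leNgt; apply/negP => p.
have [C0|C0] := leP C 0.
  by have := H 1 ltr01; rewrite mulr1 leNgt (le_lt_trans C0 p).
have C2 : 0 < 2 * C by lra.
have := H (nm x / (2 * C)) (divr_gt0 p C2).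
have -> : C * (nm x / (2 * C)) = nm x / 2 by field; rewrite gt_eqF.
lra.
Qed.

End RealNorm.

(* Limits of bounded complex sequences along one fixed nonprincipal ultrafilter:
   this gives a linear functional, and every bounded sequence has a limit. *)
Section UltraLimit.
Context {R : realType}.

Definition ultra_nat : set_system nat := projT1 (cid (ultraFilterLemma
  (eventually_filter : ProperFilter (\oo : set_system nat)))).

#[local] Notation U := ultra_nat.

#[global] Instance ultra_natP : UltraFilter U.
Proof. by rewrite /U; case: cid => G []. Qed.

#[global] Instance ultra_nat_proper : ProperFilter ultra_nat.
Proof. exact: ultra_proper. Qed.

#[global] Instance ultra_nat_filter : Filter ultra_nat.
Proof. exact: filter_filter. Qed.

Lemma ultra_ge (P : set nat) N : (forall k, (N <= k)%N -> P k) -> U P.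
Proof.
move=> h; have : \oo `<=` U by rewrite /U; case: cid => G [].
by apply; exists N.
Qed.

Lemma ultra_near (P : set nat) : (\forall k \near \oo, P k) -> U P.
Proof. by move=> [N _ h]; apply: (@ultra_ge _ N). Qed.

Lemma ultra2 (A B P : set nat) :
  U A -> U B -> (forall k, A k -> B k -> P k) -> U P.
Proof. by move=> UA UB h; apply: filterS2 UA UB => k; apply: h. Qed.

Lemma ultraN (P : set nat) : U P -> exists k, P k.
Proof. exact: filter_ex. Qed.

(** The image of the ultrafilter under x is again an ultrafilter and contains the compact segment
    [-B, B], so it converges. *)
Lemma real_ulim_ex (x : nat -> R) (B : R) : (forall k, `|x k| <= B) ->
  exists l, forall e : R, 0 < e -> U [set k | `|x k - l| < e].
Proof.
move=> xB; pose G : set_system R := x @ U.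
have GU : UltraFilter G.
  split=> [|H HF GH]; first exact: fmap_proper_filter.
  rewrite eqEsubset; split=> // A HA.
  have [//|h] := @in_ultra_setVsetC _ U (x @^-1` A) ultra_natP.
  have /(@filterI _ H _ _ _ HA) : H (~` A) by apply: GH.
  by rewrite setICr => /filter_ex[].
have := @segment_compact R (- B) B; rewrite compact_ultra => /(_ G GU) [].
  by apply: (@ultra_ge _ 0) => k _ /=; rewrite in_itv /= -ler_norml.
move=> l [_ Gl]; exists l => e e0.
have /Gl : nbhs l (ball l e) by exact: nbhsx_ballx.
by apply: (@filterS _ U) => k; rewrite /= distrC.
Qed.

Definition is_ulim (V : normedZmodType R[i]) (x : nat -> V) (l : V) :=
  forall e : R, 0 < e -> U [set k | nm (x k - l) < e].

Definition bounded_seq (x : nat -> R[i]) := exists B, forall k, nm (x k) <= B.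

Definition ulim (x : nat -> R[i]) : R[i] := xget 0 [set l | is_ulim x l].

Lemma ulimP (x : nat -> R[i]) : bounded_seq x -> is_ulim x (ulim x).
Proof.
move=> [B xB]; apply: (@xgetPex _ 0 [set l | is_ulim x l]).
have [a ha] := @real_ulim_ex (fun k => complex.Re (x k)) B
  (fun k => le_trans (Re_le_nm _) (xB k)).
have [b hb] := @real_ulim_ex (fun k => complex.Im (x k)) B
  (fun k => le_trans (Im_le_nm _) (xB k)).
exists (a +i* b) => e e0; have e20 : 0 < e / 2 by rewrite divr_gt0.
apply: (ultra2 (ha _ e20) (hb _ e20)) => k /= h1 h2.
apply: (le_lt_trans (nm_le_ReIm _)); rewrite [e]splitr.
by case: (x k) h1 h2 => u v /= h1 h2; rewrite ltrD.
Qed.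

Lemma is_ulim_le (V : normedZmodType R[i]) (x : nat -> V) (l c : V) (B : R) :
  is_ulim x l -> U [set k | nm (x k - c) <= B] -> nm (l - c) <= B.
Proof.
move=> xl xc; rewrite leNgt; apply/negP => lt.
move: lt; rewrite -subr_gt0 => /xl xl'.
have [k [/= h1 h2]] := ultraN (ultra2 xl' xc (fun k h h' => conj h h')); have := nm_sub l (x k) c; rewrite (nmC l (x k)).
lra.
Qed.

Lemma is_ulim_uniq (V : normedZmodType R[i]) (x : nat -> V) (l c : V) :
  is_ulim x l -> is_ulim x c -> l = c.
Proof.
move=> xl xc; apply: subr0_eq; apply: (@le0_small R V _ 1) => e e0.
rewrite mul1r; apply: (is_ulim_le xl).
by apply: filterS (xc _ e0) => k /= /ltW.
Qed.

Lemma ulimE (x : nat -> R[i]) l : is_ulim x l -> ulim x = l.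
Proof.
move=> xl; apply: (is_ulim_uniq _ xl).
by apply: (@xgetPex _ 0 [set l | is_ulim x l]); exists l.
Qed.

Lemma is_ulimD (x y : nat -> R[i]) l c : is_ulim x l -> is_ulim y c ->
  is_ulim (fun k => x k + y k) (l + c).
Proof.
move=> xl yc e e0; have e20 : 0 < e / 2 by rewrite divr_gt0.
apply: (ultra2 (xl _ e20) (yc _ e20)) => k /= h1 h2.
rewrite opprD addrACA (le_lt_trans (nmD _ _)) // [e]splitr.
by rewrite ltrD.
Qed.

Lemma is_ulimZ (x : nat -> R[i]) l (a : R[i]) : is_ulim x l ->
  is_ulim (fun k => a * x k) (a * l).
Proof.
move=> xl e e0; have d0 : 0 < nm a + 1 by rewrite ltr_wpDl ?nm_ge0.
apply: filterS (xl _ (divr_gt0 e0 d0)) => k /= h.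
rewrite -mulrBr nmM; rewrite ltr_pdivlMr // in h.
apply: le_lt_trans h; rewrite mulrC ler_wpM2l ?nm_ge0 //; lra.
Qed.

Lemma is_ulim_near (V : normedZmodType R[i]) (x y : nat -> V) (l : V) :
  (forall e : R, 0 < e -> U [set k | nm (y k - x k) < e]) -> is_ulim x l ->
  is_ulim y l.
Proof.
move=> xy xl e e0; have e20 : 0 < e / 2 by rewrite divr_gt0.
apply: (ultra2 (xl _ e20) (xy _ e20)) => k /= h1 h2.
by rewrite (le_lt_trans (nm_sub _ (x k) _)) // [e]splitr ltrD.
Qed.

End UltraLimit.

(** * Complex derivatives and Goursat's lemma *)

Section ComplexDerivative.
Context {R : realType}.
Implicit Types (f g : R[i] -> R[i]) (z w a b c : R[i]).

(** The inequality for increments replaces the difference quotient, so that w = z needs no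
    exception. *)
Definition cderiv f z L := forall e : R, 0 < e -> exists2 d : R, 0 < d &
  forall w, nm (w - z) < d -> nm (f w - f z - L * (w - z)) <= e * nm (w - z).

Definition cdiff f z := exists L, cderiv f z L.

Definition ccont f z := forall e : R, 0 < e -> exists2 d : R, 0 < d &
  forall w, nm (w - z) < d -> nm (f w - f z) <= e.

Lemma cdiff_cont f z : cdiff f z -> ccont f z.
Proof.
move=> [L /(_ 1 ltr01)[d d0 fd]] e e0; have K0 : 0 < nm L + 1.
  by rewrite ltr_wpDl ?nm_ge0.
exists (Num.min d (e / (nm L + 1))); first by rewrite lt_min d0 divr_gt0.
move=> w; rewrite lt_min ltr_pdivlMr // => /andP[/fd fw we].
rewrite -[f w - f z](subrK (L * (w - z))) (le_trans (nmD _ _)) // nmM.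
lra.
Qed.

Lemma is_ulim_cont f x z : ccont f z -> is_ulim x z ->
  is_ulim (fun k => f (x k)) (f z).
Proof.
move=> fz xz e e0; have e20 : 0 < e / 2 by rewrite divr_gt0.
have [d d0 fd] := fz _ e20; apply: filterS (xz _ d0) => k /= /fd h.
by apply: le_lt_trans h _; lra.
Qed.

Lemma bounded_ulim (x : nat -> R[i]) r : (forall k, nm (x k) <= r) ->
  exists2 z, is_ulim x z & nm z <= r.
Proof.
move=> xr; have xz : is_ulim x (ulim x) by apply: ulimP; exists r.
exists (ulim x) => //; rewrite -[ulim x]subr0.
apply: (is_ulim_le xz); apply: (@ultra_ge _ 0) => k _ /=.
by rewrite subr0.
Qed.

Lemma ultra_inv (e : R) : 0 < e -> ultra_nat [set k | k.+1%:R^-1 < e].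
Proof.
by move=> e0; apply: ultra_near; apply: (near_infty_natSinv_lt (PosNum e0)).
Qed.

Lemma is_ulim_inv_near (V : normedZmodType R[i]) (x y : nat -> V) (l : V) :
  (forall k, nm (y k - x k) <= k.+1%:R^-1) -> is_ulim x l -> is_ulim y l.
Proof.
move=> h; apply: is_ulim_near => e /ultra_inv.
by apply: filterS => k /=; apply: le_lt_trans.
Qed.

(** Otherwise there are pairs at distance at most 1/(k+1) violating the bound. Being bounded they
    have a common limit along the ultrafilter, and continuity there is contradicted; the ultrafilter
    replaces the extraction of subsequences. *)
Lemma disc_unif_cont f r : (forall z, nm z <= r -> ccont f z) ->
  forall e : R, 0 < e -> exists2 d : R, 0 < d & forall z w,
    nm z <= r -> nm w <= r -> nm (w - z) < d -> nm (f w - f z) <= e.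
Proof.
move=> fc e e0; apply: contrapT => N.
have /choice[z hz] : forall k : nat, exists z, nm z <= r /\ exists w,
    [/\ nm w <= r, nm (w - z) <= k.+1%:R^-1 & e < nm (f w - f z)].
  move=> k; apply: contrapT => Nk; apply: N.
  exists (k.+1%:R^-1) => [|z w zr wr zw]; first by rewrite invr_gt0.
  rewrite leNgt; apply/negP => h; apply: Nk; exists z; split=> //.
  by exists w; split=> //; apply: ltW.
have /choice[w hw] : forall k : nat, exists w,
    [/\ nm w <= r, nm (w - z k) <= k.+1%:R^-1 & e < nm (f w - f (z k))].
  by move=> k; have [_] := hz k.
have [l zl lr] := @bounded_ulim z r (fun k => (hz k).1).
have wl : is_ulim w l by apply: is_ulim_inv_near zl => k; have [] := hw k.
have e20 : 0 < e / 2 by rewrite divr_gt0.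
have := is_ulim_cont (fc _ lr) zl e20.
have := is_ulim_cont (fc _ lr) wl e20 => h1 h2.
have [k [/= {}h1 {}h2]] := ultraN (ultra2 h1 h2 (fun k h h' => conj h h')).
have [_ _] := hw k; have := nm_sub (f (w k)) (f l) (f (z k)).
rewrite (nmC (f l)); lra.
Qed.

Lemma disc_bounded f r : (forall z, nm z <= r -> ccont f z) ->
  exists B : R, forall z, nm z <= r -> nm (f z) <= B.
Proof.
move=> fc; apply: contrapT => N.
have /choice[z hz] : forall k : nat, exists z, nm z <= r /\ k%:R < nm (f z).
  move=> k; apply: contrapT => Nk; apply: N; exists k%:R => z zr.
  by rewrite leNgt; apply/negP => h; apply: Nk; exists z.
have [l zl lr] := @bounded_ulim z r (fun k => (hz k).1).
have := is_ulim_cont (fc _ lr) zl ltr01 => h1.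
have h2 : ultra_nat [set k | (Num.bound (nm (f l) + 1) <= k)%N].
  exact: (ultra_ge (fun k h => h)).
have [k [/= {}h1 {}h2]] := ultraN (ultra2 h1 h2 (fun k h h' => conj h h')).
have [_] := hz k; have := nm_sub (f (z k)) (f l) 0; rewrite !subr0.
have := archimedean.Num.Theory.archi_boundP (addr_ge0 (nm_ge0 (f l)) ler01).
rewrite -(ler_nat R) in h2; lra.
Qed.

End ComplexDerivative.

(** * Midpoint sums along segments *)

Section SegmentIntegral.
Context {R : realType}.
Implicit Types (f g : R[i] -> R[i]) (z w a b c : R[i]).

(** The midpoint rule for the integral of f over [a, b], with 2^n equal pieces. *)
Fixpoint msum f n a b : R[i] :=
  if n is k.+1 then msum f k a ((a + b) / 2) + msum f k ((a + b) / 2) b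
  else (b - a) * f ((a + b) / 2).

Lemma msum_anti f n a b : msum f n b a = - msum f n a b.
Proof.
elim: n a b => [|n IH] a b /=; first by rewrite (addrC b) -mulNr opprB.
rewrite (addrC b a) (IH ((a + b) / 2) b) (IH a ((a + b) / 2)); ring.
Qed.

(** The midpoint rule is exact on affine functions, so Goursat's argument can subtract the linear
    part of f without an error term. *)
Lemma msum_affine f p q n a b :
  msum (fun z => f z - (p + q * z)) n a b =
  msum f n a b - (p * (b - a) + q * (b ^+ 2 - a ^+ 2) / 2).
Proof.
elim: n a b => [|n IH] a b /=; first by field.
by rewrite !IH; field.
Qed.

Lemma half_subl a b : (a + b) / 2 - a = (b - a) / 2 :> R[i].
Proof. by field. Qed.

Lemma half_subr a b : b - (a + b) / 2 = (b - a) / 2 :> R[i].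
Proof. by field. Qed.

Lemma nm_half z : nm (z / 2) = nm z / 2.
Proof. by rewrite nmM nmV nm_nat. Qed.

(** Closure under midpoints is enough: all points at which the sums evaluate f arise from the
    endpoints by iterated midpoints. *)
Definition midconvex (P : set R[i]) :=
  forall a b, P a -> P b -> P ((a + b) / 2).

Lemma midconvex_disc c r : midconvex [set z | nm (z - c) <= r].
Proof.
move=> a b /= ar br.
have -> : (a + b) / 2 - c = (a - c) / 2 + (b - c) / 2 by field.
by rewrite (le_trans (nmD _ _)) // !nm_half; lra.
Qed.

Lemma midconvexI P Q : midconvex P -> midconvex Q -> midconvex (P `&` Q).
Proof. by move=> hP hQ a b [? ?] [? ?]; split; [apply: hP|apply: hQ]. Qed.

Lemma msum_bound f P e n a b : midconvex P ->
  (forall z, P z -> nm (f z) <= e) -> P a -> P b ->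
  nm (msum f n a b) <= e * nm (b - a).
Proof.
move=> Pm Pf; elim: n a b => [|n IH] a b Pa Pb /=.
  by rewrite nmM mulrC ler_wpM2r ?nm_ge0 // Pf //; apply: Pm.
rewrite (le_trans (nmD _ _)) //; have Pc := Pm _ _ Pa Pb.
have := IH _ _ Pa Pc; have := IH _ _ Pc Pb.
by rewrite half_subl half_subr nm_half; lra.
Qed.

(** Refinement replaces the midpoint of each piece by two points at a quarter of its length. At
    level n the pieces are shorter than d, so the values of f change by at most e. *)
Lemma msum_step f P e d n a b : midconvex P ->
  (forall z w, P z -> P w -> nm (w - z) < d -> nm (f w - f z) <= e) ->
  P a -> P b -> nm (b - a) < d * 2 ^+ n ->
  nm (msum f n.+1 a b - msum f n a b) <= e * nm (b - a).
Proof.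
move=> Pm Pf; elim: n a b => [|n IH] a b Pa Pb hd.
  have Pc := Pm _ _ Pa Pb; rewrite /= half_subl half_subr.
  set m := (a + b) / 2; set m1 := (a + m) / 2; set m2 := (m + b) / 2.
  have -> : (b - a) / 2 * f m1 + (b - a) / 2 * f m2 - (b - a) * f m =
    (b - a) / 2 * (f m1 - f m) + (b - a) / 2 * (f m2 - f m) by field.
  have h x : nm x / 2 / 2 <= nm (x : R[i]) by have := nm_ge0 x; lra.
  rewrite (le_trans (nmD _ _)) // !nmM nmV nm_nat.
  have e1 : nm (m1 - m) = nm (b - a) / 2 / 2.
    by rewrite nmC -!nm_half /m1 /m; congr nm; field.
  have e2 : nm (m2 - m) = nm (b - a) / 2 / 2.
    by rewrite -!nm_half /m2 /m; congr nm; field.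
  have := nm_ge0 (b - a) => b0; rewrite expr0 mulr1 in hd.
  have f1 : nm (f m1 - f m) <= e.
    by apply: Pf => //; [apply: Pm|rewrite e1; lra].
  have f2 : nm (f m2 - f m) <= e.
    by apply: Pf => //; [apply: Pm|rewrite e2; lra].
  nra.
have Pc := Pm _ _ Pa Pb.
rewrite [msum f n.+2]/= -/(msum f n.+1) [msum f n.+1 a b]/=.
have -> : forall x y z t : R[i], x + y - (z + t) = (x - z) + (y - t).
  by move=> *; ring.
have hd' : nm ((b - a) / 2) < d * 2 ^+ n.
  by rewrite nm_half ltr_pdivrMr // -mulrA -exprSr.
have := IH _ _ Pa Pc; have := IH _ _ Pc Pb.
rewrite half_subl half_subr => /(_ hd') h1 /(_ hd') h2.
by rewrite (le_trans (nmD _ _)) //; rewrite nm_half in h1 h2; lra.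
Qed.

End SegmentIntegral.

(** * Goursat's theorem and primitives on a disc *)

Section Goursat.
Context {R : realType} (f : R[i] -> R[i]) (r : R).
Hypothesis f_cont : forall z, nm z <= r -> ccont f z.
Implicit Types (z w a b c : R[i]).

Definition sint a b := ulim (fun n => msum f n a b).

#[local] Notation disc := [set z : R[i] | nm z <= r].

Lemma disc_midconvex : midconvex disc.
Proof. by move=> a b; have := @midconvex_disc R 0 r a b; rewrite /= !subr0. Qed.

Lemma sintP a b : disc a -> disc b ->
  is_ulim (fun n => msum f n a b) (sint a b).
Proof.
move=> ra rb; apply: ulimP; have [B fB] := disc_bounded f_cont.
by exists (B * nm (b - a)) => k; apply: (msum_bound _ disc_midconvex).
Qed.

(** By definition the sum of level n + 1 is that of level n over the two halves, but limits along an
    ultrafilter are not shift invariant. One also needs that consecutive levels become close, which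
    is [msum_step]. *)
Lemma sint_half a b : disc a -> disc b ->
  sint a b = sint a ((a + b) / 2) + sint ((a + b) / 2) b.
Proof.
move=> ra rb; have rc := disc_midconvex ra rb.
have h1 := is_ulimD (sintP ra rc) (sintP rc rb).
apply: (is_ulim_uniq _ h1); apply: is_ulim_near (sintP ra rb) => e e0.
have K0 : 0 < nm (b - a) + 1 by rewrite ltr_wpDl ?nm_ge0.
have [d d0 fd] := disc_unif_cont f_cont (divr_gt0 e0 (mulr_gt0 (ltr0Sn _ 1) K0)).
have := archimedean.Num.Theory.archi_boundP (divr_ge0 (nm_ge0 (b - a)) (ltW d0)).
set N := Num.bound _ => hN; apply: (@ultra_ge _ N) => k Nk /=.
have : nm (b - a) < d * 2 ^+ k.
  rewrite mulrC -ltr_pdivrMr // (lt_le_trans hN) //.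
  rewrite -natrX ler_nat (leq_trans Nk) // ltnW // ltn_expl //.
move=> /(msum_step disc_midconvex fd ra rb) /=; move/le_lt_trans; apply.
by rewrite mulrAC ltr_pdivrMr ?mulr_gt0 // ltr_pM2l //; lra.
Qed.

Lemma sint_anti a b : disc a -> disc b -> sint b a = - sint a b.
Proof.
move=> ra rb; apply: ulimE; rewrite -mulN1r.
apply: is_ulim_near (is_ulimZ (-1) (sintP ra rb)) => e e0.
by apply: (@ultra_ge _ 0) => k _ /=; rewrite msum_anti mulN1r subrr nm0.
Qed.

Lemma sint_affine P p q e a b : midconvex P ->
  (forall z, P z -> disc z) ->
  (forall z, P z -> nm (f z - (p + q * z)) <= e) -> P a -> P b ->
  nm (sint a b - (p * (b - a) + q * (b ^+ 2 - a ^+ 2) / 2)) <= e * nm (b - a).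
Proof.
move=> Pm Pd Pf Pa Pb; apply: (is_ulim_le (sintP (Pd _ Pa) (Pd _ Pb))).
apply: (@ultra_ge _ 0) => k _ /=; rewrite -msum_affine.
exact: (@msum_bound _ _ P).
Qed.

Definition tri (t : R[i] * R[i] * R[i]) :=
  sint t.1.1 t.1.2 + sint t.1.2 t.2 + sint t.2 t.1.1.

Definition tri_in (P : set R[i]) (t : R[i] * R[i] * R[i]) :=
  [/\ P t.1.1, P t.1.2 & P t.2].

Definition tri_size (t : R[i] * R[i] * R[i]) (d : R) :=
  [/\ nm (t.1.2 - t.1.1) <= d, nm (t.2 - t.1.2) <= d & nm (t.1.1 - t.2) <= d].

Lemma tri_affine P p q e d t : midconvex P -> (forall z, P z -> disc z) ->
  (forall z, P z -> nm (f z - (p + q * z)) <= e) -> 0 <= e ->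
  tri_in P t -> tri_size t d -> nm (tri t) <= e * (3 * d).
Proof.
move: t => [[a b] c] Pm Pd Pf e0 [/= Pa Pb Pc] [/= ab bc ca].
have ha := sint_affine Pm Pd Pf Pa Pb.
have hb := sint_affine Pm Pd Pf Pb Pc.
have hc := sint_affine Pm Pd Pf Pc Pa.
rewrite /tri /=.
set A := p * (b - a) + _ in ha; set B := p * (c - b) + _ in hb.
set C := p * (a - c) + _ in hc.
have -> : sint a b + sint b c + sint c a =
  (sint a b - A) + (sint b c - B) + (sint c a - C).
  have : A + B + C = 0 by rewrite /A /B /C; field.
  move=> h; rewrite -[LHS]subr0 -h; ring.
rewrite (le_trans (nmD _ _)) //; have := nmD (sint a b - A) (sint b c - B).
nra.
Qed.

(** One bisection step: among the four triangles cut out by the midpoints of the sides, one carries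
    at least a quarter of the integral. The hypothesis on t stands under the existential so that
    [choice] yields a total map to iterate; the bound on the first vertex makes the iteration
    converge. *)
Lemma tri_step t : exists t', tri_in disc t ->
  [/\ tri_in disc t', forall d, tri_size t d -> tri_size t' (d / 2),
    forall d, tri_size t d -> nm (t'.1.1 - t.1.1) <= d &
    nm (tri t) <= 4 * nm (tri t')].
Proof.
have [|N] := pselect (tri_in disc t); last by exists t.
move: t => [[a b] c] [/= Da Db Dc].
set m := (a + b) / 2; set n := (b + c) / 2; set o := (c + a) / 2.
have Dm : disc m by apply: disc_midconvex.
have Dn : disc n by apply: disc_midconvex.
have Do : disc o by apply: disc_midconvex.
(* The sides of the middle triangle (m, n, o) cancel against the inner sides of the three corner
   triangles. *)
have split4 : tri (a, b, c) =
  tri (a, m, o) + tri (m, b, n) + (tri (o, n, c) + tri (m, n, o)).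
  rewrite /tri /= (sint_half Da Db) (sint_half Db Dc) (sint_half Dc Da).
  rewrite -/m -/n -/o (sint_anti Do Dm) (sint_anti Dm Dn) (sint_anti Dn Do).
  move: (sint a m) (sint m b) (sint b n) (sint n c) (sint c o) (sint o a).
  by move: (sint o m) (sint m n) (sint n o); clear; move=> *; ring.
have ma : m - a = (b - a) / 2 by rewrite /m; field.
have bm : b - m = (b - a) / 2 by rewrite /m; field.
have nb : n - b = (c - b) / 2 by rewrite /n; field.
have cn : c - n = (c - b) / 2 by rewrite /n; field.
have oc : o - c = (a - c) / 2 by rewrite /o; field.
have ao : a - o = (a - c) / 2 by rewrite /o; field.
have nm' : n - m = - ((a - c) / 2) by rewrite /n /m; field.
have on : o - n = - ((b - a) / 2) by rewrite /o /n; field.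
have mo : m - o = - ((c - b) / 2) by rewrite /o /m; field.
have om : o - m = (c - b) / 2 by rewrite /o /m; field.
have mn : m - n = (a - c) / 2 by rewrite /n /m; field.
have no : n - o = (b - a) / 2 by rewrite /n /o; field.
clearbody m n o.
have sizes d t : t \in [:: (a, m, o); (m, b, n); (o, n, c); (m, n, o)] ->
    tri_size (a, b, c) d -> tri_size t (d / 2) /\ nm (t.1.1 - a) <= d.
  move=> ht [/= h1 h2 h3]; have d0 := le_trans (nm_ge0 _) h1.
  have oa : nm (o - a) = nm (a - c) / 2 by rewrite nmC ao nm_half.
  move: ht; rewrite !inE => /or4P[] /eqP ->; rewrite /tri_size /=;
    rewrite ?subrr ?nm0 ?oa ?ma ?bm ?nb ?cn ?oc ?ao ?nm' ?on ?mo ?om ?mn ?no;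
    rewrite ?nmN ?nm_half; clear -h1 h2 h3 d0; (split; [split|]); lra.
have [t Dt ht]: exists2 t, tri_in disc t &
    t \in [:: (a, m, o); (m, b, n); (o, n, c); (m, n, o)] /\
    nm (tri (a, b, c)) <= 4 * nm (tri t).
  apply: contrapT => N.
  have {}N t : tri_in disc t ->
      t \in [:: (a, m, o); (m, b, n); (o, n, c); (m, n, o)] ->
      4 * nm (tri t) < nm (tri (a, b, c)).
    by move=> Dt ht; rewrite ltNge; apply/negP => h; apply: N; exists t.
  have h1 : 4 * nm (tri (a, m, o)) < nm (tri (a, b, c)).
    by apply: N; rewrite ?inE ?eqxx.
  have h2 : 4 * nm (tri (m, b, n)) < nm (tri (a, b, c)).
    by apply: N; rewrite ?inE ?eqxx ?orbT.
  have h3 : 4 * nm (tri (o, n, c)) < nm (tri (a, b, c)).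
    by apply: N; rewrite ?inE ?eqxx ?orbT.
  have h4 : 4 * nm (tri (m, n, o)) < nm (tri (a, b, c)).
    by apply: N; rewrite ?inE ?eqxx ?orbT.
  have h : nm (tri (a, b, c)) <= nm (tri (a, m, o)) + nm (tri (m, b, n)) +
      (nm (tri (o, n, c)) + nm (tri (m, n, o))).
    by rewrite split4 (le_trans (nmD _ _)) // lerD // nmD.
  have parts (x p q s t : R) : 4 * p < x -> 4 * q < x -> 4 * s < x ->
    4 * t < x -> x <= p + q + (s + t) -> False by clear; move=> *; lra.
  exact: parts h1 h2 h3 h4 h.
exists t => _; case: ht => ht htri.
by split=> // d hd; have [] := sizes d t ht hd.
Qed.

Hypothesis f_diff : forall z, nm z <= r -> cdiff f z.

Lemma goursat a b c : disc a -> disc b -> disc c -> tri (a, b, c) = 0.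
Proof.
move=> Da Db Dc; have [s hs] := choice tri_step.
pose T n := iter n s (a, b, c).
have DT n : tri_in disc (T n).
  by elim: n => [//|n IH] /=; have [] := hs _ IH.
pose D := nm (b - a) + nm (c - b) + nm (a - c).
have D0 : 0 <= D by rewrite !addr_ge0 ?nm_ge0.
have sT n : tri_size (T n) (D / 2 ^+ n).
  elim: n => [|n IH].
    have := nm_ge0 (b - a); have := nm_ge0 (c - b); have := nm_ge0 (a - c).
    by rewrite expr0 divr1 /D; split=> /=; lra.
  rewrite exprS [2 * _]mulrC invfM mulrA; have [_ + _ _] := hs _ (DT n); exact.
(* The first vertex moves by at most D / 2^n at step n; the difference on the right is the sum of
   this geometric series in telescoped form, convenient for induction. *)
have xT n k : nm ((T (n + k)%N).1.1 - (T n).1.1) <= 2 * (D / 2 ^+ n) - 2 * (D / 2 ^+ (n + k)).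
  elim: k => [|k IH]; first by rewrite addn0 !subrr nm0.
  have [_ _ /(_ _ (sT _)) + _] := hs _ (DT (n + k)%N); rewrite addnS /= -/(T _).
  have := nm_sub (s (T (n + k)%N)).1.1 (T (n + k)%N).1.1 (T n).1.1.
  have -> : D / 2 ^+ (n + k).+1 = D / 2 ^+ (n + k) / 2 by rewrite exprSr invfM mulrA.
  lra.
have triT n : nm (tri (a, b, c)) <= 4 ^+ n * nm (tri (T n)).
  elim: n => [|n IH]; first by rewrite mul1r.
  have [_ _ _ h] := hs _ (DT n); apply: (le_trans IH).
  by rewrite exprSr -mulrA ler_wpM2l ?exprn_ge0.
have [p xp pr] := @bounded_ulim R (fun n => (T n).1.1) r (fun n => let: And3 h _ _ := DT n in h).
have pT n : nm (p - (T n).1.1) <= 2 * (D / 2 ^+ n).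
  apply: (is_ulim_le xp); apply: (@ultra_ge _ n) => k nk /=.
  rewrite -(subnKC nk) (le_trans (xT _ _)) // gerBl mulr_ge0 // divr_ge0 //.
have [L fL] := f_diff pr.
(* The constant is 4^n times the radius 3 D / 2^n times three sides of length at most D / 2^n. *)
apply: (@le0_small R _ _ (9 * D ^+ 2)) => e e0; have [d d0 fd] := fL e e0.
have := archimedean.Num.Theory.archi_boundP (divr_ge0 (mulr_ge0 (ler0n _ 3) D0) (ltW d0)).
set n := Num.bound _ => hn.
(* The limit p is within 2 D / 2^n of the first vertex, and the other vertices are within a further
   D / 2^n. *)
pose rho := 3 * (D / 2 ^+ n).
have rd : rho < d.
  rewrite /rho mulrA ltr_pdivrMr ?exprn_gt0 // (mulrC d) -ltr_pdivrMr //.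
  by rewrite (lt_le_trans hn) // -natrX ler_nat ltnW // ltn_expl.
have r0 : 0 <= rho by rewrite mulr_ge0 // divr_ge0 // exprn_ge0.
pose P := disc `&` [set z | nm (z - p) <= rho].
have Pm : midconvex P by apply: midconvexI; [apply: disc_midconvex|apply: midconvex_disc].
have Pf z : P z -> nm (f z - ((f p - L * p) + L * z)) <= e * rho.
  move=> [_ /= zp]; have -> : f z - (f p - L * p + L * z) = f z - f p - L * (z - p) by ring.
  by rewrite (le_trans (fd _ (le_lt_trans zp rd))) // ler_wpM2l // ltW.
have PT : tri_in P (T n).
  have [h1 h2 h3] := DT n; have [k1 k2 k3] := sT n; have := pT n; rewrite nmC => k4.
  have q0 : 0 <= D / 2 ^+ n by rewrite divr_ge0 // exprn_ge0.
  split; split=> //=; rewrite /rho; first lra.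
    by have := nm_sub (T n).1.2 (T n).1.1 p; lra.
  by have := nm_sub (T n).2 (T n).1.1 p; rewrite (nmC (T n).2 (T n).1.1); lra.
have := tri_affine Pm (fun z h => h.1) Pf (mulr_ge0 (ltW e0) r0) PT (sT n).
move=> h; apply: (le_trans (triT n)).
apply: (le_trans (ler_wpM2l (exprn_ge0 n (ler0n R 4)) h)).
rewrite /rho; have -> : (4 : R) ^+ n = 2 ^+ n * 2 ^+ n by rewrite -exprMn; congr (_ ^+ _); ring.
by rewrite le_eqVlt; apply/orP; left; apply/eqP; field; rewrite expf_neq0.
Qed.

Hypothesis r_ge0 : 0 <= r.

(** By Goursat the increment of the primitive is the integral over [z, w], and uniform continuity
    compares f with f z there. Uniformity in z is the form that the means over the circle
    require. *)
Lemma primitive_unif (e : R) : 0 < e -> exists2 d : R, 0 < d & forall z w,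
  nm z <= r -> nm w <= r -> nm (w - z) < d ->
  nm (sint 0 w - sint 0 z - f z * (w - z)) <= e * nm (w - z).
Proof.
move=> e0; have [d d0 fd] := disc_unif_cont f_cont e0.
exists d => // z w zr wr zw; have D0 : disc 0 by rewrite /= nm0.
have := goursat D0 zr wr; rewrite /tri /= (sint_anti D0 wr) => h.
have -> : sint 0 w - sint 0 z = sint z w.
  by apply: subr0_eq; rewrite -[RHS]oppr0 -[in RHS]h; ring.
pose P := disc `&` [set u | nm (u - z) <= nm (w - z)].
have Pm : midconvex P by apply: midconvexI; [apply: disc_midconvex|apply: midconvex_disc].
have := @sint_affine P (f z) 0 e z w Pm (fun z h => h.1) _ _ _.
rewrite mul0r !mul0r addr0; apply => [u [/= ur uz]||].
- by rewrite mul0r addr0 fd // (le_lt_trans uz).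
- by split=> //=; rewrite subrr nm0 nm_ge0.
- by split=> /=.
Qed.

End Goursat.

(** * Means over the unit circle and Cauchy's formula *)

Section CircleMean.
Context {R : realType}.
Implicit Types (phi psi f g : R[i] -> R[i]) (z w : R[i]).

Definition sqrt_right z := if 0 <= complex.Re (sqrtc z) then sqrtc z else - sqrtc z.

Lemma sqrt_right_sqr z : sqrt_right z ^+ 2 = z.
Proof. by rewrite /sqrt_right; case: ifP; rewrite ?sqrrN sqr_sqrtc. Qed.

Lemma Re_sqrt_right z : 0 <= complex.Re (sqrt_right z).
Proof.
rewrite /sqrt_right; case: ifPn => //; rewrite -ltNge.
by case: (sqrtc z) => x y /= /ltW; rewrite oppr_ge0.
Qed.

(** Up to conjugation this is e^(i pi / 2^n). Taking square roots in the right half-plane makes the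
    sequence tend to 1. *)
Definition unity_root n : R[i] := iter n sqrt_right (- 1).

#[local] Notation om := unity_root.

Lemma unity_rootN1 n : om n ^+ (2 ^ n) = - 1.
Proof.
elim: n => [|n IH]; first by rewrite expr1.
by rewrite expnS exprM [om _]/= sqrt_right_sqr.
Qed.

Lemma unity_root1 n : om n ^+ (2 ^ n.+1) = 1.
Proof. by rewrite expnSr exprM unity_rootN1 sqrrN expr1n. Qed.

Lemma prim_unity_root n : (2 ^ n.+1).-primitive_root (om n).
Proof.
have [//|k pk] := prim_order_exists _ (unity_root1 n); first by rewrite expn_gt0.
move=> /(dvdn_pfactor _ _ (isT : prime 2))[j jn kj].
have [j1|jn'] := eqVneq j n.+1; first by rewrite -j1 -kj.
have : (k %| 2 ^ n)%N by rewrite kj dvdn_exp2l // -ltnS ltn_neqAle jn'.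
rewrite (prim_order_dvd pk) unity_rootN1 eq_sym -subr_eq0 opprK.
by rewrite -[1 + 1]/(2%:R) pnatr_eq0.
Qed.

Lemma nm_unity_root n : nm (om n) = 1.
Proof.
apply/eqP; rewrite -(@pexpr_eq1 _ _ (2 ^ n)) ?expn_gt0 ?nm_ge0 //.
by rewrite -nmX unity_rootN1 nmN nm1.
Qed.

Lemma nm_unity_rootX n k : nm (om n ^+ k) = 1.
Proof. by rewrite nmX nm_unity_root expr1n. Qed.

(** Factor omega_n - 1 = (omega_(n+1) - 1) (omega_(n+1) + 1). Since omega_(n+1) has modulus 1 and
    nonnegative real part, the square of the modulus of the second factor is at least 2, so the
    quantity is halved at each step. *)
Lemma unity_root_sub1 n : nm (om n - 1) ^+ 2 <= 4 / 2 ^+ n.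
Proof.
elim: n => [|n IH].
  rewrite expr0 divr1 -opprD nmN -[1 + 1]/(2%:R) nm_nat; lra.
have e1 : om n - 1 = (om n.+1 - 1) * (om n.+1 + 1).
  by rewrite -subr_sqr_1 [om n.+1]/= sqrt_right_sqr.
rewrite e1 nmM exprMn in IH; set x := nm (om n.+1 - 1) ^+ 2 in IH *.
have h2 : 2 <= nm (om n.+1 + 1) ^+ 2.
  have := nm_unity_root n.+1 => /(congr1 (fun x => x ^+ 2)).
  have : 0 <= complex.Re (om n.+1) := Re_sqrt_right (om n).
  rewrite !nm_sqr.
  case: (om n.+1) => a b /=; rewrite expr1n addr0 => a0; nra.
have x0 : 0 <= x by rewrite sqr_ge0.
have : x * 2 <= 4 / 2 ^+ n by apply: le_trans IH; rewrite ler_wpM2l.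
move=> h; rewrite exprSr invfM mulrA; lra.
Qed.

Lemma unity_root_cvg (e : R) : 0 < e -> exists N, forall n, (N <= n)%N ->
  nm (om n - 1) < e.
Proof.
move=> e0; have e20 : 0 < e ^+ 2 by rewrite exprn_gt0.
have := archimedean.Num.Theory.archi_boundP (divr_ge0 (ler0n _ 4) (ltW e20)).
set N := Num.bound _ => hN; exists N => n Nn.
rewrite -(@ltr_pXn2r _ 2) ?nnegrE ?nm_ge0 ?(ltW e0) //.
apply: (le_lt_trans (unity_root_sub1 n)); rewrite ltr_pdivrMr ?exprn_gt0 //.
rewrite mulrC -ltr_pdivrMr // (lt_le_trans hN) // -natrX ler_nat.
by rewrite (leq_trans Nn) // ltnW // ltn_expl.
Qed.

Definition circle_avg phi n : R[i] :=
  (2 ^ n.+1)%:R^-1 * \sum_(k < 2 ^ n.+1) phi (om n ^+ k).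

Lemma pow2_neq0 n : (2 ^ n)%:R != 0 :> R[i].
Proof. by rewrite pnatr_eq0 -lt0n expn_gt0. Qed.

Lemma circle_avg_le phi (B : R) n : (forall z, nm z = 1 -> nm (phi z) <= B) ->
  nm (circle_avg phi n) <= B.
Proof.
move=> h; rewrite nmM nmV nm_nat ler_pdivrMl ?ltr0n ?expn_gt0 //.
rewrite (le_trans (nm_sum _ _ _)) //.
apply: (@le_trans _ _ (\sum_(k < 2 ^ n.+1) B)).
  by apply: ler_sum => k _; rewrite h // nm_unity_rootX.
by rewrite sumr_const card_ord mulr_natl.
Qed.

(** For continuous phi this is the integral of phi(z) dz / (2 i pi z) over the unit circle. *)
Definition mean phi := ulim (circle_avg phi).

Definition circle_bounded phi :=
  exists B : R, forall z, nm z = 1 -> nm (phi z) <= B.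

Lemma meanP phi : circle_bounded phi -> is_ulim (circle_avg phi) (mean phi).
Proof. by move=> [B h]; apply: ulimP; exists B => k; apply: circle_avg_le. Qed.

Lemma eq_circle_avg phi psi n : (forall z, nm z = 1 -> phi z = psi z) ->
  circle_avg phi n = circle_avg psi n.
Proof.
by move=> h; congr (_ * _); apply: eq_bigr => k _; rewrite h // nm_unity_rootX.
Qed.

Lemma eq_mean phi psi : (forall z, nm z = 1 -> phi z = psi z) ->
  mean phi = mean psi.
Proof.
by move=> h; congr ulim; apply/funext => n; apply: eq_circle_avg.
Qed.

Lemma circle_boundedD phi psi : circle_bounded phi -> circle_bounded psi ->
  circle_bounded (fun z => phi z + psi z).
Proof.
move=> [A hA] [B hB]; exists (A + B) => z z1.
by rewrite (le_trans (nmD _ _)) // lerD ?hA ?hB.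
Qed.

Lemma circle_boundedM phi psi : circle_bounded phi -> circle_bounded psi ->
  circle_bounded (fun z => phi z * psi z).
Proof.
move=> [A hA] [B hB]; exists (A * B) => z z1.
by rewrite nmM ler_pM ?hA ?hB // nm_ge0.
Qed.

Lemma circle_bounded_cst c : circle_bounded (fun=> c).
Proof. by exists (nm c). Qed.

Lemma circle_boundedB phi psi : circle_bounded phi -> circle_bounded psi ->
  circle_bounded (fun z => phi z - psi z).
Proof.
move=> [A hA] [B hB]; exists (A + B) => z z1.
by rewrite (le_trans (nmB _ _)) // lerD ?hA ?hB.
Qed.

Lemma circle_bounded_id : circle_bounded id.
Proof. by exists 1 => z ->. Qed.

Lemma meanD phi psi : circle_bounded phi -> circle_bounded psi ->
  mean (fun z => phi z + psi z) = mean phi + mean psi.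
Proof.
move=> h1 h2; apply: ulimE; have := is_ulimD (meanP h1) (meanP h2).
by congr is_ulim; apply/funext => n; rewrite /circle_avg big_split mulrDr.
Qed.

Lemma meanZ c phi : circle_bounded phi -> mean (fun z => c * phi z) = c * mean phi.
Proof.
move=> h1; apply: ulimE; have := is_ulimZ c (meanP h1).
by congr is_ulim; apply/funext => n; rewrite /circle_avg -mulr_sumr mulrCA.
Qed.

Lemma meanB phi psi : circle_bounded phi -> circle_bounded psi ->
  mean (fun z => phi z - psi z) = mean phi - mean psi.
Proof.
move=> h1 h2; rewrite -mulN1r -meanZ // -meanD //.
  by apply: eq_mean => z _; rewrite mulN1r.
exact: circle_boundedM (circle_bounded_cst _) h2.
Qed.

Lemma mean_le phi (B : R) : (forall z, nm z = 1 -> nm (phi z) <= B) ->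
  nm (mean phi) <= B.
Proof.
move=> h; rewrite -[mean phi]subr0; apply: (is_ulim_le (meanP _)).
  by exists B.
by apply: (@ultra_ge _ 0) => k _ /=; rewrite subr0 circle_avg_le.
Qed.

Lemma mean_cst c : mean (fun=> c) = c.
Proof.
apply: ulimE => e e0; apply: (@ultra_ge _ 0) => n _ /=.
rewrite /circle_avg sumr_const card_ord -[c *+ _]mulr_natl mulKf ?pow2_neq0 //.
by rewrite subrr nm0.
Qed.

(* On the 2^n-th roots of unity dz is (omega - 1) z, so the averages of z g(z)
   are Riemann sums of the closed integral of g dz = dG. *)
Lemma mean_exact (G g : R[i] -> R[i]) :
  (forall e : R, 0 < e -> exists2 d : R, 0 < d & forall z w,
    nm z = 1 -> nm w = 1 -> nm (w - z) < d ->
    nm (G w - G z - g z * (w - z)) <= e * nm (w - z)) ->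
  mean (fun z => z * g z) = 0.
Proof.
move=> Gg; apply: ulimE => e e0; have e20 : 0 < e / 2 by rewrite divr_gt0.
have [d d0 hd] := Gg _ e20; have [N hN] := unity_root_cvg d0.
apply: (@ultra_ge _ N) => n /hN omd /=; rewrite subr0.
have om1 : 0 < nm (om n - 1).
  rewrite nm_gt0 subr_eq0; apply/eqP => h; have := unity_rootN1 n.
  rewrite h expr1n => /eqP; rewrite -subr_eq0 opprK -[1 + 1]/(2%:R).
  by rewrite pnatr_eq0.
set M := (2 ^ n.+1)%N.
have tele : \sum_(k < M) (G (om n ^+ k.+1) - G (om n ^+ k)) = 0.
  rewrite -(big_mkord xpredT (fun k => G (om n ^+ k.+1) - G (om n ^+ k))).
  by rewrite telescope_sumr // expr0 unity_root1 subrr.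
pose E k := G (om n ^+ k.+1) - G (om n ^+ k) - (om n - 1) * (om n ^+ k * g (om n ^+ k)).
have sE : \sum_(k < M) E k = - ((om n - 1) * \sum_(k < M) om n ^+ k * g (om n ^+ k)).
  by rewrite sumrB tele sub0r mulr_sumr.
have hE k : nm (E k) <= e / 2 * nm (om n - 1).
  have := hd (om n ^+ k) (om n ^+ k.+1) (nm_unity_rootX _ _) (nm_unity_rootX _ _).
  have -> : om n ^+ k.+1 - om n ^+ k = (om n - 1) * om n ^+ k.
    by rewrite mulrBl mul1r exprS.
  rewrite nmM nm_unity_rootX mulr1 => /(_ omd); congr (nm _ <= _).
  by rewrite /E; ring.
have : nm (\sum_(k < M) E k) <= \sum_(k < M) (e / 2 * nm (om n - 1)).
  by rewrite (le_trans (nm_sum _ _ _)) // ler_sum.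
rewrite sE nmN nmM sumr_const card_ord -mulr_natl.
rewrite /circle_avg nmM nmV nm_nat -/M => h.
have M0 : (0 : R) < M%:R by rewrite ltr0n expn_gt0.
rewrite ltr_pdivrMl // -(ltr_pM2l om1) (le_lt_trans h) //.
have : 0 < M%:R * (e * nm (om n - 1)) by rewrite !mulr_gt0.
lra.
Qed.

(** Cauchy's kernel 1 / (w - z) with an additional factor w, because [mean] integrates against dw /
    w. *)
Definition ckernel z w : R[i] := w / (w - z).

Lemma circle_sub_ge z w : nm w = 1 -> 1 - nm z <= nm (w - z).
Proof. by move=> w1; rewrite -w1 nm_lbB. Qed.

Lemma circle_sub_neq0 z w : nm z < 1 -> nm w = 1 -> w - z != 0.
Proof.
by move=> z1 w1; rewrite -nm_gt0 (lt_le_trans _ (circle_sub_ge z w1)) ?subr_gt0.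
Qed.

Lemma circle_bounded_inv z : nm z < 1 -> circle_bounded (fun w => (w - z)^-1).
Proof.
move=> z1; exists (1 - nm z)^-1 => w w1; rewrite nmV lef_pV2 ?posrE.
- exact: circle_sub_ge.
- by rewrite nm_gt0 circle_sub_neq0.
- by rewrite subr_gt0.
Qed.

Lemma circle_bounded_kernel z : nm z < 1 -> circle_bounded (ckernel z).
Proof.
by move=> z1; apply: circle_boundedM circle_bounded_id (circle_bounded_inv z1).
Qed.

(** At an N-th root of unity w one has 1 - z^N = w^N - z^N, which w - z divides with a geometric sum
    as quotient. Summing over all roots kills every term except the one with i = 0, by orthogonality
    of the powers of a primitive root. *)
Lemma circle_avg_kernel z n : nm z < 1 ->
  (1 - z ^+ (2 ^ n.+1)) * circle_avg (ckernel z) n = 1.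
Proof.
move=> z1; set N := (2 ^ n.+1)%N; have N0 : (0 < N)%N by rewrite expn_gt0.
rewrite /circle_avg -/N mulrCA mulr_sumr.
have -> : \sum_(k < N) (1 - z ^+ N) * ckernel z (om n ^+ k) =
  \sum_(k < N) \sum_(i < N) z ^+ i * (om n ^+ (N - i)) ^+ k.
  apply: eq_bigr => k _; have wz := circle_sub_neq0 z1 (nm_unity_rootX n k).
  rewrite /ckernel mulrA; apply: (mulIf wz); rewrite mulfVK //.
  have -> : (1 : R[i]) = (om n ^+ k) ^+ N by rewrite exprAC unity_root1 expr1n.
  rewrite subrXX mulrAC -mulrA mulrC; congr (_ * _).
  rewrite mulr_sumr; apply: eq_bigr => i _.
  rewrite mulrA -exprS mulrC -!exprM mulnC; congr (_ * _ ^+ (_ * _)).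
  by rewrite -subn1 -subnDA add1n subnS prednK // subn_gt0.
rewrite exchange_big /= (bigD1 (Ordinal N0)) //= [X in _ + X]big1 ?addr0.
  rewrite -mulr_sumr expr0 mul1r subn0 (eq_bigr (fun=> 1)) => [|k _]; last first.
    by rewrite unity_root1 expr1n.
  by rewrite sumr_const card_ord mulVf ?pow2_neq0.
move=> i i0; rewrite -mulr_sumr.
suff -> : \sum_(k < N) (om n ^+ (N - i)) ^+ k = 0 by rewrite mulr0.
have x1 : om n ^+ (N - i) != 1.
  rewrite -(prim_order_dvd (prim_unity_root n)) gtnNdvd ?subn_gt0 //.
  by rewrite ltn_subrL N0 andbT lt0n.
apply/eqP; rewrite -(mulrI_eq0 _ (@mulfI _ (om n ^+ (N - i) - 1) _)) ?subr_eq0 //.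
by rewrite -subrX1 exprAC unity_root1 expr1n subrr.
Qed.

Lemma mean_kernel z : nm z < 1 -> mean (ckernel z) = 1.
Proof.
move=> z1; apply: ulimE => e e0.
have q0 : 0 < e * (1 - nm z) by rewrite mulr_gt0 ?subr_gt0.
have : (fun n => nm z ^+ n) @ \oo --> (0 : R).
  by apply: cvg_expr; rewrite ger0_norm ?nm_ge0.
move/cvgrPdist_lt => /(_ _ q0) /ultra_near.
apply: filterS => n /=; rewrite sub0r normrN ger0_norm ?exprn_ge0 ?nm_ge0 // => h.
have := circle_avg_kernel n z1; set N := (2 ^ n.+1)%N; set a := circle_avg _ _ => ha.
have N0 : (0 < N)%N by rewrite expn_gt0.
have zN : nm (z ^+ N) <= nm z.
  by rewrite nmX -[leRHS]expr1 ler_wiXn2l ?nm_ge0 ?ltW.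
have zn : nm (z ^+ N) <= nm z ^+ n.
  rewrite nmX ler_wiXn2l ?nm_ge0 ?(ltW z1) //.
  by rewrite /N (leq_trans _ (ltnW (ltn_expl _ (isT : (1 < 2)%N)))).
have dz : 1 - nm z <= nm (1 - z ^+ N).
  by have := nm_lbB 1 (z ^+ N); rewrite nm1; lra.
have e1 : (1 - z ^+ N) * (a - 1) = z ^+ N by rewrite mulrBr ha; ring.
have := congr1 (@nm R _) e1; rewrite nmM => e2; have := nm_ge0 (a - 1) => a0.
have : nm (a - 1) * (1 - nm z) < e * (1 - nm z).
  apply: le_lt_trans h; apply: le_trans zn; rewrite -e2 mulrC.
  by rewrite ler_wpM2r.
by rewrite ltr_pM2r // subr_gt0.
Qed.

End CircleMean.

(** * Cauchy's formula on the unit disc *)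

Section CauchyFormula.
Context {R : realType}.
Implicit Types (f F : R[i] -> R[i]) (z w : R[i]).

Definition unif_deriv F f (P : set R[i]) :=
  forall e : R, 0 < e -> exists2 d : R, 0 < d & forall z w,
    P z -> P w -> nm (w - z) < d ->
    nm (F w - F z - f z * (w - z)) <= e * nm (w - z).

#[local] Notation disc1 := [set z : R[i] | nm z <= 1].

Lemma convex_disc1 z w (l : R) : nm z <= 1 -> nm w <= 1 -> 0 <= l -> l <= 1 ->
  nm (z + l%:C * (w - z)) <= 1.
Proof.
move=> z1 w1 l0 l1.
have -> : z + l%:C * (w - z) = (1 - l)%:C * z + l%:C * w.
  by rewrite rmorphB rmorph1; ring.
rewrite (le_trans (nmD _ _)) // !nmM !nm_real !ger0_norm ?subr_ge0 //.
nra.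
Qed.

(* The mean of F(z + l (w - z)) against the ckernel does not depend on l: its
   derivative in l is the mean of w f(z + l (w - z)), which is exact. *)
Lemma cauchy_unif_deriv F f (B : R) z : (forall w, nm w <= 1 -> nm (F w) <= B) ->
  (forall w, nm w <= 1 -> nm (f w) <= B) -> unif_deriv F f disc1 -> nm z < 1 ->
  mean (fun w => F w * ckernel z w) = F z.
Proof.
move=> FB fB Ff z1; have zle1 := ltW z1.
pose p (l : R) w := z + l%:C * (w - z).
have p1 l w : 0 <= l -> l <= 1 -> nm w = 1 -> nm (p l w) <= 1.
  by move=> l0 l1 w1; apply: convex_disc1 => //; rewrite w1.
have bk := circle_bounded_kernel z1.
have bF l : 0 <= l -> l <= 1 -> circle_bounded (fun w => F (p l w)).
  by move=> l0 l1; exists B => w w1; apply: FB; apply: p1.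
have bf l : 0 <= l -> l <= 1 -> circle_bounded (fun w => w * f (p l w)).
  move=> l0 l1; apply: circle_boundedM circle_bounded_id _.
  by exists B => w w1; apply: fB; apply: p1.
pose Phi l := mean (fun w => F (p l w) * ckernel z w).
(* For l > 0 a primitive of f(z + l (w - z)) in w is F(z + l (w - z)) / l; for l = 0 the function is
   constant and has a linear primitive. *)
have exact0 l : 0 <= l -> l <= 1 -> mean (fun w => w * f (p l w)) = 0.
  rewrite le_eqVlt => /predU1P[<- _|l0 l1].
    apply: (@mean_exact R (fun w => f z * w)) => e e0; exists 1 => // u v _ _ _.
    rewrite /p mul0r addr0 -mulrBr subrr nm0.
    by rewrite mulr_ge0 ?nm_ge0 // ltW.
  apply: (@mean_exact R (fun w => l%:C^-1 * F (p l w))) => e e0.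
  have [d d0 hd] := Ff _ e0; exists d => // u v u1 v1 uv.
  have pp : p l v - p l u = l%:C * (v - u) by rewrite /p; ring.
  have lC : l%:C != 0 :> R[i] by rewrite -nm_eq0 nm_real normr_eq0 gt_eqF.
  have -> : l%:C^-1 * F (p l v) - l%:C^-1 * F (p l u) - f (p l u) * (v - u) =
    l%:C^-1 * (F (p l v) - F (p l u) - f (p l u) * (p l v - p l u)).
    by rewrite pp; field.
  rewrite nmM nmV nm_real (gtr0_norm l0) ler_pdivrMl //.
  have e2 : nm (p l v - p l u) = l * nm (v - u) by rewrite pp nmM nm_real gtr0_norm.
  have := hd (p l u) (p l v) (p1 _ _ (ltW l0) l1 u1) (p1 _ _ (ltW l0) l1 v1).
  rewrite e2 mulrCA; apply.
  by apply: le_lt_trans uv; rewrite ler_piMl ?nm_ge0.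
pose c := (1 - nm z)^-1; have c0 : 0 < c by rewrite invr_gt0 subr_gt0.
have kc w : nm w = 1 -> nm (ckernel z w) <= c.
  move=> w1; rewrite nmM w1 mul1r nmV lef_pV2 ?posrE ?subr_gt0 //.
    exact: circle_sub_ge.
  by rewrite nm_gt0 circle_sub_neq0.
have step (e : R) : 0 < e -> exists2 d : R, 0 < d & forall l h, 0 <= l ->
    0 <= h -> l + h <= 1 -> h < d -> nm (Phi (l + h) - Phi l) <= e * h.
  move=> e0; have q0 : 0 < e / (2 * c) by rewrite divr_gt0 ?mulr_gt0.
  have [d d0 hd] := Ff _ q0; exists (d / 2); first by rewrite divr_gt0.
  move=> l h l0 h0 lh hh; have l1 : l <= 1 by lra.
  have lh0 : 0 <= l + h by lra.
  have bl := circle_boundedM (bF _ l0 l1) bk.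
  have bh := circle_boundedM (bF _ lh0 lh) bk.
  rewrite /Phi -meanB //.
  (* A zero is subtracted. The increment of p is h (w - z), and its factor w - z cancels the
     denominator of the kernel, so that the linear term of the increment of F becomes exactly h w
     f(p l w). *)
  have -> : mean (fun w => F (p (l + h) w) * ckernel z w - F (p l w) * ckernel z w)
    = mean (fun w => F (p (l + h) w) * ckernel z w - F (p l w) * ckernel z w)
      - h%:C * mean (fun w => w * f (p l w)).
    by rewrite exact0 // mulr0 subr0.
  rewrite -meanZ; last exact: bf.
  rewrite -meanB; last 2 first.
  - exact: circle_boundedB.
  - exact: circle_boundedM (circle_bounded_cst _) (bf _ l0 l1).
  apply: mean_le => w w1; have wz := circle_sub_neq0 z1 w1.
  have pp : p (l + h) w - p l w = h%:C * (w - z) by rewrite /p rmorphD; ring.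
  have -> : F (p (l + h) w) * ckernel z w - F (p l w) * ckernel z w
      - h%:C * (w * f (p l w)) =
    (F (p (l + h) w) - F (p l w) - f (p l w) * (p (l + h) w - p l w)) * ckernel z w.
    by rewrite pp /ckernel; field.
  have wz2 : nm (w - z) <= 2 by have := nmB w z; rewrite w1; lra.
  have n1 : nm (p (l + h) w - p l w) <= h * 2.
    by rewrite pp nmM nm_real ger0_norm // ler_wpM2l.
  have := hd (p l w) (p (l + h) w) (p1 _ _ l0 l1 w1) (p1 _ _ lh0 lh w1).
  have hd' : nm (p (l + h) w - p l w) < d by lra.
  move=> /(_ hd') hF; rewrite nmM.
  apply: (@le_trans _ _ (e / (2 * c) * (h * 2) * c)); last first.
    by rewrite le_eqVlt; apply/orP; left; apply/eqP; field; rewrite gt_eqF.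
  apply: ler_pM; rewrite ?nm_ge0 ?kc //; apply: (le_trans hF).
  by rewrite ler_wpM2l // ltW.
(* A chain of k + 1 steps of length 1/(k+1) from 0 to 1 accumulates an error of at most e. *)
have Phi01 : Phi 1 = Phi 0.
  apply: subr0_eq; apply: (@le0_small R _ _ 1) => e e0; rewrite mul1r.
  have [d d0 hd] := step _ e0.
  have [k kd] : exists k : nat, k.+1%:R^-1 < d.
    by have [k] := ultraN (ultra_inv d0); exists k.
  pose h : R := k.+1%:R^-1; have h0 : 0 < h by rewrite invr_gt0.
  have K1 : h * k.+1%:R = 1 by rewrite mulVf ?pnatr_eq0.
  have ind j : (j <= k.+1)%N -> nm (Phi (h * j%:R) - Phi 0) <= e * (h * j%:R).
    elim: j => [|j IH] jk; first by rewrite mulr0 subrr nm0 mulr0.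
    have e3 : h * j.+1%:R = h * j%:R + h by rewrite -natr1 mulrDr mulr1.
    have jh : h * j%:R + h <= 1 by rewrite -e3 -[leRHS]K1 ler_pM2l // ler_nat.
    have j0 : 0 <= h * j%:R by rewrite mulr_ge0 // ltW.
    rewrite e3 mulrDr [leRHS]addrC (le_trans (nm_sub _ (Phi (h * j%:R)) _)) //.
    exact: lerD (hd _ _ j0 (ltW h0) jh kd) (IH (ltnW jk)).
  by have := ind k.+1 (leqnn _); rewrite K1 mulr1.
have <- : Phi 1 = mean (fun w => F w * ckernel z w).
  by apply: eq_mean => w _; rewrite /p mul1r addrC subrK.
rewrite Phi01 /Phi /p -[RHS]mulr1 -(mean_kernel z1) -meanZ //.
by apply: eq_mean => w _; rewrite mul0r addr0.
Qed.

End CauchyFormula.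

(** * Holomorphic functions of one variable *)

Section Differentiable.
Context {R : realType}.

Lemma nbhs_nmP (V : normedModType R[i]) (x : V) (P : set V) :
  (\forall y \near x, P y) <->
  exists2 d : R, 0 < d & forall y, nm (y - x) < d -> P y.
Proof.
split=> [/nbhs_ballP[e e0 h]|[d d0 h]].
  exists (complex.Re e).
    by move: e0; rewrite /= ltcE /= => /andP[_].
  move=> y yx; apply: h; rewrite -ball_normE /= distrC nmE.
  by rewrite -(RRe_real (gtr0_real e0)) ltcR.
apply/nbhs_ballP; exists d%:C; first by rewrite /= ltcR.
move=> y; rewrite -ball_normE /= distrC nmE ltcR; exact: h.
Qed.

Lemma ler_nm (V W : normedZmodType R[i]) (x : V) (y : W) (k : R) :
  (`|x| <= k%:C * `|y|) = (nm x <= k * nm y).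
Proof. by rewrite !nmE -rmorphM lecR. Qed.

Lemma gt0_realC (e : R[i]) : 0 < e -> exists2 k : R, 0 < k & e = k%:C.
Proof.
move=> e0; exists (complex.Re e); first by move: e0; rewrite ltcE => /andP[].
by rewrite RRe_real ?gtr0_real.
Qed.

Lemma differentiable_bound (V W : normedModType R[i]) (f : V -> W) x :
  differentiable f x -> exists K : R, forall h, nm ('d f x h) <= K * nm h.
Proof.
move=> /diff_continuous /linear_bounded_continuous /linear_boundedP.
move=> /pinfty_ex_gt0[M /gt0_realC[k _ ->] hM]; exists k => h.
by rewrite -ler_nm.
Qed.

Lemma differentiable_nm (V W : normedModType R[i]) (f : V -> W) x :
  differentiable f x ->
  forall e : R, 0 < e -> exists2 d : R, 0 < d & forall y, nm (y - x) < d ->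
    nm (f y - f x - 'd f x (y - x)) <= e * nm (y - x).
Proof.
move=> /diff_locally /eqaddoP df e e0.
have /nbhs_nmP[d d0 h] := df e%:C (eq_ind_r is_true e0 (ltcR 0 e)).
exists d => // y yd; have := h (y - x); rewrite subr0 => /(_ yd).
rewrite ler_nm !fctE /= subrK; congr (nm _ <= _).
by rewrite opprD addrA.
Qed.

Lemma nm_differentiable (V W : normedModType R[i]) (f : V -> W) x
    (L : V -> W) (K : R) : linear L -> (forall h, nm (L h) <= K * nm h) ->
  (forall e : R, 0 < e -> exists2 d : R, 0 < d & forall y, nm (y - x) < d ->
    nm (f y - f x - L (y - x)) <= e * nm (y - x)) ->
  differentiable f x /\ 'd f x = L :> (V -> W).
Proof.
move=> Ll LK fL.
pose Lm : {linear V -> W} := HB.pack L (GRing.isLinear.Build _ _ _ _ L Ll).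
have Lc : continuous Lm.
  apply/linear_bounded_continuous/linear_boundedP.
  exists (Num.max K 0)%:C; split; first by rewrite complex_real eqxx.
  move=> r Kr h; apply: (@le_trans _ _ ((Num.max K 0)%:C * `|h|)).
    by rewrite ler_nm (le_trans (LK h)) // ler_wpM2r ?nm_ge0 // le_max lexx.
  by rewrite ler_wpM2r // ltW.
have fo : f \o shift x = cst (f x) + Lm +o_ 0 id.
  apply/eqaddoP => _ /gt0_realC[e e0 ->]; apply/nbhs_nmP.
  have [d d0 h] := fL e e0; exists d => // y; rewrite subr0 => yd.
  have := h (y + x); rewrite addrK => /(_ yd).
  by rewrite ler_nm !fctE /= opprD addrA.
have dE := diff_unique Lc fo; split; last exact: dE.
by apply/diff_locallyP; rewrite dE; split.
Qed.

Lemma differentiable_cderiv (f : R[i] -> R[i]) z :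
  differentiable (f : R[i]^o -> R[i]^o) z ->
  cderiv f z ('d (f : R[i]^o -> R[i]^o) z 1).
Proof.
move=> df e e0; have [d d0 h] := differentiable_nm df e0; exists d => // w wz.
have := h w wz; rewrite -[X in 'd _ _ X]mulr1 -[X in 'd _ _ X]/((w - z) *: (1 : R[i]^o)).
by rewrite linearZ /= (mulrC _ (w - z)).
Qed.

Lemma cdiffP (f : R[i] -> R[i]) z :
  cdiff f z <-> differentiable (f : R[i]^o -> R[i]^o) z.
Proof.
split=> [[L fL]|df]; last by eexists; apply: differentiable_cderiv.
have [] // := @nm_differentiable _ _ (f : R[i]^o -> R[i]^o) z (fun h => L * h) (nm L).
- by move=> a u v; rewrite mulrDr -[a *: u]/(a * u) mulrCA.
- by move=> h; rewrite -nmM.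
Qed.

Lemma cdiff_line (V : normedModType R[i]) (f : V -> R[i]^o) x v z :
  differentiable f (x + z *: v) -> cderiv (fun s => f (x + s *: v)) z ('d f (x + z *: v) v).
Proof.
move=> df e e0; have K0 : 0 < nm v + 1 by rewrite ltr_wpDl ?nm_ge0.
have [d d0 h] := differentiable_nm df (divr_gt0 e0 K0).
exists (d / (nm v + 1)); first by rewrite divr_gt0.
move=> w; rewrite ltr_pdivlMr // => wz.
have wzv : x + w *: v - (x + z *: v) = (w - z) *: v.
  by rewrite opprD addrACA subrr add0r scalerBl.
have := h (x + w *: v); rewrite wzv nmZ linearZ /=.
rewrite (mulrC _ (w - z)).
have n0 := nm_ge0 (w - z); have nv := nm_ge0 v.
have hd : nm (w - z) * nm v < d by nra.
move=> /(_ hd) /le_trans; apply; rewrite -mulrA ler_wpM2l ?(ltW e0) //.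
by rewrite ler_pdivrMl //; nra.
Qed.

End Differentiable.

(** * Derivatives of the Cauchy integral; Cauchy's formula for differentiable functions *)

Section CauchyEstimates.
Context {R : realType}.
Implicit Types (f F phi : R[i] -> R[i]) (z w u : R[i]).

Lemma cderiv_uniq f z L M : cderiv f z L -> cderiv f z M -> L = M.
Proof.
move=> fL fM; apply: subr0_eq; apply: (@le0_small R _ _ 2) => e e0.
have [d d0 h] := fL e e0; have [c c0 k] := fM e e0.
pose t : R := Num.min d c / 2.
have m0 : 0 < Num.min d c by rewrite lt_min d0.
have t0 : 0 < t by rewrite divr_gt0.
have tn : nm (z + t%:C - z) = t by rewrite addrC addKr nm_real gtr0_norm.
have : t < Num.min d c by rewrite /t; lra.
rewrite lt_min => /andP[td tc].
have := h (z + t%:C); rewrite tn => /(_ td); rewrite (addrC z) addrK => h1.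
have := k (z + t%:C); rewrite tn => /(_ tc); rewrite (addrC z) addrK => h2.
have := nmB (f (t%:C + z) - f z - M * t%:C) (f (t%:C + z) - f z - L * t%:C).
have -> : f (t%:C + z) - f z - M * t%:C - (f (t%:C + z) - f z - L * t%:C) =
  (L - M) * t%:C by ring.
rewrite nmM nm_real (gtr0_norm t0) => h3; rewrite -(ler_pM2r t0); lra.
Qed.

Lemma cderiv_sqr F z L (C d : R) : 0 < d ->
  (forall w, nm (w - z) < d -> nm (F w - F z - L * (w - z)) <= C * nm (w - z) ^+ 2) ->
  cderiv F z L.
Proof.
move=> d0 h e e0; have C0 : 0 < `|C| + 1 by rewrite ltr_wpDl.
exists (Num.min d (e / (`|C| + 1))); first by rewrite lt_min d0 divr_gt0.
move=> w; rewrite lt_min ltr_pdivlMr // => /andP[/h h1 h2].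
apply: (le_trans h1); rewrite expr2 mulrA ler_wpM2r ?nm_ge0 //.
have := nm_ge0 (w - z); have := ler_norm C; nra.
Qed.

(** The case k = 1 is the Cauchy kernel; the higher ones are its derivatives in z up to
    factorials. *)
Definition kernel_pow k z w : R[i] := w / (w - z) ^+ k.

Lemma circle_bounded_kernel_pow k z : nm z < 1 -> circle_bounded (kernel_pow k z).
Proof.
move=> z1; elim: k => [|k IH].
  by rewrite /kernel_pow; apply: circle_boundedM circle_bounded_id (circle_bounded_cst _).
have -> : kernel_pow k.+1 z = (fun w => kernel_pow k z w * (w - z)^-1).
  by apply/funext => w; rewrite /kernel_pow exprSr invfM mulrA.
exact: circle_boundedM IH (circle_bounded_inv z1).
Qed.

Lemma mean_combine phi (f g h : R[i] -> R[i]) c : circle_bounded phi ->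
  circle_bounded f -> circle_bounded g -> circle_bounded h ->
  mean (fun u => phi u * f u) - mean (fun u => phi u * g u) -
    mean (fun u => phi u * h u) * c =
  mean (fun u => phi u * (f u - g u - c * h u)).
Proof.
move=> bp bf bg bh; have bpf := circle_boundedM bp bf.
have bpg := circle_boundedM bp bg; have bph := circle_boundedM bp bh.
rewrite -meanB // mulrC -meanZ // -meanB.
- by apply: eq_mean => u _; ring.
- exact: circle_boundedB.
- exact: circle_boundedM (circle_bounded_cst _) bph.
Qed.

(** The Taylor remainder of the kernel is (w - z)^2 u / ((u - z)^2 (u - w)). On the circle the two
    distances are at least 1/2 and 1/4, whence the constant 16. *)
Lemma mean_kernel_taylor phi (B : R) z w :
  (forall u, nm u = 1 -> nm (phi u) <= B) -> nm z <= 1 / 2 -> nm w <= 3 / 4 ->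
  nm (mean (fun u => phi u * kernel_pow 1 w u) -
      mean (fun u => phi u * kernel_pow 1 z u) -
      mean (fun u => phi u * kernel_pow 2 z u) * (w - z)) <=
  B * 16 * nm (w - z) ^+ 2.
Proof.
move=> hB z2 w4; have z1 : nm z < 1 by lra.
have w1 : nm w < 1 by lra.
have bp : circle_bounded phi by exists B.
rewrite mean_combine //; try exact: circle_bounded_kernel_pow.
apply: mean_le => u u1; rewrite nmM -mulrA.
have uz := circle_sub_neq0 z1 u1; have uw := circle_sub_neq0 w1 u1.
apply: ler_pM; rewrite ?nm_ge0 ?hB //.
have -> : kernel_pow 1 w u - kernel_pow 1 z u - (w - z) * kernel_pow 2 z u =
  (w - z) ^+ 2 * (u / ((u - z) ^+ 2 * (u - w))).
  by rewrite /kernel_pow; field; rewrite uw uz.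
rewrite nmM nmX mulrC ler_wpM2r ?sqr_ge0 // nmM u1 mul1r nmV nmM nmX.
have h1 := circle_sub_ge z u1; have h2 := circle_sub_ge w u1.
have a0 : 1 / 2 <= nm (u - z) by lra.
have b0 : 1 / 4 <= nm (u - w) by lra.
rewrite -[leRHS]invrK lef_pV2 ?posrE ?invr_gt0 //; last first.
  by rewrite mulr_gt0 ?exprn_gt0 //; lra.
have -> : 16^-1 = (1 / 2) ^+ 2 * (1 / 4) :> R by field.
have p2 : (1 / 2) ^+ 2 <= nm (u - z) ^+ 2 by rewrite !expr2; nra.
by apply: ler_pM; [exact: sqr_ge0|lra|exact: p2|exact: b0].
Qed.

(** The same for the squared kernel: the remainder has the numerator 3 (u - z) - 2 (w - z), of
    modulus at most 7, over five factors of modulus at least 1/2, and 224 = 7 * 2^5. *)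
Lemma mean_kernel_taylor2 phi (B : R) z w :
  (forall u, nm u = 1 -> nm (phi u) <= B) -> nm z <= 1 / 2 -> nm w <= 1 / 2 ->
  nm (mean (fun u => phi u * kernel_pow 2 w u) -
      mean (fun u => phi u * kernel_pow 2 z u) -
      mean (fun u => phi u * (2 * kernel_pow 3 z u)) * (w - z)) <=
  B * 224 * nm (w - z) ^+ 2.
Proof.
move=> hB z2 w2; have z1 : nm z < 1 by lra.
have w1 : nm w < 1 by lra.
have bp : circle_bounded phi by exists B.
rewrite mean_combine //; try exact: circle_bounded_kernel_pow; last first.
  exact: circle_boundedM (circle_bounded_cst _) (circle_bounded_kernel_pow _ z1).
apply: mean_le => u u1; rewrite nmM -mulrA.
have uz := circle_sub_neq0 z1 u1; have uw := circle_sub_neq0 w1 u1.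
apply: ler_pM; rewrite ?nm_ge0 ?hB //.
have -> : kernel_pow 2 w u - kernel_pow 2 z u - (w - z) * (2 * kernel_pow 3 z u) =
  (w - z) ^+ 2 * (u * (3 * (u - z) - 2 * (w - z)) / ((u - z) ^+ 3 * (u - w) ^+ 2)).
  by rewrite /kernel_pow; field; rewrite uw uz.
rewrite nmM nmX mulrC ler_wpM2r ?sqr_ge0 // !nmM u1 mul1r nmV nmM !nmX.
have h1 := circle_sub_ge z u1; have h2 := circle_sub_ge w u1.
have a0 : 1 / 2 <= nm (u - z) by lra.
have b0 : 1 / 2 <= nm (u - w) by lra.
have n7 : nm (3 * (u - z) - 2 * (w - z)) <= 7.
  rewrite (le_trans (nmB _ _)) // !nmM !nm_nat.
  by have := nmB u z; have := nmB w z; rewrite u1; lra.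
have -> : 224 = 7 * ((1 / 2) ^+ 3 * (1 / 2) ^+ 2)^-1 :> R by field.
apply: ler_pM => //; rewrite ?nm_ge0 ?invr_ge0 ?mulr_ge0 ?exprn_ge0 ?nm_ge0 //.
have p3 : (1 / 2) ^+ 3 <= nm (u - z) ^+ 3 by rewrite lerXn2r ?nnegrE ?nm_ge0 //; lra.
have p2 : (1 / 2) ^+ 2 <= nm (u - w) ^+ 2 by rewrite lerXn2r ?nnegrE ?nm_ge0 //; lra.
have q3 : (0 : R) < (1 / 2) ^+ 3 by rewrite exprn_gt0 //; lra.
have q2 : (0 : R) < (1 / 2) ^+ 2 by rewrite exprn_gt0 //; lra.
have uz0 : 0 < nm (u - z) by lra.
have uw0 : 0 < nm (u - w) by lra.
rewrite lef_pV2 ?posrE ?mulr_gt0 ?exprn_gt0 //.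
by apply: ler_pM => //; apply: ltW.
Qed.

Lemma unif_deriv_scale F f (P Q : set R[i]) (c : R) : 0 < c ->
  (forall z, Q z -> P (c%:C * z)) -> unif_deriv F f P ->
  unif_deriv (fun z => F (c%:C * z)) (fun z => c%:C * f (c%:C * z)) Q.
Proof.
move=> c0 QP Ff e e0; have [d d0 h] := Ff _ (divr_gt0 e0 c0).
exists (d / c) => [|z w Qz Qw]; first by rewrite divr_gt0.
rewrite ltr_pdivlMr // => zw; have := h _ _ (QP _ Qz) (QP _ Qw).
rewrite -mulrBr nmM nm_real (gtr0_norm c0) mulrC => /(_ zw).
have -> : e / c * (nm (w - z) * c) = e * nm (w - z) by field; rewrite gt_eqF.
congr (nm _ <= _).
by rewrite mulrCA mulrA [c%:C * f _]mulrC -!mulrA.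
Qed.

(** The formula for functions with uniform derivative applies at once to a primitive of f, but not
    yet to f. Differentiating it once represents f by the squared kernel; differentiating again
    shows that f has a uniform derivative itself, so that the formula applies to f. The radius 2 of
    the hypothesis leaves the room for this. *)
Theorem cauchy_formula f z : (forall w, nm w <= 2 -> cdiff f w) -> nm z < 1 ->
  f z = mean (fun w => f w * ckernel z w).
Proof.
move=> fd z1; have fc w : nm w <= 2 -> ccont f w by move=> /fd /cdiff_cont.
have [B hB] := disc_bounded fc.
have B0 : 0 <= B by apply: le_trans (nm_ge0 _) (hB 0 _); rewrite nm0.
pose F w := sint f 0 w.
have FB w : nm w <= 2 -> nm (F w) <= 2 * B.
  move=> w2; have d0 : nm (0 : R[i]) <= 2 by rewrite nm0.
  have := @sint_affine R f 2 fc [set z | nm z <= 2] 0 0 B 0 w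
    (@disc_midconvex R 2) (fun z h => h).
  rewrite !mul0r !(mul0r, addr0, subr0) => h; apply: (le_trans (h _ d0 w2)).
    by move=> u u2; rewrite mul0r addr0 subr0 hB.
  by rewrite mulrC ler_wpM2r.
have Ff : unif_deriv F f [set z | nm z <= 2].
  by move=> e e0; apply: primitive_unif.
(* Rescaling by 2 brings the primitive to the unit disc and sends the disc on which f is wanted to
   |w| <= 1/2, away from the circle. *)
pose G w := F (2%:C * w); pose g w := 2%:C * f (2%:C * w).
have n2 w : nm (2%:C * w) = 2 * nm w by rewrite nmM nm_real gtr0_norm.
have Gg : unif_deriv G g [set z | nm z <= 1].
  by apply: unif_deriv_scale Ff => // w /= w1; rewrite n2; lra.
have GB w : nm w <= 1 -> nm (G w) <= 2 * B by move=> w1; apply: FB; rewrite n2; lra.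
have gB w : nm w <= 1 -> nm (g w) <= 2 * B.
  by move=> w1; rewrite n2 ler_pM2l // hB // n2; lra.
have GK w : nm w < 1 -> G w = mean (fun u => G u * kernel_pow 1 w u).
  by move=> w1; rewrite -(cauchy_unif_deriv GB gB Gg w1).
have GB1 u : nm u = 1 -> nm (G u) <= 2 * B by move=> u1; apply: GB; rewrite u1.
(* Both sides are derivatives of G at w. *)
have gK w : nm w <= 1 / 2 -> g w = mean (fun u => G u * kernel_pow 2 w u).
  move=> w2; apply: (@cderiv_uniq G w).
    move=> e e0; have [d d0 h] := Gg e e0; exists (Num.min d (1 / 2)).
      by rewrite lt_min d0; lra.
    move=> v; rewrite lt_min => /andP[h1 h2]; apply: h => //=; first lra.
    by have := nm_sub v w 0; rewrite !subr0; lra.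
  apply: (@cderiv_sqr _ _ _ (2 * B * 16) (1 / 4)); first lra.
  move=> v vw; have v4 : nm v <= 3 / 4 by have := nm_sub v w 0; rewrite !subr0; lra.
  rewrite (GK v) ?(GK w); try lra.
  exact: mean_kernel_taylor.
pose g' w := mean (fun u => G u * (2 * kernel_pow 3 w u)).
have gd : unif_deriv g g' [set z | nm z <= 1 / 2].
  move=> e e0; have K0 : 0 < 2 * B * 224 + 1 by lra.
  exists (e / (2 * B * 224 + 1)) => [|v w /= v2 w2 vw]; first by rewrite divr_gt0.
  rewrite !gK //; apply: (le_trans (mean_kernel_taylor2 GB1 v2 w2)).
  rewrite expr2 mulrA ler_wpM2r ?nm_ge0 //.
  rewrite ltr_pdivlMr // in vw; have := nm_ge0 (w - v); nra.
have c2 : 0 < 2^-1 :> R by rewrite invr_gt0.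
have fE w : f w = (2^-1)%:C * g ((2^-1)%:C * w).
  by rewrite /g !mulrA -!rmorphM /= mulVf ?mulfV // rmorph1 !mul1r.
pose f' w := (2^-1)%:C * ((2^-1)%:C * g' ((2^-1)%:C * w)).
have n2' w : nm ((2^-1)%:C * w : R[i]) = 2^-1 * nm w by rewrite nmM nm_real gtr0_norm.
have fd1 : unif_deriv f f' [set z | nm z <= 1].
  have h1 w : nm w <= 1 -> nm ((2^-1)%:C * w) <= 1 / 2 by rewrite n2'; lra.
  move=> e e0; have e20 : 0 < 2 * e by lra.
  have [d d0 h] := unif_deriv_scale c2 h1 gd e20; exists d => // v w v1 w1 vw.
  have := h v w v1 w1 vw; rewrite (fE v) (fE w) /f'.
  set a := g (_ * w); set b := g (_ * v); set c := _ * g' _ => h2.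
  have -> : (2^-1)%:C * a - (2^-1)%:C * b - (2^-1)%:C * c * (w - v) =
    (2^-1)%:C * (a - b - c * (w - v)) by ring.
  by rewrite nmM nm_real gtr0_norm // ler_pdivrMl // mulrA.
(* The constant is (1/2)(1/2) from the two rescalings, times 2 B for G, times 2 * 2^3 for the
   doubled cubic kernel. *)
have hC w : nm w <= 1 -> nm (f' w) <= 8 * B.
  move=> w1; rewrite !nmM nm_real gtr0_norm //.
  have w2 : nm ((2^-1)%:C * w) <= 1 / 2 by rewrite n2'; lra.
  suff : nm (g' ((2^-1)%:C * w)) <= 2 * B * (2 * 2 ^+ 3) by lra.
  apply: mean_le => u u1; rewrite nmM; apply: ler_pM; rewrite ?nm_ge0 ?GB1 //.
  rewrite nmM nm_nat ler_pM2l // nmM u1 mul1r nmV nmX.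
  have h2 : 1 / 2 <= nm (u - (2^-1)%:C * w).
    by have := circle_sub_ge ((2^-1)%:C * w) u1; lra.
  rewrite -[leRHS]invrK lef_pV2 ?posrE ?invr_gt0 ?exprn_gt0 //; last lra.
  by rewrite -exprVn lerXn2r ?nnegrE ?nm_ge0 ?invr_ge0 //; lra.
have hB1 w : nm w <= 1 -> nm (f w) <= 8 * B.
  by move=> w1; apply: (@le_trans _ _ B); [apply: hB|]; lra.
by rewrite (cauchy_unif_deriv hB1 hC fd1 z1).
Qed.

End CauchyEstimates.

(** * Removable singularities and isolated zeros *)

Section OneVariable.
Context {R : realType}.
Implicit Types (f g phi psi : R[i] -> R[i]) (z w u : R[i]).

Lemma cderiv_near f g z L : (exists2 d : R, 0 < d & forall w, nm (w - z) < d -> f w = g w) ->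
  cderiv f z L -> cderiv g z L.
Proof.
move=> [d d0 fg] fL e e0; have [c c0 h] := fL e e0.
exists (Num.min d c) => [|w]; first by rewrite lt_min d0.
rewrite lt_min => /andP[wd wc]; rewrite -!fg //; first exact: h.
by rewrite subrr nm0.
Qed.

Lemma cdiff_near f g z : (exists2 d : R, 0 < d & forall w, nm (w - z) < d -> f w = g w) ->
  cdiff f z -> cdiff g z.
Proof. by move=> fg [L fL]; exists L; apply: cderiv_near fL. Qed.

Lemma cderiv_affine f (c a z L : R[i]) : cderiv f (c + a * z) L ->
  cderiv (fun w => f (c + a * w)) z (L * a).
Proof.
move=> fL e e0; have K0 : 0 < nm a + 1 by rewrite ltr_wpDl ?nm_ge0.
have [d d0 h] := fL _ (divr_gt0 e0 K0).
exists (d / (nm a + 1)) => [|w]; first by rewrite divr_gt0.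
rewrite ltr_pdivlMr // => wz; have a0 := nm_ge0 a; have n0 := nm_ge0 (w - z).
have aw : c + a * w - (c + a * z) = a * (w - z) by ring.
have := h (c + a * w); rewrite aw nmM mulrA.
have wd : nm a * nm (w - z) < d by nra.
move=> /(_ wd) /le_trans; apply.
by rewrite -!mulrA ler_wpM2l ?(ltW e0) // ler_pdivrMl //; nra.
Qed.

Lemma cdiff_affine f (c a z : R[i]) : cdiff f (c + a * z) ->
  cdiff (fun w => f (c + a * w)) z.
Proof. by move=> [L fL]; exists (L * a); apply: cderiv_affine. Qed.

Lemma cdiffM f g z : cdiff f z -> cdiff g z -> cdiff (fun w => f w * g w) z.
Proof. by move=> /cdiffP fz /cdiffP gz; apply/cdiffP; apply: differentiableM. Qed.

Lemma cdiff_id z : cdiff id z.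
Proof. by exists 1 => e e0; exists 1 => // w _; rewrite mul1r subrr nm0 mulr_ge0 ?nm_ge0 // ltW. Qed.

Lemma cdiffV f z : cdiff f z -> f z != 0 -> cdiff (fun w => (f w)^-1) z.
Proof. by move=> /cdiffP fz f0; apply/cdiffP; apply: differentiableV. Qed.

Lemma circle_bounded_disc f : (forall z, nm z <= 2 -> cdiff f z) -> circle_bounded f.
Proof.
move=> fd; have [|B hB] := @disc_bounded R f 2; first by move=> z /fd /cdiff_cont.
by exists B => u u1; apply: hB; rewrite u1; lra.
Qed.

Lemma ckernel0 u : nm u = 1 -> ckernel 0 u = 1.
Proof. by move=> u1; rewrite /ckernel subr0 divff // -nm_gt0 u1. Qed.

Lemma cauchy_center f : (forall z, nm z <= 2 -> cdiff f z) -> f 0 = mean f.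
Proof.
move=> fd; rewrite (cauchy_formula fd) ?nm0 //.
by apply: eq_mean => u u1; rewrite ckernel0 // mulr1.
Qed.

Lemma cauchy_taylor f (B : R) : (forall z, nm z <= 2 -> cdiff f z) ->
  (forall u, nm u = 1 -> nm (f u) <= B) -> forall h, nm h <= 3 / 4 ->
  nm (f h - f 0 - mean (fun u => f u * kernel_pow 2 0 u) * h) <= B * 16 * nm h ^+ 2.
Proof.
move=> fd fB h h1; have := @mean_kernel_taylor R f B 0 h fB.
rewrite subr0 nm0 => /(_ _ h1) H; rewrite (cauchy_formula fd) ?nm0; last lra.
by rewrite (cauchy_formula (z := 0) fd) ?nm0 //; apply: H; lra.
Qed.

Lemma cauchy_deriv f L : (forall z, nm z <= 2 -> cdiff f z) -> cderiv f 0 L ->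
  L = mean (fun u => f u * kernel_pow 2 0 u).
Proof.
move=> fd fL; have [B hB] := circle_bounded_disc fd.
apply: (cderiv_uniq fL); apply: (@cderiv_sqr _ _ _ _ (B * 16) (1 / 2)); first lra.
move=> w; rewrite subr0 => w1; apply: (cauchy_taylor fd hB); lra.
Qed.

Lemma cauchy_estimates f L (B : R) : (forall z, nm z <= 2 -> cdiff f z) ->
  (forall u, nm u = 1 -> nm (f u) <= B) -> cderiv f 0 L ->
  nm L <= B /\ forall h, nm h <= 3 / 4 -> nm (f h - f 0 - L * h) <= B * 16 * nm h ^+ 2.
Proof.
move=> fd fB fL; rewrite (cauchy_deriv fd fL); split; last exact: cauchy_taylor.
apply: mean_le => u u1; rewrite /kernel_pow subr0 !nmM nmV nmX u1 expr1n invr1 !mulr1.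
exact: fB.
Qed.

(** The function z^2 f(z), set to 0 at 0, is differentiable there with derivative 0, so Cauchy's
    formula holds for it. Dividing by z^2 gives Cauchy's formula for f off 0, and the value at 0 of
    the Cauchy integral is the missing value. *)
Lemma removable_unit f (B d : R) : (forall z, z != 0 -> nm z <= 2 -> cdiff f z) ->
  0 < d -> (forall z, z != 0 -> nm z < d -> nm (f z) <= B) ->
  exists c, cdiff (fun z => if z == 0 then c else f z) 0.
Proof.
move=> fd d0 fB; pose k z := z ^+ 2 * f z.
have k0 : cderiv k 0 0.
  apply: (@cderiv_sqr _ _ _ _ (Num.max B 0) d) => // w; rewrite subr0 => wd.
  rewrite /k expr0n mul0r subr0 mul0r subr0 nmM nmX mulrC.
  have [->|w0] := eqVneq w 0; first by rewrite nm0 expr0n !mulr0.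
  by rewrite ler_wpM2r ?sqr_ge0 // le_max fB.
have kd z : nm z <= 2 -> cdiff k z.
  have [->|z0] := eqVneq z 0 => z2; first by exists 0.
  by apply: cdiffM (fd _ z0 z2); apply: cdiffM (cdiff_id _) (cdiff_id _).
have bk := circle_bounded_disc kd.
have bf : circle_bounded f.
  have [M hM] := bk; exists M => u u1; have := hM u u1.
  by rewrite nmM nmX u1 expr1n mul1r.
have fE z : z != 0 -> nm z < 1 -> f z = mean (fun u => f u * ckernel z u).
  move=> z0 z1; have b1 := circle_bounded_inv (z := 0) (eq_ind_r (fun x => is_true (x < 1)) ltr01 (nm0 _)).
  have bkz := circle_bounded_kernel z1.
  apply: (@mulfI _ (z ^+ 2)); first by rewrite expf_neq0.
  rewrite -[LHS]/(k z) (cauchy_formula kd z1).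
  have e1 := cauchy_center kd; have e2 := cauchy_deriv kd k0.
  rewrite -meanZ; last exact: circle_boundedM.
  (* The kernel is 1 + z/u + (z/u)^2 times the kernel. The first two terms contribute k(0) and z
     k'(0), which are zero. *)
  transitivity (mean (fun u => k u + z * (k u * kernel_pow 2 0 u) + z ^+ 2 * (f u * ckernel z u))).
    apply: eq_mean => u u1; have uz := circle_sub_neq0 z1 u1.
    have u0 : u != 0 by rewrite -nm_gt0 u1.
    by rewrite /k /kernel_pow /ckernel subr0; field; rewrite u0 uz.
  have bk2 : circle_bounded (fun u => k u * kernel_pow 2 0 u).
    by apply: circle_boundedM bk (circle_bounded_kernel_pow _ _); rewrite nm0.
  have bzk := circle_boundedM (circle_bounded_cst z) bk2.
  have bfz := circle_boundedM (circle_bounded_cst (z ^+ 2)) (circle_boundedM bf bkz).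
  rewrite meanD //; last exact: circle_boundedD.
  rewrite meanD // (meanZ z) // -e1 -e2 /k mulr0 expr0n mul0r !add0r //.
exists (mean (fun u => f u * ckernel 0 u)).
exists (mean (fun u => f u * kernel_pow 2 0 u)); have [M hM] := bf.
apply: (@cderiv_sqr _ _ _ _ (M * 16) (1 / 2)); first lra.
move=> w; rewrite subr0 eqxx => w1; have [->|w0] := eqVneq w 0.
  by rewrite subrr mulr0 subr0 nm0 expr0n mulr0.
rewrite (fE w w0); last lra.
have := @mean_kernel_taylor R f M 0 w hM; rewrite nm0 subr0; apply; lra.
Qed.

Lemma removable f z (r B : R) : 0 < r ->
  (forall w, w != z -> nm (w - z) < r -> cdiff f w) ->
  (forall w, w != z -> nm (w - z) < r -> nm (f w) <= B) ->
  exists c, cdiff (fun w => if w == z then c else f w) z.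
Proof.
(* With the scale r / 4 the disc of radius 2 becomes one of radius r / 2, inside the domain. *)
move=> r0 fd fB; pose a : R[i] := (r / 4)%:C.
have r4 : 0 < r / 4 by lra.
have na : nm a = r / 4 by rewrite nm_real gtr0_norm.
have a0 : a != 0 by rewrite -nm_gt0 na.
have az w : nm (z + a * w - z) = r / 4 * nm w by rewrite addrC addKr nmM na.
have neq w : w != 0 -> z + a * w != z.
  by move=> w0; rewrite -subr_eq0 addrC addKr mulf_neq0.
have [|||c hc] := @removable_unit (fun w => f (z + a * w)) B 2.
- by move=> w w0 w2; apply/cdiff_affine/fd; rewrite ?neq ?az //; nra.
- by [].
- by move=> w w0 w2; apply: fB; rewrite ?neq ?az //; nra.
exists c; pose g w := if w == 0 then c else f (z + a * w).
have : cdiff (fun w => g (- (a^-1 * z) + a^-1 * w)) z.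
  by apply: cdiff_affine; rewrite addrC subrr.
apply: cdiff_near; exists 1 => // w _.
have -> : - (a^-1 * z) + a^-1 * w = a^-1 * (w - z) by ring.
rewrite /g mulf_eq0 invr_eq0 (negbTE a0) subr_eq0 /=; case: eqP => // _.
by rewrite mulVKf // addrC subrK.
Qed.

Lemma ckernel_expand k z u : nm z < 1 -> nm u = 1 ->
  ckernel z u = \sum_(j < k) z ^+ j * u ^- j + z ^+ k * (u ^- k * ckernel z u).
Proof.
move=> z1 u1; have uz := circle_sub_neq0 z1 u1.
have u0 : u != 0 by rewrite -nm_gt0 u1.
elim: k => [|k IH]; first by rewrite big_ord0 add0r !expr0 invr1 !mul1r.
rewrite {1}IH big_ord_recr /= -addrA; congr (_ + _).
by rewrite /ckernel !exprS; field; rewrite u0 uz expf_neq0.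
Qed.

Lemma circle_boundedXV k : circle_bounded (fun u : R[i] => u ^- k).
Proof. by exists 1 => u u1; rewrite nmV nmX u1 expr1n invr1. Qed.

Lemma mean_sum (k : nat) (F : nat -> R[i] -> R[i]) :
  (forall j, circle_bounded (F j)) ->
  mean (fun u => \sum_(j < k) F j u) = \sum_(j < k) mean (F j) /\
  circle_bounded (fun u => \sum_(j < k) F j u).
Proof.
move=> bF; elim: k => [|k [IH bs]].
  have e u : \sum_(j < 0) F j u = 0 by rewrite big_ord0.
  split; first by rewrite big_ord0 (eq_mean (psi := fun=> 0)) ?mean_cst.
  by exists 0 => u _; rewrite e nm0.
have e : (fun u => \sum_(j < k.+1) F j u) = (fun u => \sum_(j < k) F j u + F k u).
  by apply/funext => u; rewrite big_ord_recr.
by rewrite e big_ord_recr meanD // IH; split=> //; apply: circle_boundedD.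
Qed.

Lemma cauchy_expand f k z : (forall z, nm z <= 2 -> cdiff f z) -> nm z < 1 ->
  f z = \sum_(j < k) z ^+ j * mean (fun u => f u * u ^- j) +
        z ^+ k * mean (fun u => f u * u ^- k * ckernel z u).
Proof.
move=> fd z1; have bf := circle_bounded_disc fd; rewrite (cauchy_formula fd z1).
have bj j := circle_boundedM bf (circle_boundedXV j).
have bzj j := circle_boundedM (circle_bounded_cst (z ^+ j)) (bj j).
have [e1 b1] := mean_sum k bzj.
have bR := circle_boundedM (bj k) (circle_bounded_kernel z1).
rewrite -(meanZ _ bR); under eq_bigr do rewrite -(meanZ _ (bj _)).
rewrite -e1 -meanD //; last exact: circle_boundedM (circle_bounded_cst _) bR.
apply: eq_mean => u u1; rewrite {1}(ckernel_expand k z1 u1) mulrDr; congr (_ + _); last ring.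
by rewrite mulr_sumr; apply: eq_bigr => j _; rewrite mulrCA.
Qed.

(** If all Taylor coefficients are zero, then f(z) is z^k times a bounded quantity for every k,
    hence 0. Otherwise, with a_k the first nonzero one, f(z) is z^k times a quantity that tends to
    a_k. *)
Lemma isolated_zero f : (forall z, nm z <= 2 -> cdiff f z) ->
  (forall z, nm z < 1 -> f z = 0) \/
  exists2 d : R, 0 < d & forall z, z != 0 -> nm z < d -> f z != 0.
Proof.
move=> fd; have [B hB] := circle_bounded_disc fd.
have bf := circle_bounded_disc fd.
pose a j := mean (fun u => f u * u ^- j).
have [a0|] := pselect (forall j, a j = 0).
  left=> z z1; have zz := nm_ge0 z.
  have c0 : 0 < 1 - nm z by lra.
  have B0 : 0 <= B by apply: le_trans (nm_ge0 _) (hB 1 (nm1)).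
  have h k : nm (f z) <= nm z ^+ k * (B / (1 - nm z)).
    rewrite (cauchy_expand k fd z1) big1 ?add0r => [|j _]; last by rewrite -/(a j) a0 mulr0.
    rewrite nmM nmX ler_wpM2l ?exprn_ge0 //; apply: mean_le => u u1.
    rewrite !nmM nmV nmX u1 expr1n invr1 mulr1 mul1r; apply: ler_pM; rewrite ?nm_ge0 ?hB //.
    rewrite nmV lef_pV2 ?posrE //; first exact: circle_sub_ge.
    by rewrite nm_gt0 circle_sub_neq0.
  apply: (@le0_small R _ _ (B / (1 - nm z))) => e e0.
  have : (fun n => nm z ^+ n) @ \oo --> (0 : R).
    by apply: cvg_expr; rewrite ger0_norm.
  move/cvgrPdist_lt => /(_ _ e0) /ultra_near /ultraN[k] /=.
  rewrite sub0r normrN ger0_norm ?exprn_ge0 // => ke; apply: (le_trans (h k)).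
  by rewrite [leLHS]mulrC; exact: (ler_wpM2l (divr_ge0 B0 (ltW c0)) (ltW ke)).
move=> /existsNP aN; right.
have /ex_minnP[k /eqP ak kmin] : exists k, a k != 0.
  by case: aN => k /eqP ak; exists k.
have ak0 : 0 < nm (a k) by rewrite nm_gt0; apply/eqP.
(* For |z| <= 1/2 and u on the circle, |z / (u - z)| <= 2 |z|, so the cofactor of z^k differs from
   a_k by at most 2 B |z|. *)
pose C := B * 2; have B0 : 0 <= B by apply: le_trans (nm_ge0 _) (hB 1 (nm1)).
have C1 : 0 < C + 1 by rewrite /C; lra.
exists (Num.min (1 / 2) (nm (a k) / (C + 1))).
  by rewrite lt_min (divr_gt0 ak0 C1) andbT; lra.
move=> z z0; rewrite lt_min => /andP[z2]; rewrite ltr_pdivlMr // => zk; have z1 : nm z < 1 by lra.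
rewrite (cauchy_expand k fd z1) big1 ?add0r => [|j _]; last first.
  rewrite -/(a j); have [->|aj] := eqVneq (a j) 0; first by rewrite mulr0.
  by have := kmin j aj; rewrite leqNgt ltn_ord.
rewrite mulf_neq0 ?expf_neq0 // -nm_gt0; set Q := mean _.
have bk := circle_boundedM bf (circle_boundedXV k).
have : nm (Q - a k) <= B * 2 * nm z.
  rewrite /Q /a -meanB //; last exact: circle_boundedM bk (circle_bounded_kernel z1).
  apply: mean_le => u u1; have uz := circle_sub_neq0 z1 u1.
  have -> : f u * u ^- k * ckernel z u - f u * u ^- k = f u * u ^- k * (z / (u - z)).
    have u0 : u ^+ k != 0 by rewrite expf_neq0 // -nm_gt0 u1.
    by rewrite /ckernel; field; rewrite uz u0.
  rewrite !nmM nmV nmX u1 expr1n invr1 mulr1 -mulrA; apply: ler_pM; rewrite ?mulr_ge0 ?nm_ge0 ?hB //.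
  rewrite mulrC ler_wpM2r ?nm_ge0 // nmV -[leRHS]invrK lef_pV2 ?posrE ?invr_gt0 //.
    by have := circle_sub_ge z u1; lra.
  by rewrite nm_gt0.
have := nm_lbB (a k) Q; rewrite (nmC (a k) Q) => h1 h2.
by have := nm_ge0 z; rewrite /C in zk; nra.
Qed.

Lemma isolated_zero_at f z (r : R) : 0 < r -> (forall w, nm (w - z) < r -> cdiff f w) ->
  (exists2 d : R, 0 < d & forall w, nm (w - z) < d -> f w = 0) \/
  exists2 d : R, 0 < d & forall w, w != z -> nm (w - z) < d -> f w != 0.
Proof.
move=> r0 fd; pose a : R[i] := (r / 4)%:C.
have r4 : 0 < r / 4 by lra.
have na : nm a = r / 4 by rewrite nm_real gtr0_norm.
have a0 : a != 0 by rewrite -nm_gt0 na.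
have E w : w = z + a * (a^-1 * (w - z)) by rewrite mulVKf // addrC subrK.
have nE w : nm (a^-1 * (w - z)) = nm (w - z) / (r / 4) by rewrite nmM nmV na mulrC.
have [w w2||[d d0 h]] := @isolated_zero (fun w => f (z + a * w)).
- by apply/cdiff_affine/fd; rewrite addrC addKr nmM na; nra.
- move=> h; left; exists (r / 4) => // w wr; rewrite (E w) h // nE.
  by rewrite ltr_pdivrMr // mul1r.
- right; exists (d * (r / 4)) => [|w wz wd]; first by rewrite mulr_gt0.
  rewrite (E w) h // ?nE ?ltr_pdivrMr //.
  by rewrite mulf_neq0 ?invr_eq0 // subr_eq0.
Qed.

(** Where phi vanishes, psi / phi is bounded nearby, so all singularities of the quotient are
    removable and the mean value property holds at the center. The product form of the conclusion
    allows phi 0 = 0. *)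
Lemma quotient_mean phi psi : (forall z, nm z < 3 -> cdiff phi z) ->
  (forall z, nm z < 3 -> cdiff psi z) ->
  (forall z, nm z < 3 -> exists2 d : R, 0 < d & forall w, w != z -> nm (w - z) < d -> phi w != 0) ->
  (forall z, nm z < 3 -> phi z = 0 -> exists K : R, exists2 d : R, 0 < d &
     forall w, nm (w - z) < d -> nm (psi w) <= K * nm (phi w)) ->
  (forall u, nm u = 1 -> phi u != 0) ->
  psi 0 = phi 0 * mean (fun u => psi u / phi u).
Proof.
move=> dphi dpsi iso bnd circ; pose q w := psi w / phi w.
have dq z : nm z < 3 -> phi z != 0 -> cdiff q z.
  by move=> z3 z0; apply: cdiffM (dpsi _ z3) _; apply: cdiffV (dphi _ z3) z0.
have /choice[c hc] : forall z, exists c, nm z < 3 -> phi z = 0 ->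
    cdiff (fun w => if w == z then c else q w) z.
  move=> z; have [z3|] := boolP (nm z < 3); last by exists 0.
  have [z0|] := eqVneq (phi z) 0; last by move=> /eqP ? ; exists 0.
  have [d d0 hd] := iso z z3; have [K [b b0 hb]] := bnd z z3 z0.
  pose r := Num.min d (Num.min b (3 - nm z)).
  have [|||C hC] := @removable q z r K.
  - by rewrite !lt_min d0 b0 subr_gt0.
  - move=> w wz; rewrite !lt_min => /and3P[wd wb w3]; apply: dq; last exact: hd.
    by have := nm_sub w z 0; rewrite !subr0; lra.
  - move=> w wz; rewrite !lt_min => /and3P[wd wb w3].
    rewrite nmM nmV ler_pdivrMr ?hb // nm_gt0; exact: hd.
  by exists C => _ _.
(* Zeros of phi are isolated, so near each of them [chi] has just one corrected value, and
   [removable] applies there. *)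
pose chi w := if phi w == 0 then c w else q w.
have dchi z : nm z <= 2 -> cdiff chi z.
  move=> z2; have z3 : nm z < 3 by lra.
  have [z0|z0] := eqVneq (phi z) 0.
    have [d d0 hd] := iso z z3; apply: cdiff_near (hc z z3 z0).
    exists d => // w wd; rewrite /chi; have [->|wz] := eqVneq w z.
      by rewrite z0 eqxx.
    by rewrite (negbTE (hd _ wz wd)).
  have nz0 : 0 < nm (phi z) by rewrite nm_gt0.
  apply: cdiff_near (dq z z3 z0); have nz2 : 0 < nm (phi z) / 2 by lra.
  have [d d0 hd] := cdiff_cont (dphi z z3) nz2; exists d => // w /hd.
  rewrite /chi; have [-> |//] := eqVneq (phi w) 0; rewrite sub0r nmN => h; exfalso; lra.
have -> : mean (fun u => psi u / phi u) = mean chi.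
  by apply: eq_mean => u u1; rewrite /chi (negbTE (circ u u1)).
rewrite -(cauchy_center dchi) /chi; have n0 : nm (0 : R[i]) < 3 by rewrite nm0.
case: eqP => [z0|/eqP z0]; last by rewrite mulrC divfK.
have [K [b b0 hb]] := bnd 0 n0 z0; rewrite z0 mul0r; apply/eqP.
rewrite -nm_eq0 eq_le nm_ge0 andbT; have := hb 0; rewrite subrr nm0 z0 nm0 mulr0.
by apply.
Qed.

Lemma simple_zero_quotient phi psi z L M : cderiv phi z L -> L != 0 -> phi z = 0 ->
  cderiv psi z M -> psi z = 0 -> exists K : R, exists2 d : R, 0 < d &
     forall w, nm (w - z) < d -> nm (psi w) <= K * nm (phi w).
Proof.
move=> dphi L0 phi0 dpsi psi0; have nL : 0 < nm L by rewrite nm_gt0.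
have nL2 : 0 < nm L / 2 by lra.
have [d d0 hd] := dphi _ nL2; have [b b0 hb] := dpsi _ ltr01.
exists ((nm M + 1) / (nm L / 2)); exists (Num.min d b); first by rewrite lt_min d0.
move=> w; rewrite lt_min => /andP[/hd + /hb]; rewrite phi0 psi0 !subr0 => h1 h2.
rewrite mulrAC ler_pdivlMr //.
have h3 : nm L * nm (w - z) - nm (phi w) <= nm L / 2 * nm (w - z).
  by rewrite -nmM (le_trans (nm_lbB _ _)) // nmC.
have h4 : nm (psi w) <= (nm M + 1) * nm (w - z).
  have := nmD (psi w - M * (w - z)) (M * (w - z)); rewrite subrK nmM; lra.
have := nm_ge0 M; have := nm_ge0 (psi w); have := nm_ge0 (phi w); have := nm_ge0 (w - z).
nra.
Qed.

End OneVariable.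

(** * Holomorphic functions of several variables *)

Section SeveralVariables.
Context {R : realType}.
Implicit Types (V : normedModType R[i]).

Definition ncont V (f : V -> R[i]) x := forall e : R, 0 < e ->
  exists2 d : R, 0 < d & forall y, nm (y - x) < d -> nm (f y - f x) <= e.

Lemma differentiable_ncont V (f : V -> R[i]^o) x : differentiable f x -> ncont f x.
Proof.
move=> /differentiable_continuous fc e e0.
have : \forall y \near x, `|f x - f y| < e%:C by apply: cvgr_dist_lt fc _ _; rewrite ltcR.
move=> /nbhs_nmP[d d0 h]; exists d => // y /h; rewrite distrC nmE ltcR; exact: ltW.
Qed.

(** Cauchy's estimates on the complex line through y in the direction of h, rescaled to length rho /
    4 so that |z| <= 2 stays within rho / 2. The constants depend on the sup bound B and the radius
    only, not on q or y. *)
Lemma differentiable_estimates V (q : V -> R[i]^o) y (rho B : R) : 0 < rho ->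
  (forall y', nm (y' - y) < rho -> differentiable q y') ->
  (forall y', nm (y' - y) < rho -> nm (q y') <= B) ->
  (forall h, nm ('d q y h) <= 4 * B / rho * nm h) /\
  forall h, nm h <= rho / 8 ->
    nm (q (y + h) - q y - 'd q y h) <= 16 * B * (4 / rho) ^+ 2 * nm h ^+ 2.
Proof.
move=> rho0 qd qB.
have key h : h != 0 -> nm ('d q y h) <= 4 * B / rho * nm h /\ (nm h <= rho / 8 ->
    nm (q (y + h) - q y - 'd q y h) <= 16 * B * (4 / rho) ^+ 2 * nm h ^+ 2).
  move=> h0; have nh : 0 < nm h by rewrite nm_gt0.
  pose t := rho / (4 * nm h); have t0 : 0 < t by rewrite divr_gt0 ?mulr_gt0.
  have tC : t%:C != 0 :> R[i] by rewrite -nm_gt0 nm_real gtr0_norm.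
  pose w := t%:C *: h; have nw : nm w = rho / 4.
    by rewrite nmZ nm_real gtr0_norm // /t; field; rewrite gt_eqF.
  have near z : nm z <= 2 -> nm (y + z *: w - y) < rho.
    by rewrite addrC addKr nmZ nw; nra.
  pose phi z := q (y + z *: w).
  have dphi z : nm z <= 2 -> cdiff phi z.
    by move=> z2; eexists; apply: cdiff_line; apply: qd; apply: near.
  have phiB u : nm u = 1 -> nm (phi u) <= B.
    by move=> u1; apply: qB; apply: near; rewrite u1; lra.
  have dphi0 : cderiv phi 0 ('d q y w).
    have q0 : differentiable q (y + 0 *: w).
      by rewrite scale0r addr0; apply: qd; rewrite subrr nm0.
    by have := cdiff_line q0; rewrite scale0r addr0.
  have [h1 h2] := cauchy_estimates dphi phiB dphi0.
  have dw : 'd q y w = t%:C * 'd q y h.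
    by rewrite linearZ.
  have tE : t^-1 = 4 * nm h / rho by rewrite invf_div.
  split=> [|hr].
    rewrite dw nmM nm_real gtr0_norm // mulrC -ler_pdivlMr // tE in h1.
    by apply: (le_trans h1); rewrite le_eqVlt; apply/orP; left; apply/eqP; field; rewrite gt_eqF.
  have nt : nm (t%:C^-1 : R[i]) = 4 * nm h / rho by rewrite nmV nm_real gtr0_norm.
  have := h2 (t%:C^-1); rewrite nt => H.
  have : 4 * nm h / rho <= 3 / 4 by rewrite ler_pdivrMr //; lra.
  move=> /H; rewrite /phi scale0r addr0 scalerA mulVf // scale1r dw mulrAC mulfV // mul1r.
  move=> /le_trans; apply; rewrite le_eqVlt; apply/orP; left; apply/eqP; field.
  by rewrite gt_eqF.
have B0 : 0 <= B by apply: le_trans (nm_ge0 _) (qB y _); rewrite subrr nm0.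
split=> h; have [->|h0] := eqVneq h 0; try by have [] := key h h0.
  by rewrite linear0 !nm0 mulr0.
by rewrite linear0 addr0 subrr subr0 !nm0 expr0n !mulr0.
Qed.

(** Differentiation under the mean: by [differentiable_estimates] the quadratic error is uniform in
    s, so it survives averaging. *)
Lemma mean_differentiable V (q : V -> R[i]^o) x v (rho B : R) : 0 < rho ->
  (forall s y, nm s = 1 -> nm (y - (x + s *: v)) < rho ->
     differentiable q y /\ nm (q y) <= B) ->
  differentiable ((fun y => mean (fun s => q (y + s *: v))) : V -> R[i]^o) x.
Proof.
move=> rho0 hq.
have est s : nm s = 1 -> (forall h, nm ('d q (x + s *: v) h) <= 4 * B / rho * nm h) /\
  forall h, nm h <= rho / 8 ->
    nm (q (x + s *: v + h) - q (x + s *: v) - 'd q (x + s *: v) h) <= 16 * B * (4 / rho) ^+ 2 * nm h ^+ 2.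
  by move=> s1; apply: differentiable_estimates => // y' /(hq _ _ s1)[].
have bd h : circle_bounded (fun s => 'd q (x + s *: v) h).
  by exists (4 * B / rho * nm h) => s /est[+ _]; apply.
have bq h : nm h < rho -> circle_bounded (fun s => q (x + h + s *: v)).
  move=> hr; exists B => s s1; have [] // := hq s (x + h + s *: v) s1.
  by rewrite opprD addrACA subrr addr0 addrC addKr.
have B0 : 0 <= B.
  by have [|_] := hq 1 (x + 1 *: v) nm1; [rewrite subrr nm0|apply: le_trans; exact: nm_ge0].
pose L h := mean (fun s => 'd q (x + s *: v) h) : R[i]^o.
have Ll : linear L.
  move=> a u w; rewrite /L; transitivity (mean (fun s => a * 'd q (x + s *: v) u + 'd q (x + s *: v) w)).
    by apply: eq_mean => s _; rewrite linearP.
  rewrite meanD //; last exact: circle_boundedM (circle_bounded_cst _) (bd u).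
  by rewrite meanZ.
have LK h : nm (L h) <= 4 * B / rho * nm h.
  by apply: mean_le => s /est[+ _]; apply.
have [] // := @nm_differentiable R V _ ((fun y => mean (fun s => q (y + s *: v))) : V -> R[i]^o)
  x L (4 * B / rho) Ll LK.
move=> e e0; pose C := 16 * B * (4 / rho) ^+ 2.
have C0 : 0 <= C := mulr_ge0 (mulr_ge0 (ler0n _ 16) B0) (sqr_ge0 _).
exists (Num.min (rho / 8) (e / (C + 1))).
  by rewrite lt_min divr_gt0 // divr_gt0 //; lra.
move=> y; set h := y - x; rewrite lt_min => /andP[h8].
rewrite ltr_pdivlMr; last lra.
move=> he; have -> : y = x + h by rewrite addrC subrK.
have bx : circle_bounded (fun s => q (x + s *: v)).
  by have := bq 0; rewrite nm0 addr0; apply.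
have bxh : circle_bounded (fun s => q (x + h + s *: v)) by apply: bq; lra.
rewrite /L -meanB // -meanB //; last exact: circle_boundedB.
apply: (@le_trans _ _ (C * nm h ^+ 2)).
  apply: mean_le => s s1; rewrite (addrAC x h); have [_] := est s s1; apply; lra.
by rewrite expr2 mulrA ler_wpM2r ?nm_ge0 //; have := nm_ge0 h; nra.
Qed.

(** On the line c + z w with w = 2 (y - c), the point y sits at z = 1/2, within the unit disc where
    [isolated_zero] gives vanishing. That lemma needs |z| <= 2, that is, distance 4 |y - c| < r from
    c. *)
Lemma ball_identity V (f : V -> R[i]^o) c (r : R) : 0 < r ->
  (forall y, nm (y - c) < r -> differentiable f y) ->
  (exists2 d : R, 0 < d & forall y, nm (y - c) < d -> f y = 0) ->
  forall y, nm (y - c) < r / 4 -> f y = 0.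
Proof.
move=> r0 fd [d d0 hd] y yr; pose w := (2 : R[i]) *: (y - c).
have nw : nm w = 2 * nm (y - c) by rewrite nmZ nm_nat.
have nw0 := nm_ge0 w.
have [z z2||[b b0 hb]] := @isolated_zero R (fun z => f (c + z *: w)).
- eexists; apply: cdiff_line; apply: fd; rewrite addrC addKr nmZ.
  have := nm_ge0 z; nra.
- move=> /(_ 2^-1); rewrite nmV nm_nat /w scalerA mulVf ?pnatr_eq0 // scale1r.
  by rewrite addrC subrK; apply; lra.
- pose t := Num.min b (d / (nm w + 1)) / 2.
  have m0 : 0 < Num.min b (d / (nm w + 1)) by rewrite lt_min b0 divr_gt0 //; lra.
  have t0 : 0 < t by rewrite divr_gt0.
  have : t < Num.min b (d / (nm w + 1)) by rewrite /t; lra.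
  rewrite lt_min ltr_pdivlMr; last lra.
  move=> /andP[tb td]; have := hb t%:C.
  rewrite -nm_gt0 nm_real gtr0_norm // => /(_ t0 tb); rewrite hd ?eqxx //.
  by rewrite addrC addKr nmZ nm_real gtr0_norm //; nra.
Qed.

(** The set of t up to which f vanishes near the segment has a supremum. From a point shortly before
    it, [ball_identity] reaches beyond it, so the supremum is 1 and is attained. *)
Lemma segment_identity V (f : V -> R[i]^o) p q :
  (forall t : R, 0 <= t -> t <= 1 -> exists2 r : R, 0 < r &
     forall y, nm (y - (p + t%:C *: (q - p))) < r -> differentiable f y) ->
  (exists2 d : R, 0 < d & forall y, nm (y - p) < d -> f y = 0) ->
  exists2 d : R, 0 < d & forall y, nm (y - q) < d -> f y = 0.
Proof.
move=> fd f0; pose g (t : R) := p + t%:C *: (q - p).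
pose Z (t : R) := exists2 d : R, 0 < d & forall y, nm (y - g t) < d -> f y = 0.
pose S : set R := [set t | [/\ 0 <= t, t <= 1 & forall u, 0 <= u -> u <= t -> Z u]].
have gg t u : nm (g t - g u) = `|t - u| * nm (q - p).
  by rewrite /g opprD addrACA subrr add0r -scalerBl -rmorphB nmZ nm_real.
have S0 : S 0.
  split=> // u u0 u1; have -> : u = 0 by apply: le_anti; rewrite u0 u1.
  by rewrite /Z /g scale0r addr0.
have supS : has_sup S by split; [exists 0|exists 1 => t []].
pose sg := sup S; have sg0 : 0 <= sg by apply: ub_le_sup => //; case: supS.
have sg1 : sg <= 1 by apply: ge_sup; [exists 0|move=> t []].
have [r r0 hr] := fd sg sg0 sg1; have n0 := nm_ge0 (q - p).
have N0 : 0 < nm (q - p) + 1 by lra.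
(* Points within e of the supremum are at distance at most r / 16 from its image. The ball of radius
   7 r / 8 about such a point gives vanishing up to 7 r / 32, more than the r / 8 + r / 16 required
   below. *)
pose e := r / 16 / (nm (q - p) + 1); have e0 : 0 < e by rewrite !divr_gt0.
have eN : e * (nm (q - p) + 1) = r / 16 by rewrite divfK // gt_eqF.
have [t [t0 t1 tZ] ht] := sup_adherent e0 supS; rewrite -/sg in ht.
have tsg : t <= sg by apply: ub_le_sup; [case: supS|split].
have gtsg : nm (g t - g sg) <= r / 16.
  rewrite gg -eN distrC ger0_norm ?subr_ge0 //; nra.
have fz : forall y, nm (y - g t) < 7 / 8 * r / 4 -> f y = 0.
  apply: ball_identity; first lra.
    by move=> y yt; apply: hr; have := nm_sub y (g t) (g sg); rewrite -/(g sg); lra.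
  exact: tZ.
have Zu u : 0 <= u -> u <= sg + e -> Z u.
  move=> u0 ue; have [ut|ut] := leP u t; first exact: tZ.
  exists (r / 16); first lra.
  move=> y yu; apply: fz; have := nm_sub y (g u) (g t).
  have : nm (g u - g t) <= r / 8.
    rewrite gg gtr0_norm ?subr_gt0 //; have -> : r / 8 = 2 * (e * (nm (q - p) + 1)) by rewrite eN; lra.
    by nra.
  lra.
have sgE : sg = 1.
  apply: le_anti; rewrite sg1 /= leNgt; apply/negP => lt1.
  have : S (Num.min 1 (sg + e)).
    split; first by rewrite le_min ler01 /=; lra.
      by rewrite ge_min lexx.
    by move=> u u0; rewrite le_min => /andP[_]; apply: Zu.
  move=> /(ub_le_sup supS.2); rewrite -/sg ge_min; lra.
have : Z 1 by apply: Zu; rewrite ?sgE; lra.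
by rewrite /Z /g scale1r addrC subrK.
Qed.

(** Compactness in sequential form: counterexamples y_n for every n would have a limit along the
    ultrafilter, and Q n near that limit contradicts all later counterexamples by monotonicity in
    n. *)
Lemma seq_uniform V (Q : nat -> V -> Prop) (Y : nat -> set V) :
  (forall n k y, (n <= k)%N -> Q n y -> Q k y) ->
  (forall y : nat -> V, (forall n, Y n (y n)) -> exists l, is_ulim y l /\
     exists n, exists2 d : R, 0 < d & forall z, nm (z - l) < d -> Q n z) ->
  exists n, forall y, Y n y -> Q n y.
Proof.
move=> Qm hY; apply: contrapT => N.
have /choice[y hy] : forall n, exists y, Y n y /\ ~ Q n y.
  move=> n; apply: contrapT => Nn; apply: N; exists n => y Yy.
  by apply: contrapT => nQ; apply: Nn; exists y.
have [l [yl [n [d d0 hd]]]] := hY y (fun n => (hy n).1).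
have h2 : ultra_nat [set k | (n <= k)%N] := ultra_ge (fun k h => h).
have [k [/= {}h1 {}h2]] := ultraN (ultra2 (yl _ d0) h2 (fun k h h' => conj h h')).
by case: (hy k) => _; apply; apply: Qm h2 _; apply: hd.
Qed.

Lemma is_ulim_cst V (x : V) : is_ulim (fun=> x) x.
Proof. by move=> e e0; apply: (@ultra_ge _ 0) => k _ /=; rewrite subrr nm0. Qed.

Lemma is_ulim_slice V (x : nat -> V) (s : nat -> R[i]) (v l : V) (a : R[i]) :
  is_ulim x l -> is_ulim s a -> is_ulim (fun k => x k + s k *: v) (l + a *: v).
Proof.
move=> xl sa e e0; have e20 : 0 < e / 2 by rewrite divr_gt0.
have K0 : 0 < nm v + 1 by rewrite ltr_wpDl ?nm_ge0.
apply: (ultra2 (xl _ e20) (sa _ (divr_gt0 e20 K0))) => k /= h1.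
rewrite ltr_pdivlMr // => h2; rewrite opprD addrACA -scalerBl.
rewrite (le_lt_trans (nmD _ _)) // nmZ; have := nm_ge0 (s k - a); have := nm_ge0 v.
nra.
Qed.

Lemma eq_is_ulim V (x y : nat -> V) l :
  (forall k, y k = x k) -> is_ulim x l -> is_ulim y l.
Proof. by move=> yx; rewrite (funext yx). Qed.

(** Only s ranges over a compact set while x tends to x0, so V may be any normed space. One number c
    serves as the radius and as the lower bound. *)
Lemma slice_lower V (H : V -> R[i]) x0 v (a b : R) :
  (forall s, a <= nm s -> nm s <= b -> ncont H (x0 + s *: v) /\ H (x0 + s *: v) != 0) ->
  exists c : R, 0 < c /\ forall x s, nm (x - x0) <= c -> a <= nm s -> nm s <= b ->
    c <= nm (H (x + s *: v)).
Proof.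
move=> hH.
have [||n hn] := @seq_uniform V (fun n y => n.+1%:R^-1 <= nm (H y))
  (fun n => [set y | exists x s, [/\ nm (x - x0) <= n.+1%:R^-1, a <= nm s, nm s <= b & y = x + s *: v]]).
- move=> n k y nk; apply: le_trans; rewrite lef_pV2 ?posrE // ler_nat ltnS //.
- move=> y /choice[x] /choice[s] hy.
  have xl : is_ulim x x0 by apply: is_ulim_inv_near (is_ulim_cst x0) => k; case: (hy k).
  have [l sl lb] := @bounded_ulim R s b (fun k => let: And4 _ _ h _ := hy k in h).
  have al : a <= nm l.
    rewrite leNgt; apply/negP => la; have d0 : 0 < a - nm l by lra.
    have [k /= hk] := ultraN (sl _ d0); case: (hy k) => _ + _ _.
    have := nm_sub (s k) l 0; rewrite !subr0; lra.
  exists (x0 + l *: v); split.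
    by apply: eq_is_ulim (is_ulim_slice v xl sl) => k; case: (hy k).
  have [Hc H0] := hH l al lb; have h0 : 0 < nm (H (x0 + l *: v)) by rewrite nm_gt0.
  have h2 : 0 < nm (H (x0 + l *: v)) / 2 by lra.
  have [n /= hn] := ultraN (ultra_inv h2); have [d d0 hd] := Hc _ h2.
  exists n; exists d => // z /hd; have := nm_lbB (H (x0 + l *: v)) (H z).
  by rewrite (nmC (H (x0 + l *: v)) (H z)) => h3 h4; apply: le_trans (ltW hn) _; lra.
- exists (n.+1%:R^-1); split=> [|x s hx hs hs']; first by rewrite invr_gt0.
  by apply: hn; exists x, s.
Qed.

End SeveralVariables.

(** * Compactness of closed balls in C^m *)

Section RowVectors.
Context {R : realType} {m : nat}.
#[local] Notation V := 'rV[R[i]]_m.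

Lemma nm_row_lt (x : V) (e : R) : 0 < e -> (forall j, nm (x 0 j) < e) -> nm x < e.
Proof.
move=> e0 h; have : ball (0 : V) e%:C x.
  split=> [|i j]; first by rewrite ltcR.
  rewrite (ord1 i) mxE; change (ball (0 : R[i]^o) e%:C (x 0 j : R[i]^o)).
  by rewrite -ball_normE /= sub0r normrN nmE ltcR.
by rewrite -ball_normE /= sub0r normrN nmE ltcR.
Qed.

Lemma nm_coord_lt (x : V) (e : R) j : nm x < e -> nm (x 0 j) < e.
Proof.
move=> xe; have : ball (0 : V) e%:C x.
  by rewrite -ball_normE /= sub0r normrN nmE ltcR.
move=> [_ /(_ 0 j)]; rewrite mxE => h.
have : ball (0 : R[i]^o) e%:C (x 0 j : R[i]^o) by exact: h.
by rewrite -ball_normE /= sub0r normrN nmE ltcR.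
Qed.

Lemma row_bounded_ulim (x : nat -> V) (x0 : V) (r : R) : (forall k, nm (x k - x0) <= r) ->
  exists2 l, is_ulim x l & nm (l - x0) <= r.
Proof.
move=> xr.
have xj j k : nm (x k 0 j) <= r + nm x0 + 1.
  apply/ltW/nm_coord_lt; have := nm_sub (x k) x0 0; have := xr k; rewrite !subr0; lra.
pose l : V := \row_j ulim (fun k => x k 0 j).
have xl : is_ulim x l.
  move=> e e0; have : forall j, ultra_nat [set k | nm ((x k - l) 0 j) < e].
    move=> j; have := @ulimP R (fun k => x k 0 j) (ex_intro _ _ (xj j)) e e0.
    by apply: filterS => k /=; rewrite !mxE.
  move=> /filter_forall; apply: filterS => k /= h; exact: nm_row_lt.
by exists l => //; apply: (is_ulim_le xl); apply: (@ultra_ge _ 0) => k _ /=.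
Qed.

(** Here x ranges over a whole closed ball of fixed radius, so the finite dimension of the space is
    used, unlike in [slice_lower]. *)
Lemma slice_upper (P : V -> R[i]) x0 v (rho : R) :
  (forall x s, nm (x - x0) <= rho -> nm s = 1 -> ncont P (x + s *: v)) ->
  exists B : R, forall x s, nm (x - x0) <= rho -> nm s = 1 -> nm (P (x + s *: v)) <= B.
Proof.
move=> hP.
have [||n hn] := @seq_uniform R V (fun n y => nm (P y) <= n%:R)
  (fun n => [set y | exists x s, [/\ nm (x - x0) <= rho, nm s = 1 & y = x + s *: v]]).
- by move=> n k y nk /le_trans; apply; rewrite ler_nat.
- move=> y /choice[x] /choice[s] hy.
  have [l xl lr] := @row_bounded_ulim x x0 rho (fun k => let: And3 h _ _ := hy k in h).
  have s1 k : nm (s k) = 1 by case: (hy k).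
  have [a sa a1] := @bounded_ulim R s 1 (fun k => eq_ind_r (fun x => is_true (x <= 1)) (lexx 1) (s1 k)).
  have na : nm a = 1.
    apply: le_anti; rewrite a1 /= leNgt; apply/negP => la; have d0 : 0 < 1 - nm a by lra.
    have [k /= hk] := ultraN (sa _ d0); have := nm_sub (s k) a 0; rewrite !subr0 s1; lra.
  exists (l + a *: v); split.
    by apply: eq_is_ulim (is_ulim_slice v xl sa) => k; case: (hy k).
  have [d d0 hd] := hP l a lr na 1 ltr01.
  exists (Num.bound (nm (P (l + a *: v)) + 1)); exists d => // z /hd.
  have := archimedean.Num.Theory.archi_boundP (addr_ge0 (nm_ge0 (P (l + a *: v))) ler01).
  have := nm_lbB (P z) (P (l + a *: v)); lra.
- by exists n%:R => x s hx hs; apply: hn; exists x, s.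
Qed.

End RowVectors.

(** * Division by powers of a holomorphic function *)

Section Division.
Context {R : realType}.

Lemma cdiffX (f : R[i] -> R[i]) z N : cdiff f z -> cdiff (fun w => f w ^+ N) z.
Proof.
move=> fz; elim: N => [|N IH].
  by exists 0 => e e0; exists 1 => // w _; rewrite !expr0 subrr mul0r subr0 nm0 mulr_ge0 ?nm_ge0 // ltW.
by apply: cdiff_near (cdiffM fz IH); exists 1 => // w _; rewrite exprS.
Qed.

Lemma differentiable_pow (V : normedModType R[i]) (f : V -> R[i]^o) x N :
  differentiable f x -> differentiable ((fun y => f y ^+ N) : V -> R[i]^o) x.
Proof.
move=> fx; elim: N => [|N IH].
  rewrite (_ : (fun y => f y ^+ 0) = cst 1); first exact: differentiable_cst.
  by apply/funext => y; rewrite expr0.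
rewrite (_ : (fun y => f y ^+ N.+1) = f * (fun y => f y ^+ N)); first exact: differentiableM.
by apply/funext => y; rewrite exprS.
Qed.

Lemma slice_quotient (V : normedModType R[i]) (H P : V -> R[i]^o) (x v : V) N :
  (forall s, nm s < 3 -> differentiable H (x + s *: v)) ->
  (forall s, nm s < 3 -> differentiable P (x + s *: v)) ->
  (forall s, nm s = 1 -> H (x + s *: v) != 0) ->
  (forall s, nm s < 3 -> H (x + s *: v) = 0 -> exists K : R, exists2 d : R, 0 < d &
     forall w, nm (w - s) < d -> nm (P (x + w *: v)) <= K * nm (H (x + w *: v) ^+ N)) ->
  P x = H x ^+ N * mean (fun s => P (x + s *: v) / H (x + s *: v) ^+ N).
Proof.
move=> dH dP H1 bnd.
pose phi s : R[i] := H (x + s *: v) ^+ N; pose psi s : R[i] := P (x + s *: v).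
have dphi z : nm z < 3 -> cdiff phi z.
  by move=> z3; apply: cdiffX; eexists; apply: cdiff_line; apply: dH.
have phi1 u : nm u = 1 -> phi u != 0 by move=> u1; rewrite expf_neq0 ?H1.
have := @quotient_mean R phi psi; rewrite /phi /psi scale0r addr0; apply=> // z z3.
- by eexists; apply: cdiff_line; apply: dP.
- have r0 : 0 < 3 - nm z by lra.
  have [w wz|[d d0 hd]|//] := @isolated_zero_at R phi z _ r0.
    by apply: dphi; have := nm_sub w z 0; rewrite !subr0; lra.
  (* If H^N vanished near a point of the disc |s| < 3, it would vanish near s = 1 by the identity
     theorem along a segment, but H has no zero on the circle. *)
  have [t t0 t1||b b0 hb] := @segment_identity R R[i]^o phi z 1; last 2 first.
  + by exists d.
  + by have := phi1 1 nm1; rewrite hb ?eqxx // subrr nm0.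
  have n3 : nm (z + t%:C * (1 - z)) < 3.
    have -> : z + t%:C * (1 - z) = (1 - t)%:C * z + t%:C by rewrite rmorphB rmorph1; ring.
    rewrite (le_lt_trans (nmD _ _)) // nmM !nm_real !ger0_norm ?subr_ge0 //.
    have := nm_ge0 z; nra.
  exists (3 - nm (z + t%:C * (1 - z))) => [|y hy]; first lra.
  apply/cdiffP/dphi; have := nm_sub y (z + t%:C * (1 - z)) 0; rewrite !subr0.
  rewrite -[_ *: _]/(t%:C * (1 - z)) in hy; lra.
- by move=> /eqP; rewrite expf_eq0 => /andP[_ /eqP]; apply: bnd.
Qed.

Lemma nm_diff_compare (a b c d D E : R[i]) :
  nm (D - E) <= nm (a - b - D) + nm (c - d - E) + nm (a - c) + nm (b - d).
Proof.
have -> : D - E = (c - d - E) - (a - b - D) + (a - c) - (b - d) by ring.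
rewrite (le_trans (nmB _ _)) // lerD2r (le_trans (nmD _ _)) // lerD2r.
by rewrite [leRHS]addrC nmB.
Qed.

(** The differential at y along a small h = t v is compared with H(y + h) - H(y), up to a quadratic
    error uniform in y; the latter is continuous in y. *)
Lemma differential_neq0_near (V : normedModType R[i]) (H : V -> R[i]^o) (x0 v : V) (r : R) :
  0 < r -> (forall y, nm (y - x0) < r -> differentiable H y) ->
  'd H x0 v != 0 :> R[i] ->
  exists2 b : R, 0 < b & forall y, nm (y - x0) < b -> 'd H y v != 0 :> R[i].
Proof.
move=> r0 dH; set l : R[i] := 'd H x0 v => l0; have nl : 0 < nm l by rewrite nm_gt0.
have x0r : nm (x0 - x0) < r by rewrite subrr nm0.
have nv0 := nm_ge0 v; have K0 : 0 < nm v + 1 by lra.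
have [d0 d00 hd0] := differentiable_ncont (dH _ x0r) ltr01.
pose d := Num.min d0 r; have dp : 0 < d by rewrite lt_min d00.
have dd0 : d <= d0 by rewrite ge_min lexx.
have dr : d <= r by rewrite ge_min lexx orbT.
have d2 : 0 < d / 2 by lra.
pose B := nm (H x0) + 1; have B0 : 0 < B by rewrite /B; have := nm_ge0 (H x0); lra.
have [C C0 est] : exists2 C : R, 0 < C & forall y, nm (y - x0) < d / 2 ->
    forall h, nm h <= d / 2 / 8 -> nm (H (y + h) - H y - 'd H y h) <= C * nm h ^+ 2.
  exists (16 * B * (4 / (d / 2)) ^+ 2).
    by apply: mulr_gt0 (mulr_gt0 _ B0) (exprn_gt0 _ (divr_gt0 _ d2)); rewrite ltr0n.
  move=> y yd; have near y' : nm (y' - y) < d / 2 -> nm (y' - x0) < d.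
    by have := nm_sub y' y x0; lra.
  have [||_ //] := @differentiable_estimates R V H y (d / 2) B d2.
  - by move=> y' /near h; apply: dH; lra.
  - move=> y' /near h; have := hd0 y'; have := nm_lbB (H y') (H x0).
    by rewrite /B => h1 h2; have := h2 (lt_le_trans h dd0); lra.
pose q := C * (nm v + 1) ^+ 2; have q0 : 0 < q by rewrite mulr_gt0 ?exprn_gt0.
(* With this t each Taylor error is at most t |l| / 8. Two of them and two errors from the
   continuity of H add up to t |l| / 2. *)
pose t := Num.min (d / 16 / (nm v + 1)) (nm l / 8 / q).
have t0 : 0 < t by rewrite lt_min !divr_gt0.
have td : t * (nm v + 1) <= d / 16 by rewrite -ler_pdivlMr // ge_min lexx.
have tL : t * q <= nm l / 8 by rewrite -ler_pdivlMr // ge_min lexx orbT.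
clearbody t.
pose h := t%:C *: v; have nh : nm h = t * nm v by rewrite nmZ nm_real gtr0_norm.
have hd : nm h <= d / 2 / 8 by rewrite nh; nra.
have Ch : C * nm h ^+ 2 <= t * (nm l / 8).
  rewrite nh; have -> : C * (t * nm v) ^+ 2 = t * (t * (C * nm v ^+ 2)) by ring.
  rewrite ler_pM2l //; apply: le_trans tL; rewrite ler_pM2l // /q ler_pM2l //.
  by rewrite !expr2; nra.
have e0 : 0 < t * (nm l / 8) by rewrite mulr_gt0 // divr_gt0.
have xh : nm (x0 + h - x0) < r by rewrite addrC addKr; lra.
have [b1 b10 hb1] := differentiable_ncont (dH _ x0r) e0.
have [b2 b20 hb2] := differentiable_ncont (dH _ xh) e0.
exists (Num.min (d / 2) (Num.min b1 b2)); first by rewrite !lt_min d2 b10.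
move=> y; rewrite !lt_min => /and3P[yd yb1 yb2].
have h1 := est y yd h hd; have x0d : nm (x0 - x0) < d / 2 by rewrite subrr nm0.
have h2 := est x0 x0d h hd; have h3 := hb1 y yb1.
have := hb2 (y + h); rewrite opprD addrACA subrr addr0 => /(_ yb2) h4.
have := nm_diff_compare (H (y + h)) (H y) (H (x0 + h)) (H x0) ('d H y h) ('d H x0 h).
have Eh y' : 'd H y' h = t%:C * 'd H y' v :> R[i] by rewrite linearZ.
have -> : nm ('d H y h - 'd H x0 h : R[i]) = t * nm ('d H y v - l : R[i]).
  by rewrite !Eh -mulrBr nmM nm_real gtr0_norm.
move=> h5; have : t * nm ('d H y v - l : R[i]) <= t * (nm l / 2).
  apply: (le_trans h5); apply: (@le_trans _ _ (C * nm h ^+ 2 + C * nm h ^+ 2 + t * (nm l / 8) + t * (nm l / 8))).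
    by rewrite !lerD.
  by move: Ch; clear; move: (C * _) => w hw; lra.
rewrite ler_pM2l // => hh; rewrite -nm_gt0.
have := nm_lbB l ('d H y v); rewrite (nmC l); move: hh nl.
by move: (nm _) (nm l) (nm _) => p1 p2 p3; clear; lra.
Qed.

(** On the line from x0 to a nearby point where H is nonzero, x0 is isolated among the zeros of H;
    shrinking the direction empties the punctured disc of radius 3, the radius of the slices in
    [slice_quotient]. *)
Lemma nonzero_direction (V : normedModType R[i]) (H : V -> R[i]^o) (x0 : V) (r : R) : 0 < r ->
  (forall y, nm (y - x0) < r -> differentiable H y) ->
  ~ (exists2 d : R, 0 < d & forall y, nm (y - x0) < d -> H y = 0) ->
  exists2 v : V, 6 * nm v < r & forall s, 0 < nm s -> nm s <= 3 -> H (x0 + s *: v) != 0.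
Proof.
move=> r0 dH N.
have [y yr y0] : exists2 y, nm (y - x0) < r / 8 & H y != 0.
  apply: contrapT => Ny; apply: N; exists (r / 8) => [|y yr]; first lra.
  by apply: contrapT => /eqP h; apply: Ny; exists y.
pose w := (2 : R[i]) *: (y - x0).
have nw : nm w = 2 * nm (y - x0) by rewrite nmZ nm_nat.
have nw0 := nm_ge0 w.
have [z z2|h|[d d0 hd]] := @isolated_zero R (fun z => H (x0 + z *: w)).
- eexists; apply: cdiff_line; apply: dH; rewrite addrC addKr nmZ.
  have := nm_ge0 z; nra.
- have := h 2^-1; rewrite nmV nm_nat /w scalerA mulVf ?pnatr_eq0 // scale1r.
  by rewrite addrC subrK => h0; rewrite h0 ?eqxx // in y0; lra.
pose k := Num.min d 1 / 6.
have m0 : 0 < Num.min d 1 by rewrite lt_min d0 ltr01.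
have k0 : 0 < k by rewrite divr_gt0.
have : 3 * k < Num.min d 1 by rewrite /k; lra.
rewrite lt_min => /andP[kd k1].
exists (k%:C *: w); first by rewrite nmZ nm_real gtr0_norm //; nra.
move=> s s0 s3; rewrite scalerA; apply: hd.
  by rewrite -nm_gt0 nmM nm_real gtr0_norm // mulr_gt0.
by rewrite nmM nm_real gtr0_norm //; nra.
Qed.

Context {m : nat}.
#[local] Notation V := 'rV[R[i]]_m.

(* The Cauchy integral of P / H^N over the circle x0 + s v, |s| = 1, around
   which H does not vanish: the radius depends neither on P nor on N. *)
Lemma division (H : V -> R[i]^o) (x0 v : V) (r : R) :
  (forall y, nm (y - x0) < r -> differentiable H y) -> 6 * nm v < r ->
  (forall s, 0 < nm s -> nm s <= 3 -> H (x0 + s *: v) != 0) ->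
  exists2 delta : R, 0 < delta & forall N (P : V -> R[i]^o),
    (forall y, nm (y - x0) < r -> differentiable P y) ->
    (exists K : R, exists2 d : R, 0 < d & forall y, nm (y - x0) < d ->
       nm (P y) <= K * nm (H y) ^+ N) ->
    exists (g : V -> R[i]^o) (B : R), forall x, nm (x - x0) < delta ->
      [/\ differentiable g x, nm (g x) <= B & g x * H x ^+ N = P x].
Proof.
move=> dH vr Hv; have v0 := nm_ge0 v.
have slice x s : nm (x + s *: v - x0) <= nm (x - x0) + nm s * nm v.
  by rewrite addrAC (le_trans (nmD _ _)) // nmZ.
(* With a = 1 this keeps H away from 0 on the circles; with a small it confines the zeros of H on
   nearby slices to |s| < a. *)
have low (a : R) : 0 < a -> exists c : R, 0 < c /\ forall x s, nm (x - x0) <= c ->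
    a <= nm s -> nm s <= 3 -> c <= nm (H (x + s *: v)).
  move=> a0; apply: slice_lower => s as_ s3; split; last by apply: Hv => //; lra.
  apply/differentiable_ncont/dH; have := slice x0 s; rewrite subrr nm0; nra.
have [c [c0 hc]] := low 1 ltr01.
pose rho := Num.min c (r / 4).
have rho0 : 0 < rho by rewrite lt_min c0; lra.
have rhoc : rho <= c by rewrite ge_min lexx.
have rhor : rho <= r / 4 by rewrite ge_min lexx orbT.
(* Half of rho is left for differentiating the mean, and a quarter of that is the loss in
   [ball_identity]. *)
clearbody rho; exists (rho / 2 / 4) => [|N P dP [K [d d0 hK]]]; first lra.
have inb x s : nm (x - x0) <= rho -> nm s = 1 -> nm (x + s *: v - x0) < r.
  by move=> h s1; have := slice x s; rewrite s1; lra.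
have [B hB] := @slice_upper R m P x0 v rho
  (fun x s h s1 => differentiable_ncont (dP _ (inb _ _ h s1))).
have cH x s : nm (x - x0) <= rho -> nm s = 1 -> c <= nm (H (x + s *: v)).
  by move=> h s1; apply: hc; rewrite ?s1 //; lra.
pose q (y : V) : R[i]^o := P y / H y ^+ N.
have Hn0 y : c <= nm (H y) -> H y ^+ N != 0.
  by move=> h; rewrite expf_neq0 // -nm_gt0; lra.
have qB x s : nm (x - x0) <= rho -> nm s = 1 -> nm (q (x + s *: v)) <= B / c ^+ N.
  move=> h s1; rewrite nmM nmV nmX; apply: ler_pM; rewrite ?nm_ge0 ?invr_ge0 ?exprn_ge0 ?nm_ge0 ?hB //.
  have := cH _ _ h s1 => cH1; rewrite lef_pV2 ?posrE ?exprn_gt0 //; last lra.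
  by rewrite lerXn2r ?nnegrE ?nm_ge0 ?(ltW c0).
have qd x s : nm (x - x0) <= rho -> nm s = 1 -> differentiable q (x + s *: v).
  move=> h s1; apply: differentiableM; first by apply: dP; apply: inb.
  apply: differentiableV; last by apply: Hn0; apply: cH.
  by apply: differentiable_pow; apply: dH; apply: inb.
pose g (x : V) : R[i]^o := mean (fun s => q (x + s *: v)).
have gd x : nm (x - x0) < rho / 2 -> differentiable g x.
  move=> h; have rho2 : 0 < rho / 2 by lra.
  apply: (mean_differentiable (B := B / c ^+ N) rho2) => s y s1 ys.
  have -> : y = (y - s *: v) + s *: v by rewrite subrK.
  have hy : nm (y - s *: v - x0) <= rho.
    have -> : y - s *: v - x0 = (y - (x + s *: v)) + (x - x0).
      by rewrite opprD [- x - _]addrC addrA addrA subrK.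
    by have := nmD (y - (x + s *: v)) (x - x0); lra.
  by split; [apply: qd|apply: qB].
(* The bound on P is available within d of x0 only. For x close enough to x0 all zeros of H on the
   slice lie in that range, so the quotient is represented by its mean; [ball_identity] then extends
   the equation to a radius independent of d. *)
have near0 : exists2 b : R, 0 < b & forall x, nm (x - x0) < b -> g x * H x ^+ N - P x = 0.
  pose a := Num.min 1 (d / (2 * (nm v + 1))).
  have a0 : 0 < a by rewrite lt_min ltr01 divr_gt0 //; lra.
  have a1 : a <= 1 by rewrite ge_min lexx.
  have ad : a * nm v <= d / 2.
    have : a <= d / (2 * (nm v + 1)) by rewrite ge_min lexx orbT.
    rewrite ler_pdivlMr; last lra.
    by move=> h; have := ltW a0; nra.
  have [c1 [c10 hc1]] := low a a0.
  exists (Num.min c1 (Num.min (d / 2) rho)).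
    by rewrite !lt_min c10 rho0 andbT /=; lra.
  move=> x; rewrite !lt_min => /and3P[xc xd xr].
  apply/eqP; rewrite subr_eq0; apply/eqP.
  rewrite (@slice_quotient _ H P x v N); first by rewrite /g mulrC.
  - move=> s s3; apply: dH; have := slice x s; nra.
  - move=> s s3; apply: dP; have := slice x s; nra.
  - by move=> s s1; rewrite -nm_gt0 (lt_le_trans c10) // hc1 ?s1 ?ler1n // ltW.
  - move=> s s3 Hs0; have sa : nm s < a.
      rewrite ltNge; apply/negP => as_.
      by have := hc1 x s (ltW xc) as_ (ltW s3); rewrite Hs0 nm0; lra.
    have sd : nm (x + s *: v - x0) < d by have := slice x s; nra.
    exists K; exists ((d - nm (x + s *: v - x0)) / (nm v + 1)).
      by rewrite divr_gt0 ?subr_gt0 //; lra.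
    move=> w; rewrite ltr_pdivlMr; last lra.
    move=> ws; rewrite nmX; apply: hK.
    have := nm_sub (x + w *: v) (x + s *: v) x0.
    have -> : x + w *: v - (x + s *: v) = (w - s) *: v.
      by rewrite opprD addrACA subrr add0r scalerBl.
    rewrite nmZ; move: ws (nm_ge0 (w - s)).
    move: (nm (w - s)) (nm v) (nm (x + w *: v - x0)) (nm (x + s *: v - x0)) => p1 p2 p3 p4.
    by clear; nra.
exists g, (B / c ^+ N) => x xr; split.
- by apply: gd; lra.
- by apply: mean_le => s s1; apply: qB => //; lra.
- apply/eqP; rewrite -subr_eq0; apply/eqP.
  have rho2 : 0 < rho / 2 by lra.
  apply: (@ball_identity R V (fun x => g x * H x ^+ N - P x : R[i]^o) x0 (rho / 2) rho2 _ near0 x xr).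
  move=> y yr; have yr' : nm (y - x0) < r by lra.
  apply: differentiableB; last exact: dP.
  apply: differentiableM; first exact: gd.
  by apply: differentiable_pow; apply: dH.
Qed.

(** In a direction where the differential of H stays nonzero, all zeros of H on nearby slices are
    simple, so P / H is locally bounded on each slice, with constants depending on the slice. The
    mean over the circle makes the bound uniform. *)
Lemma simple_zero_bound (H P : V -> R[i]^o) (x0 v : V) (r : R) : 0 < r ->
  (forall y, nm (y - x0) < r -> differentiable H y) ->
  (forall y, nm (y - x0) < r -> differentiable P y) ->
  H x0 = 0 -> 'd H x0 v != 0 :> R[i] ->
  (forall y, nm (y - x0) < r -> H y = 0 -> P y = 0) ->
  exists K : R, exists2 d : R, 0 < d & forall y, nm (y - x0) < d ->
    nm (P y) <= K * nm (H y).
Proof.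
move=> r0 dH dP H0 L0 HP.
have x0r : nm (x0 - x0) < r by rewrite subrr nm0.
have nv0 := nm_ge0 v; have K0 : 0 < nm v + 1 by lra.
have [b b0 hb] := differential_neq0_near r0 dH L0.
set L := 'd H x0 v in L0; have nL : 0 < nm L by rewrite nm_gt0.
have dl : cderiv (fun s => H (x0 + s *: v)) 0 L.
  have q0 : differentiable H (x0 + 0 *: v) by rewrite scale0r addr0; apply: dH.
  by have := cdiff_line q0; rewrite scale0r addr0.
have nL2 : 0 < nm L / 2 by lra.
have [a a0 ha] := dl _ nL2.
(* The bound a / 4 keeps the disc |s| <= 3 in the range where H is close to its linear part, and the
   other one keeps the slices within r and b. *)
pose k := Num.min (a / 4) (Num.min r b / (8 * (nm v + 1))).
have rb0 : 0 < Num.min r b by rewrite lt_min r0.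
have k0 : 0 < k by rewrite lt_min divr_gt0 //= divr_gt0 // mulr_gt0.
have ka : k <= a / 4 by rewrite ge_min lexx.
have : k <= Num.min r b / (8 * (nm v + 1)) by rewrite ge_min lexx orbT.
rewrite ler_pdivlMr ?mulr_gt0 // le_min => /andP[kr kb].
clearbody k; pose w := k%:C *: v; have nw : nm w = k * nm v by rewrite nmZ nm_real gtr0_norm.
have wr : 8 * nm w < r by rewrite nw; lra.
have wb : 8 * nm w < b by rewrite nw; lra.
have nw0 := nm_ge0 w.
have Hw s : 0 < nm s -> nm s <= 3 -> H (x0 + s *: w) != 0.
  move=> s0 s3; rewrite scalerA -nm_gt0; have ns : nm (s * k%:C) = nm s * k.
    by rewrite nmM nm_real gtr0_norm.
  have sp : 0 < nm s * k by rewrite mulr_gt0.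
  have sa : nm (s * k%:C) < a by rewrite ns; nra.
  have := ha (s * k%:C); rewrite subr0 => /(_ sa); rewrite scale0r addr0 H0 subr0 ns.
  have := nm_lbB (L * (s * k%:C)) (H (x0 + (s * k%:C) *: v)).
  rewrite nmM ns (nmC (L * _)); nra.
have slice x s : nm (x + s *: w - x0) <= nm (x - x0) + nm s * nm w.
  by rewrite addrAC (le_trans (nmD _ _)) // nmZ.
have [c [c0 hc]] : exists c : R, 0 < c /\ forall x s, nm (x - x0) <= c ->
    1 <= nm s -> nm s <= 3 -> c <= nm (H (x + s *: w)).
  apply: slice_lower => s s1 s3; split; last by apply: Hw => //; lra.
  apply/differentiable_ncont/dH; have := slice x0 s; rewrite subrr nm0; nra.
pose rho := Num.min c (Num.min (r / 4) (b / 4)).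
have rho0 : 0 < rho by rewrite !lt_min c0 /=; lra.
have rhoc : rho <= c by rewrite ge_min lexx.
have rhor : rho <= r / 4 by rewrite !ge_min lexx orbT.
have rhob : rho <= b / 4 by rewrite !ge_min lexx !orbT.
clearbody rho.
have inb x s : nm (x - x0) <= rho -> nm s < 3 -> nm (x + s *: w - x0) < r /\ nm (x + s *: w - x0) < b.
  move=> h s3; have := slice x s; have := nm_ge0 s => s0 h2.
  have h4 : nm s * nm w <= 3 * nm w by rewrite ler_wpM2r // ltW.
  by clear -h h2 h4 rhor rhob wr wb nw0; split; lra.
have [|B hB] := @slice_upper R m P x0 w rho.
  move=> x s h s1; apply/differentiable_ncont/dP.
  by have [] := inb x s h; rewrite ?s1 ?ltr1n.
exists (B / c); exists rho => // x xr; have xr' := ltW xr.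
rewrite (@slice_quotient V H P x w 1).
- rewrite expr1 nmM mulrC ler_wpM2r ?nm_ge0 //; apply: mean_le => s s1.
  rewrite expr1 nmM nmV; apply: ler_pM; rewrite ?nm_ge0 ?invr_ge0 ?nm_ge0 ?hB //.
  have ch : c <= nm (H (x + s *: w)) by rewrite hc ?s1 ?ler1n // (le_trans xr').
  by rewrite lef_pV2 ?posrE // (lt_le_trans c0).
- by move=> s s3; apply: dH; have [] := inb x s xr' s3.
- by move=> s s3; apply: dP; have [] := inb x s xr' s3.
- by move=> s s1; rewrite -nm_gt0 (lt_le_trans c0) // hc ?s1 ?ler1n // (le_trans xr').
- move=> s s3 Hs; have [h1 h2] := inb x s xr' s3.
  have D1 := cdiff_line (dH _ h1); have D2 := cdiff_line (dP _ h1).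
  have [|K [d d0 hK]] := simple_zero_quotient D1 _ Hs D2 (HP _ h1 Hs).
    have -> : 'd H (x + s *: w) w = k%:C * 'd H (x + s *: w) v :> R[i] by rewrite [in 'd H _ w]linearZ.
    by rewrite mulf_neq0 ?hb // -nm_gt0 nm_real gtr0_norm.
  by exists K; exists d => // z /hK; rewrite expr1.
Qed.

End Division.

(** * Extension across a locus with dense complement *)

Section Differentiability.
Context {R : realType}.

Lemma differentiable_near (V W : normedModType R[i]) (f g : V -> W) x :
  (exists2 d : R, 0 < d & forall y, nm (y - x) < d -> f y = g y) ->
  differentiable f x -> differentiable g x.
Proof.
move=> [d d0 fg] df; have [K hK] := differentiable_bound df.
have [] // := @nm_differentiable _ _ _ g x ('d f x) K _ hK _.
  by move=> a u v; rewrite linearP.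
move=> e e0; have [c c0 h] := differentiable_nm df e0.
exists (Num.min c d) => [|y]; first by rewrite lt_min c0.
rewrite lt_min => /andP[yc yd]; rewrite -!fg //; first exact: h.
by rewrite subrr nm0.
Qed.

Lemma differentiable_bigsum (V W : normedModType R[i]) (I : Type) (r : seq I)
    (P : pred I) (f : I -> V -> W) x : (forall i, differentiable (f i) x) ->
  differentiable (fun y => \sum_(i <- r | P i) f i y) x.
Proof.
move=> df; elim: r => [|i r IH].
  rewrite (_ : (fun y => _) = cst 0); first exact: differentiable_cst.
  by apply/funext => y; rewrite big_nil.
have [Pi|Pi] := boolP (P i); last first.
  by rewrite (_ : (fun y => _) = fun y => \sum_(j <- r | P j) f j y) //;
    apply/funext => y; rewrite big_cons (negbTE Pi).
rewrite (_ : (fun y => _) = f i + fun y => \sum_(j <- r | P j) f j y).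
  exact: differentiableD.
by apply/funext => y; rewrite big_cons Pi.
Qed.

Lemma differentiable_bigprod (V : normedModType R[i]) (I : Type) (r : seq I)
    (P : pred I) (f : I -> V -> R[i]^o) x : (forall i, differentiable (f i) x) ->
  differentiable ((fun y => \prod_(i <- r | P i) (f i y : R[i])) : V -> R[i]^o) x.
Proof.
move=> df; elim: r => [|i r IH].
  rewrite (_ : (fun y => _) = cst (1 : R[i]^o)); first exact: differentiable_cst.
  by apply/funext => y; rewrite big_nil.
have [Pi|Pi] := boolP (P i); last first.
  by rewrite (_ : (fun y => _) = fun y => \prod_(j <- r | P j) (f j y : R[i])) //;
    apply/funext => y; rewrite big_cons (negbTE Pi).
rewrite (_ : (fun y => _) = f i * fun y => \prod_(j <- r | P j) (f j y : R[i])).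
  exact: differentiableM.
by apply/funext => y; rewrite big_cons Pi.
Qed.

Lemma differentiable_entry (V : normedModType R[i]) p q (M : V -> 'M[R[i]]_(p, q)) x i j :
  differentiable M x -> differentiable ((fun y => M y i j) : V -> R[i]^o) x.
Proof.
by move=> dM; have := differentiable_comp dM (differentiable_coord (M x) i j).
Qed.

Lemma differentiable_matrix (V : normedModType R[i]) p q (M : V -> 'M[R[i]]_(p, q)) x :
  (forall i j, differentiable ((fun y => M y i j) : V -> R[i]^o) x) ->
  differentiable M x.
Proof.
move=> dM; rewrite (_ : M = fun y => \sum_i \sum_j M y i j *: delta_mx i j); last first.
  by apply/funext => y; rewrite [LHS]matrix_sum_delta.
apply: differentiable_bigsum => i; apply: differentiable_bigsum => j.
exact: differentiableZl.
Qed.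

Lemma differentiable_det (V : normedModType R[i]) p (M : V -> 'M[R[i]]_p) x :
  (forall i j, differentiable ((fun y => M y i j) : V -> R[i]^o) x) ->
  differentiable ((fun y => \det (M y)) : V -> R[i]^o) x.
Proof.
move=> dM; apply: differentiable_bigsum => s.
apply: differentiableM; first exact: differentiable_cst.
by apply: differentiable_bigprod => i.
Qed.

Lemma differentiable_mulmx (V : normedModType R[i]) p q k (M : V -> 'M[R[i]]_(p, q))
    (N : V -> 'M[R[i]]_(q, k)) x :
  differentiable M x -> differentiable N x -> differentiable (fun y => M y *m N y) x.
Proof.
move=> dM dN; apply: differentiable_matrix => i j.
rewrite (_ : (fun y => _) = fun y => \sum_l (M y i l * N y l j)); last first.
  by apply/funext => y; rewrite mxE.
apply: differentiable_bigsum => l.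
exact: differentiableM (differentiable_entry _ _ dM) (differentiable_entry _ _ dN).
Qed.

Lemma differentiable_invmx (V : normedModType R[i]) p (M : V -> 'M[R[i]]_p) x :
  differentiable M x -> (exists2 d : R, 0 < d & forall y, nm (y - x) < d -> M y \in unitmx) ->
  differentiable (fun y => invmx (M y)) x.
Proof.
move=> dM [d d0 hd]; have ux : M x \in unitmx by apply: hd; rewrite subrr nm0.
apply: (@differentiable_near _ _ (fun y => (\det (M y))^-1 *: \adj (M y))).
  by exists d => // y /hd uy; rewrite /invmx uy.
apply: differentiable_matrix => i j.
rewrite (_ : (fun y => _) = (fun y => (\det (M y))^-1) * (fun y => cofactor (M y) j i)); last first.
  by apply/funext => y; rewrite !mxE.
apply: differentiableM.
  apply: differentiableV; last by rewrite -unitfE -unitmxE.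
  by apply: differentiable_det => k l; apply: differentiable_entry.
apply: differentiableM; first exact: differentiable_cst.
apply: differentiable_det => k l.
rewrite (_ : (fun y => _) = (fun y => M y (lift j k) (lift i l))); last first.
  by apply/funext => y; rewrite !mxE.
exact: differentiable_entry.
Qed.

End Differentiability.

(** * Identity theorem, density and extension off a locus *)

Section Identity.
Context {R : realType} (V : normedModType R[i]).
Implicit Types (f : V -> R[i]^o).

Definition zero_near f x := exists2 d : R, 0 < d & forall y, nm (y - x) < d -> f y = 0.

Lemma zero_near_ball f x r y : (forall y, nm (y - x) < r -> differentiable f y) ->
  nm (y - x) < r -> zero_near f y -> zero_near f x.
Proof.
move=> fd yr; apply: segment_identity => t t0 t1.
have h : nm (y + t%:C *: (x - y) - x) < r.
  have -> : y + t%:C *: (x - y) - x = (1 - t)%:C *: (y - x).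
    rewrite rmorphB rmorph1 scalerBl scale1r -[x - y]opprB scalerN.
    by rewrite [LHS]addrAC.
  rewrite nmZ nm_real ger0_norm ?subr_ge0 //; have := nm_ge0 (y - x); nra.
exists (r - nm (y + t%:C *: (x - y) - x)) => [|z hz]; first lra.
by apply: fd; have := nm_sub z (y + t%:C *: (x - y)) x; lra.
Qed.

(** By induction: the functions already treated remain nonzero on a small ball, and the next one
    does not vanish identically on it, since otherwise it would vanish near x. *)
Lemma nonvanishing_dense (I : eqType) (s : seq I) (f : I -> V -> R[i]^o) x (r : R) :
  (forall i y, nm (y - x) < r -> differentiable (f i) y) ->
  (forall i, i \in s -> ~ zero_near (f i) x) ->
  forall y (e : R), nm (y - x) < r -> 0 < e ->
  exists2 z, nm (z - y) < e & forall i, i \in s -> f i z != 0.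
Proof.
move=> fd; elim: s => [|i s IH] fs y e yr e0.
  by exists y; rewrite ?subrr ?nm0.
have e1 : 0 < Num.min (e / 2) (r - nm (y - x)) by rewrite lt_min; lra.
have [|z zy hz] := IH _ y _ yr e1.
  by move=> j js; apply: fs; rewrite inE js orbT.
move: zy; rewrite lt_min => /andP[ze zr].
have zx : nm (z - x) < r by have := nm_sub z y x; lra.
have [d d0 hd] : exists2 d : R, 0 < d & forall w, nm (w - z) < d -> forall j, j \in s -> f j w != 0.
  elim: s hz {IH fs} => [|j s IH] hz; first by exists 1.
  have [k ks|d d0 hd] := IH _; first by apply: hz; rewrite inE ks orbT.
  have fj0 : 0 < nm (f j z : R[i]) by rewrite nm_gt0 hz // inE eqxx.
  have fj2 : 0 < nm (f j z : R[i]) / 2 by lra.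
  have [c c0 hc] := differentiable_ncont (fd j z zx) fj2.
  exists (Num.min d c) => [|w]; first by rewrite lt_min d0.
  rewrite lt_min => /andP[wd wc] k; rewrite inE => /predU1P[->|]; last exact: hd.
  rewrite -nm_gt0; have := hc w wc; have := nm_lbB (f j z : R[i]) (f j w).
  rewrite (nmC (f j z : R[i])); lra.
have : ~ zero_near (f i) z.
  move=> /(zero_near_ball (fd i) zx); apply: fs; by rewrite inE eqxx.
move=> N; apply: contrapT => Nz; apply: N.
exists (Num.min d (e / 2)) => [|w]; first by rewrite lt_min d0; lra.
rewrite lt_min => /andP[wd we]; apply: contrapT => /eqP fw; apply: Nz; exists w.
  by have := nm_sub w z y; lra.
by move=> j; rewrite inE => /predU1P[->//|]; apply: hd.
Qed.

Lemma dense_bound (Z : set V) (P Q : V -> R[i]) (K : R) y : 0 <= K ->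
  ncont P y -> ncont Q y ->
  (forall e : R, 0 < e -> exists2 z, nm (z - y) < e & ~ Z z) ->
  (exists2 d : R, 0 < d & forall z, nm (z - y) < d -> ~ Z z -> nm (P z) <= K * nm (Q z)) ->
  nm (P y) <= K * nm (Q y).
Proof.
move=> K0 Pc Qc dense [d d0 hd]; apply/ler_addgt0Pr => e e0.
have e1 : 0 < e / 2 by lra.
have e2 : 0 < e / 2 / (K + 1) by rewrite divr_gt0 //; lra.
have [b b0 hb] := Pc _ e1; have [c c0 hc] := Qc _ e2.
have m0 : 0 < Num.min d (Num.min b c) by rewrite !lt_min d0 b0.
have [z] := dense _ m0; rewrite !lt_min => /and3P[zd zb zc] Zz.
have h1 := hd z zd Zz; have h2 := hb z zb; have := hc z zc.
rewrite ler_pdivlMr; last lra.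
have := nm_lbB (P y) (P z); rewrite (nmC (P y)).
have := nm_lbB (Q z) (Q y); have := nm_ge0 (Q z - Q y); nra.
Qed.

Definition is_limit_off (Z : set V) (f : V -> R[i]) y (c : R[i]) :=
  forall e : R, 0 < e -> exists2 d : R, 0 < d &
    forall z, nm (z - y) < d -> ~ Z z -> nm (f z - c) <= e.

Lemma is_limit_off_uniq Z f y c c' :
  (forall e : R, 0 < e -> exists2 z, nm (z - y) < e & ~ Z z) ->
  is_limit_off Z f y c -> is_limit_off Z f y c' -> c = c'.
Proof.
move=> dense fc fc'; apply: subr0_eq; apply: (@le0_small R _ _ 2) => e e0.
have [d d0 hd] := fc e e0; have [b b0 hb] := fc' e e0.
have m0 : 0 < Num.min d b by rewrite lt_min d0.
have [z] := dense _ m0; rewrite lt_min => /andP[zd zb] Zz.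
have := hd z zd Zz; have := hb z zb Zz; have := nm_sub c (f z) c'.
rewrite (nmC c (f z)); lra.
Qed.

Definition extends (Z : set V) (x : V) (r : R) (f : V -> R[i]) :=
  exists P : V -> R[i]^o, forall y, nm (y - x) < r ->
    differentiable P y /\ (~ Z y -> P y = f y).

Definition bounded_off (Z : set V) (x : V) (f : V -> R[i]) :=
  exists K : R, exists2 d : R, 0 < d &
    forall y, nm (y - x) < d -> ~ Z y -> nm (f y) <= K.

Lemma eq_extends Z x r f g :
  (forall y, nm (y - x) < r -> ~ Z y -> f y = g y) -> extends Z x r f -> extends Z x r g.
Proof.
move=> fg [P hP]; exists P => y yr; have [dP PE] := hP y yr.
by split=> // Zy; rewrite PE // fg.
Qed.

Lemma extends_differentiable Z x r (f : V -> R[i]^o) :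
  (forall y, nm (y - x) < r -> differentiable f y) -> extends Z x r f.
Proof. by move=> df; exists f => y /df. Qed.

Lemma extends_cst Z x r (c : R[i]) : extends Z x r (fun=> c).
Proof. by apply: extends_differentiable => y _; apply: differentiable_cst. Qed.

Lemma extendsD Z x r f g : extends Z x r f -> extends Z x r g ->
  extends Z x r (fun y => f y + g y).
Proof.
move=> [P hP] [Q hQ]; exists (P + Q) => y yr.
have [dP PE] := hP y yr; have [dQ QE] := hQ y yr.
by split=> [|Zy]; [apply: differentiableD|rewrite -PE // -QE].
Qed.

Lemma extendsM Z x r f g : extends Z x r f -> extends Z x r g ->
  extends Z x r (fun y => f y * g y).
Proof.
move=> [P hP] [Q hQ]; exists (P * Q) => y yr.
have [dP PE] := hP y yr; have [dQ QE] := hQ y yr.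
by split=> [|Zy]; [apply: differentiableM|rewrite -PE // -QE].
Qed.

Lemma bounded_off_ncont Z x f : ncont f x -> bounded_off Z x f.
Proof.
move=> /(_ 1 ltr01)[d d0 hd]; exists (nm (f x) + 1); exists d => // y /hd.
have := nm_lbB (f y) (f x); lra.
Qed.

Lemma eq_bounded_off Z x f g : (exists2 r : R, 0 < r &
    forall y, nm (y - x) < r -> ~ Z y -> f y = g y) ->
  bounded_off Z x f -> bounded_off Z x g.
Proof.
move=> [r r0 fg] [K [d d0 hd]]; exists K; exists (Num.min d r) => [|y].
  by rewrite lt_min d0.
by rewrite lt_min => /andP[yd yr] Zy; rewrite -fg // hd.
Qed.

Lemma bounded_offD Z x f g : bounded_off Z x f -> bounded_off Z x g ->
  bounded_off Z x (fun y => f y + g y).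
Proof.
move=> [K [d d0 hd]] [L [b b0 hb]]; exists (K + L); exists (Num.min d b) => [|y].
  by rewrite lt_min d0.
rewrite lt_min => /andP[yd yb] Zy.
by rewrite (le_trans (nmD _ _)) // lerD ?hd ?hb.
Qed.

Lemma bounded_offM Z x f g : bounded_off Z x f -> bounded_off Z x g ->
  bounded_off Z x (fun y => f y * g y).
Proof.
move=> [K [d d0 hd]] [L [b b0 hb]]; exists (K * L); exists (Num.min d b) => [|y].
  by rewrite lt_min d0.
rewrite lt_min => /andP[yd yb] Zy.
by rewrite nmM ler_pM ?nm_ge0 ?hd ?hb.
Qed.

End Identity.

(** * The coefficients of the formal solution *)

Section FormalSolution.
Context {R : realType} {m n : nat} (D : set 'rV[R[i]]_m)
  (Aj : nat -> 'rV[R[i]]_m -> 'M[R[i]]_n) (G0 : 'rV[R[i]]_m -> 'M[R[i]]_n)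
  (u : 'rV[R[i]]_m -> 'rV[R[i]]_n) (F : nat -> 'rV[R[i]]_m -> 'M[R[i]]_n).

#[local] Notation V := 'rV[R[i]]_m.
#[local] Notation Z := (coalescence u).
#[local] Notation Ah := (hatA Aj G0).

Hypothesis D_open : open D.
Hypothesis Aj_holo : forall j t, D t -> holomorphic_at (Aj j) t.
Hypothesis G0_holo : forall t, D t -> holomorphic_at G0 t.
Hypothesis G0_unit : forall t, D t -> G0 t \in unitmx.
Hypothesis u_holo : forall t, D t -> holomorphic_at u t.
Hypothesis A0_diag : forall t, D t -> Ah 0 t = diag_mx (u t).
Hypothesis F_0 : forall t, D t -> ~ Z t -> F 0%N t = 1%:M.
Hypothesis F_formal : forall t, D t -> ~ Z t ->
  formal_solution (Aj^~ t) (fun k => G0 t *m F k t)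
    (diag_part (Ah 1 t)) (diag_mx (u t)).

Lemma D_ball t : D t -> exists2 r : R, 0 < r & forall y, nm (y - t) < r -> D y.
Proof. by move=> Dt; apply/nbhs_nmP; apply: open_nbhs_nbhs. Qed.

Lemma holomorphic_differentiable (W : normedModType R[i]) (f : V -> W) t :
  holomorphic_at f t -> differentiable f t.
Proof. exact: nbhs_singleton. Qed.

Lemma hatA_differentiable k a b t : D t ->
  differentiable ((fun y => Ah k y a b) : V -> R[i]^o) t.
Proof.
move=> Dt; apply: differentiable_entry; apply: differentiable_mulmx; last first.
  exact/holomorphic_differentiable/G0_holo.
apply: differentiable_mulmx; last exact/holomorphic_differentiable/Aj_holo.
apply: differentiable_invmx; first exact/holomorphic_differentiable/G0_holo.
by have [r r0 hr] := D_ball Dt; exists r => // y /hr /G0_unit.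
Qed.

Lemma gap_differentiable a b t : D t ->
  differentiable ((fun y => u y 0 a - u y 0 b) : V -> R[i]^o) t.
Proof.
move=> /u_holo /holomorphic_differentiable du.
exact: differentiableB (differentiable_entry _ _ du) (differentiable_entry _ _ du).
Qed.

Lemma lhs_entry (X Y B : 'M[R[i]]_n) (d : 'rV[R[i]]_n) (c : R[i]) a b :
  (X *m diag_mx d + (Y *m diag_part B - c *: Y)) a b =
  X a b * d 0 b + (Y a b * B b b - c * Y a b).
Proof. by rewrite /diag_part !mul_mx_diag !mxE. Qed.

Lemma rhs_entry (X S : 'M[R[i]]_n) (d : 'rV[R[i]]_n) a b :
  (S + diag_mx d *m X) a b = d 0 a * X a b + S a b.
Proof. by rewrite mul_diag_mx !mxE addrC. Qed.

Lemma big_nat_ends (f : nat -> R[i]) k :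
  \sum_(0 <= j < k.+2) f j = f 0%N + \sum_(1 <= j < k.+1) f j + f k.+1.
Proof. by rewrite big_nat_recr //= big_ltn. Qed.

Lemma recursion t k a b : D t -> ~ Z t ->
  F k.+1 t a b * u t 0 b + F k t a b * Ah 1 t b b - k%:R * F k t a b =
  u t 0 a * F k.+1 t a b + \sum_(0 <= j < k.+1) (Ah (k.+1 - j) t *m F j t) a b.
Proof.
move=> Dt Zt; have uG := G0_unit Dt.
have := congr1 (fun M => (invmx (G0 t) *m M) a b) (F_formal Dt Zt k.+1).
rewrite /= mulmxDr mulmxBr -scalemxAr !mulmxA mulVmx // !mul1mx mulmx_sumr.
rewrite (eq_bigr (fun j : 'I_k.+2 => Ah (k.+1 - j) t *m F j t)); last first.
  by move=> j _; rewrite /hatA !mulmxA.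
rewrite big_ord_recr /= subnn A0_diag // big_mkord lhs_entry rhs_entry.
by rewrite summxE addrA.
Qed.

(** Valid for a = b too: the left side is then 0, and the equation determines the diagonal entries
    of the preceding coefficient. *)
Lemma recursion_obstruction t l a b : D t -> ~ Z t -> (2 <= l)%N ->
  (u t 0 b - u t 0 a) * F l t a b = obstruction (Ah^~ t) (F^~ t) l a b.
Proof.
case: l => [//|[//|k]] Dt Zt _; have e := recursion k.+1 a b Dt Zt.
pose f j := (Ah (k.+2 - j) t *m F j t) a b.
have f0 : f 0%N = Ah k.+2 t a b by rewrite /f subn0 (F_0 Dt Zt) mulmx1.
have f1 : f k.+1 = Ah 1 t a a * F k.+1 t a b +
    \sum_(g < n | g != a) Ah 1 t a g * F k.+1 t g b.
  by rewrite /f subSn // subnn mxE (bigD1 a).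
move: e; rewrite (big_nat_ends f k) f0 f1 /f => e.
rewrite /obstruction /=; move: e; set s1 := \sum_(1 <= j < k.+1) _.
set s2 := \sum_(g < n | g != a) _ => e.
have -> : (u t 0 b - u t 0 a) * F k.+2 t a b =
  F k.+2 t a b * u t 0 b + F k.+1 t a b * Ah 1 t b b - k.+1%:R * F k.+1 t a b
  - F k.+1 t a b * Ah 1 t b b + k.+1%:R * F k.+1 t a b - u t 0 a * F k.+2 t a b by ring.
by rewrite e; ring.
Qed.

Lemma recursion1 t a b : D t -> ~ Z t -> a != b ->
  (u t 0 b - u t 0 a) * F 1 t a b = Ah 1 t a b.
Proof.
move=> Dt Zt ab; have := recursion 0 a b Dt Zt.
rewrite big_nat1 subn0 F_0 // mulmx1 [1%:M a b]mxE (negbTE ab) mul0r mulr0 subr0 addr0.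
by move=> e; rewrite mulrBl [X in X - _]mulrC e; ring.
Qed.

(** The numerator of the off-diagonal entries of F_l: expression (i) for l = 1, expression (ii) for
    l >= 2. *)
Definition source l t a b : R[i] :=
  if l == 1%N then Ah 1 t a b else obstruction (Ah^~ t) (F^~ t) l a b.

Lemma source_recursion t l a b : D t -> ~ Z t -> (1 <= l)%N -> a != b ->
  (u t 0 b - u t 0 a) * F l t a b = source l t a b.
Proof.
rewrite /source; case: l => [//|[|l]] Dt Zt _ ab /=; first exact: recursion1.
exact: recursion_obstruction.
Qed.

Lemma diagonal_recursion t l a : D t -> ~ Z t -> (1 <= l)%N ->
  F l t a a = - l%:R^-1 * (\sum_(g < n | g != a) Ah 1 t a g * F l t g a +
    \sum_(1 <= j < l) (Ah (l.+1 - j) t *m F j t) a a + Ah l.+1 t a a).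
Proof.
case: l => [//|l] Dt Zt _; have := @recursion_obstruction t l.+2 a a Dt Zt isT.
rewrite subrr mul0r /obstruction /= subrr add0r -!addrA => /esym/eqP.
rewrite addr_eq0 => /eqP e.
have l0 : l.+1%:R != 0 :> R[i] by rewrite pnatr_eq0.
by rewrite -[LHS](mulKf l0) e mulrN mulNr.
Qed.

(* Membership in Pr is preserved by the recursion for the F_l, except for the
   division by u_a - u_b. *)
Record recursion_class (Pr : (V -> R[i]) -> Prop) : Prop := RecursionClass {
  classD : forall f g, Pr f -> Pr g -> Pr (fun y => f y + g y);
  classM : forall f g, Pr f -> Pr g -> Pr (fun y => f y * g y);
  class_hatA : forall k a b, Pr (fun y => Ah k y a b);
  class_cst : forall c, Pr (fun=> c);
  class_eq : forall f g, (forall y, D y -> ~ Z y -> f y = g y) -> Pr f -> Pr g }.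

Section RecursionClass.
Context (Pr : (V -> R[i]) -> Prop) (PrC : recursion_class Pr).

Lemma class_sum (I : eqType) (s : seq I) (P : pred I) (f : I -> V -> R[i]) :
  (forall i, i \in s -> P i -> Pr (f i)) ->
  Pr (fun y => \sum_(i <- s | P i) f i y).
Proof.
elim: s => [|i s IH] hf.
  by rewrite (_ : (fun y => _) = fun=> 0); [apply: class_cst|apply/funext => y; rewrite big_nil].
have [Pi|Pi] := boolP (P i).
  rewrite (_ : (fun y => _) = fun y => f i y + \sum_(j <- s | P j) f j y).
    apply: classD => //; first by apply: hf; rewrite ?mem_head.
    by apply: IH => j js; apply: hf; rewrite inE js orbT.
  by apply/funext => y; rewrite big_cons Pi.
rewrite (_ : (fun y => _) = fun y => \sum_(j <- s | P j) f j y).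
  by apply: IH => j js; apply: hf; rewrite inE js orbT.
by apply/funext => y; rewrite big_cons (negbTE Pi).
Qed.

Lemma class_mulmx k j a b : (forall c, Pr (fun y => F j y c b)) ->
  Pr (fun y => (Ah k y *m F j y) a b).
Proof.
move=> hF; rewrite (_ : (fun y => _) = fun y => \sum_c (Ah k y a c * F j y c b)).
  by apply: class_sum => c _ _; apply: classM => //; apply: class_hatA.
by apply/funext => y; rewrite mxE.
Qed.

Lemma class_source l a b : (1 <= l)%N -> (forall j a b, (j < l)%N -> Pr (fun y => F j y a b)) ->
  Pr (fun y => source l y a b).
Proof.
case: l => [//|[|l]] _ hF; first exact: class_hatA.
apply: (classD PrC); last exact: class_hatA.
apply: (classD PrC); last first.
  apply: class_sum => j; rewrite mem_index_iota => /andP[_ jl] _.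
  by apply: class_mulmx => c; apply: hF; rewrite ltnW.
apply: (classD PrC); last first.
  apply: class_sum => g _ _; apply: (classM PrC); first exact: class_hatA.
  exact: hF.
apply: (classM PrC); last exact: hF.
apply: (classD PrC); last exact: class_cst.
apply: (classD PrC); first exact: class_hatA.
have -> : (fun y => - Ah 1 y b b) = (fun y => (fun=> -1) y * Ah 1 y b b).
  by apply/funext => y; rewrite mulN1r.
apply: (classM PrC); [exact: class_cst|exact: class_hatA].
Qed.

(** Strong induction on l. Within a level the off-diagonal entries come first, because the diagonal
    entries of F_l are computed from them. *)
Lemma class_F : (forall l a b, (1 <= l)%N -> a != b ->
    (forall j a b, (j < l)%N -> Pr (fun y => F j y a b)) -> Pr (fun y => F l y a b)) ->
  forall l a b, Pr (fun y => F l y a b).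
Proof.
move=> off; elim/ltn_ind => l IH a b.
have [->|l0] := posnP l.
  apply: (class_eq PrC) (class_cst PrC (1%:M a b)) => y Dy Zy.
  by rewrite F_0.
have [<-|ab] := eqVneq a b; last by apply: off => // j c d jl; apply: IH.
apply: (class_eq PrC (f := fun y => - l%:R^-1 * (\sum_(g < n | g != a) Ah 1 y a g * F l y g a +
    \sum_(1 <= j < l) (Ah (l.+1 - j) y *m F j y) a a + Ah l.+1 y a a))).
  by move=> y Dy Zy; rewrite -diagonal_recursion.
apply: (classM PrC (class_cst PrC _)); apply: (classD PrC); last exact: class_hatA.
apply: (classD PrC).
  apply: class_sum => g _ ga; apply: (classM PrC); first exact: class_hatA.
  by apply: off => // j c d jl; apply: IH.
apply: class_sum => j; rewrite mem_index_iota => /andP[_ jl] _.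
by apply: class_mulmx => c; apply: IH.
Qed.

End RecursionClass.

Definition gaps t : R[i] :=
  \prod_(p : 'I_n * 'I_n | p.1 != p.2) (u t 0 p.1 - u t 0 p.2).

Lemma gaps_neq0 t : gaps t != 0 <-> ~ Z t.
Proof.
split=> [/prodf_neq0 h [a [b [ab uab]]]|Zt].
  by have := h (a, b) ab; rewrite /= uab subrr eqxx.
apply/prodf_neq0 => -[a b] /= ab; rewrite subr_eq0; apply/eqP => uab.
by apply: Zt; exists a, b.
Qed.

Lemma gap_neq0 t a b : ~ Z t -> a != b -> u t 0 a - u t 0 b != 0.
Proof.
move=> Zt ab; rewrite subr_eq0; apply/eqP => uab; apply: Zt.
by exists a, b.
Qed.

Lemma gaps_differentiable t : D t -> differentiable (gaps : V -> R[i]^o) t.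
Proof. by move=> Dt; apply: differentiable_bigprod => p; apply: gap_differentiable. Qed.

Section Ball.
Context (x0 : V) (r : R).
Hypothesis r_gt0 : 0 < r.
Hypothesis ballD : forall y, nm (y - x0) < r -> D y.
Hypothesis dense : forall y (e : R), nm (y - x0) < r -> 0 < e ->
  exists2 z, nm (z - y) < e & ~ Z z.

Definition meromorphic (f : V -> R[i]) :=
  exists N, extends Z x0 r (fun y => f y * gaps y ^+ N).

Lemma gapsX_extends N : extends Z x0 r (fun y => gaps y ^+ N).
Proof.
apply: (@extends_differentiable R V Z x0 r (fun y => gaps y ^+ N : R[i]^o)) => y yr.
by apply: differentiable_pow; apply: gaps_differentiable; apply: ballD.
Qed.

Lemma meromorphic_class : recursion_class meromorphic.
Proof.
have ext0 f : extends Z x0 r f -> meromorphic f.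
  by move=> fe; exists 0%N; apply: eq_extends fe => y _ _; rewrite mulr1.
split.
- move=> f g [N hf] [M hg]; exists (N + M)%N.
  apply: eq_extends (extendsD (extendsM hf (gapsX_extends M)) (extendsM hg (gapsX_extends N))).
  by move=> y _ _; rewrite exprD; ring.
- move=> f g [N hf] [M hg]; exists (N + M)%N.
  by apply: eq_extends (extendsM hf hg) => y _ _; rewrite exprD; ring.
- move=> k a b; apply: ext0; apply: (@extends_differentiable R V Z x0 r (fun y => Ah k y a b : R[i]^o)).
  by move=> y /ballD; apply: hatA_differentiable.
- by move=> c; apply: ext0; apply: extends_cst.
- move=> f g fg [N hf]; exists N; apply: eq_extends hf => y yr Zy.
  by rewrite fg //; apply: ballD.
Qed.

Lemma F_meromorphic l a b : meromorphic (fun y => F l y a b).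
Proof.
apply: (class_F meromorphic_class) => {}l {}a {}b l1 ab hF.
(* Division by u_b - u_a costs one more power of the product of the gaps: the other factors of that
   product are collected in [rest]. *)
have [N hN] := class_source meromorphic_class a b l1 hF; exists N.+1.
pose rest y : R[i] := \prod_(p : 'I_n * 'I_n | (p.1 != p.2) && (p != (b, a))) (u y 0 p.1 - u y 0 p.2).
have hrest : extends Z x0 r rest.
  apply: (@extends_differentiable R V Z x0 r (rest : V -> R[i]^o)) => y /ballD Dy.
  by apply: differentiable_bigprod => p; apply: gap_differentiable.
apply: eq_extends (extendsM hN hrest) => y yr Zy.
have gE : gaps y = (u y 0 b - u y 0 a) * rest y.
  by rewrite /gaps (bigD1 (b, a)) //= eq_sym.
rewrite -(source_recursion (ballD yr) Zy l1 ab) exprS gE; ring.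
Qed.

Lemma uniform_extension : exists2 delta : R, 0 < delta <= r & forall k a b,
  bounded_off Z x0 (fun y => F k y a b) -> exists (g : V -> R[i]^o) (B : R),
    forall y, nm (y - x0) < delta ->
      [/\ differentiable g y, nm (g y) <= B & ~ Z y -> g y = F k y a b].
Proof.
have dg y : nm (y - x0) < r -> differentiable (gaps : V -> R[i]^o) y.
  by move=> /ballD; apply: gaps_differentiable.
have x0r : nm (x0 - x0) < r by rewrite subrr nm0.
have [|v vr hv] := nonzero_direction r_gt0 dg.
  move=> [d d0 hd]; have [z zd /gaps_neq0] := dense x0r d0.
  by rewrite hd ?eqxx.
have [delta delta0 hdelta] := division dg vr hv.
exists (Num.min delta r); first by rewrite lt_min delta0 r_gt0 ge_min lexx orbT.
move=> k a b [K [d d0 hK]]; have [N [P hP]] := F_meromorphic k a b.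
have [||g [B hg]] := hdelta N P.
- by move=> y /hP[].
- exists (Num.max K 0); exists (Num.min d r); first by rewrite lt_min d0.
  move=> y; rewrite lt_min => /andP[yd yr]; rewrite -nmX.
  (* F_k is bounded off the locus only; continuity and density carry the inequality for P over to
     the locus. *)
  apply: (@dense_bound R V Z P (fun y => gaps y ^+ N)).
  + by rewrite le_max lexx orbT.
  + by apply: differentiable_ncont; have [] := hP y yr.
  + by apply: differentiable_ncont; apply: (differentiable_pow N (dg y yr)).
  + by move=> e; apply: dense.
  exists (Num.min d r - nm (y - x0)) => [|z hz Zz]; first by rewrite subr_gt0 lt_min yd.
  have : nm (z - x0) < Num.min d r by have := nm_sub z y x0; lra.
  rewrite lt_min => /andP[zd zr]; have [_ ->//] := hP z zr.
  by rewrite nmM ler_wpM2r ?nm_ge0 // le_max hK.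
exists g, B => y; rewrite lt_min => /andP[yd yr]; have [h1 h2 h3] := hg y yd.
split=> // Zy; have [_ /(_ Zy) PE] := hP y yr; rewrite PE in h3.
by apply: mulIf h3; rewrite expf_neq0 //; apply/gaps_neq0.
Qed.

Lemma bounded_off_class : recursion_class (bounded_off Z x0).
Proof.
have x0r : nm (x0 - x0) < r by rewrite subrr nm0.
split.
- by move=> f g; apply: bounded_offD.
- by move=> f g; apply: bounded_offM.
- move=> k a b; apply/bounded_off_ncont/differentiable_ncont.
  by apply: hatA_differentiable; apply: ballD.
- by move=> c; exists (nm c); exists 1.
- by move=> f g fg; apply: eq_bounded_off; exists r => // y /ballD; apply: fg.
Qed.

Lemma F_bounded : (forall l a b, (1 <= l)%N -> a != b -> u x0 0 a = u x0 0 b ->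
    (forall j a b, (j < l)%N -> bounded_off Z x0 (fun y => F j y a b)) ->
    bounded_off Z x0 (fun y => F l y a b)) ->
  forall l a b, bounded_off Z x0 (fun y => F l y a b).
Proof.
move=> coal; apply: (class_F bounded_off_class) => l a b l1 ab hF.
have [uab|uab] := eqVneq (u x0 0 a) (u x0 0 b); first exact: coal.
have x0r : nm (x0 - x0) < r by rewrite subrr nm0.
have hs := class_source bounded_off_class a b l1 hF.
have hi : bounded_off Z x0 (fun y => (u y 0 b - u y 0 a)^-1).
  apply: bounded_off_ncont; apply: differentiable_ncont; apply: differentiableV.
    by apply: gap_differentiable; apply: ballD.
  by rewrite subr_eq0 eq_sym.
apply: eq_bounded_off (bounded_offM hs hi); exists r => // y yr Zy.
rewrite -(source_recursion (ballD yr) Zy l1 ab) mulrC mulKf //.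
by apply: gap_neq0 => //; rewrite eq_sym.
Qed.

End Ball.

Context (eps0 : R).
Hypothesis D_polydisc : @polydisc R m eps0 `<=` D.
Hypothesis u_distinct : forall a b : 'I_n, a != b ->
  exists2 t, @polydisc R m eps0 t & u t 0 a != u t 0 b.

Lemma polydiscE (r : R) (t : V) : polydisc r t <-> nm t <= r.
Proof. by rewrite /polydisc /= nmE lecR. Qed.

(** A gap vanishing near x would vanish along the segment to a point of the polydisc where it is
    nonzero. The polydisc is convex, so the segment stays inside D, which need not be connected. *)
Lemma polydisc_dense x r : polydisc eps0 x -> (forall y, nm (y - x) < r -> D y) ->
  forall y (e : R), nm (y - x) < r -> 0 < e -> exists2 z, nm (z - y) < e & ~ Z z.
Proof.
move=> /polydiscE xp xD y e yr e0.
pose s := [seq p <- enum {: 'I_n * 'I_n} | p.1 != p.2].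
have [p z /xD|p|z zy hz] := @nonvanishing_dense R V _ s
    (fun p y => u y 0 p.1 - u y 0 p.2 : R[i]^o) x r _ _ y e yr e0.
- exact: gap_differentiable.
- rewrite mem_filter => /andP[p12 _] zn; have [q /polydiscE qp quq] := u_distinct p12.
  have [t t0 t1||d d0 hd] := @segment_identity R V
      (fun y => u y 0 p.1 - u y 0 p.2 : R[i]^o) x q.
  + have Dt : D (x + t%:C *: (q - x)).
      apply/D_polydisc/polydiscE.
      have -> : x + t%:C *: (q - x) = (1 - t)%:C *: x + t%:C *: q.
        by rewrite rmorphB rmorph1 scalerBl scale1r scalerBr addrAC addrA.
      rewrite (le_trans (nmD _ _)) // !nmZ !nm_real !ger0_norm ?subr_ge0 //.
      by nra.
    have [r' r'0 hr'] := D_ball Dt; exists r'; first exact: r'0.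
    move=> w /hr'; exact: gap_differentiable.
  + exact: zn.
  + have := hd q; rewrite subrr nm0 => /(_ d0) /eqP.
    by rewrite subr_eq0 (negbTE quq).
- exists z => // -[a [b [ab uab]]]; have := hz (a, b).
  by rewrite mem_filter mem_enum /= ab uab subrr eqxx => /(_ isT).
Qed.

Lemma polydisc_ball x : polydisc eps0 x -> exists2 r : R, 0 < r &
  (forall y, nm (y - x) < r -> D y) /\
  forall y (e : R), nm (y - x) < r -> 0 < e -> exists2 z, nm (z - y) < e & ~ Z z.
Proof.
move=> xp; have [r r0 xD] := D_ball (D_polydisc xp); exists r => //.
by split=> //; apply: polydisc_dense.
Qed.

Lemma holomorphic_bounded_off S k x : holomorphic_off_on Z (F k) S -> S x ->
  forall a b, bounded_off Z x (fun y => F k y a b).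
Proof.
move=> [g hg] Sx a b; have [gx /nbhs_nmP[d d0 hd]] := hg x Sx.
have dg := holomorphic_differentiable gx.
apply: eq_bounded_off (bounded_off_ncont Z (differentiable_ncont (differentiable_entry a b dg))).
by exists d => // y yd Zy; rewrite hd.
Qed.

Lemma bounded_off_holomorphic S k : S `<=` @polydisc R m eps0 ->
  (forall x, S x -> forall a b, bounded_off Z x (fun y => F k y a b)) ->
  holomorphic_off_on Z (F k) S.
Proof.
move=> SP hb.
(* The extension is defined pointwise as the limit from outside the locus, so the local extensions
   agree with it by uniqueness of limits and need not be glued. *)
pose g y : 'M[R[i]]_n :=
  \matrix_(a, b) xget 0 [set c | is_limit_off Z (fun z => F k z a b) y c].
exists g => x Sx; have xp := SP x Sx; have [r r0 [xD dense]] := polydisc_ball xp.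
have [delta /andP[delta0 dr] ext] := uniform_extension r0 xD dense.
have key a b : exists h : V -> R[i]^o, forall y, nm (y - x) < delta ->
    [/\ differentiable h y, ~ Z y -> h y = F k y a b & g y a b = h y].
  have [h [B hB]] := ext k a b (hb x Sx a b); exists h => y yd.
  have [dh _ hE] := hB y yd; split=> //; rewrite mxE.
  have lim : is_limit_off Z (fun z => F k z a b) y (h y).
    move=> e e0; have [d d0 hd] := differentiable_ncont dh e0.
    exists (Num.min d (delta - nm (y - x))); first by rewrite lt_min d0 subr_gt0.
    move=> z; rewrite lt_min => /andP[zd zy] Zz.
    have zx : nm (z - x) < delta by have := nm_sub z y x; lra.
    by have [_ _ <-//] := hB z zx; apply: hd.
  apply: (@is_limit_off_uniq R V Z (fun z => F k z a b) y) => //.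
    by move=> e; apply: dense; apply: lt_le_trans yd dr.
  by apply: (@xgetPex _ 0 [set c | is_limit_off Z (fun z => F k z a b) y c]); exists (h y).
split.
  apply/nbhs_nmP; exists delta => // y yd; apply: differentiable_matrix => a b.
  have [h hh] := key a b; apply: (@differentiable_near _ _ _ h); last by have [] := hh y yd.
  exists (delta - nm (y - x)) => [|z zy]; first by rewrite subr_gt0.
  by have [|_ _ ->//] := hh z; have := nm_sub z y x; lra.
apply/nbhs_nmP; exists delta => // y yd Zy; apply/matrixP => a b.
by have [h hh] := key a b; have [_ hE ->] := hh y yd; apply: hE.
Qed.

Lemma source_bounded_off x l a b (K d : R) : 0 < d -> D x ->
  (1 <= l)%N -> a != b ->
  (forall y, nm (y - x) < d -> D y -> ~ Z y -> nm (source l y a b) <= K * nm (u y 0 a - u y 0 b)) ->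
  bounded_off Z x (fun y => F l y a b).
Proof.
move=> d0 /D_ball[r r0 hr] l1 ab hK; exists K; exists (Num.min d r).
  by rewrite lt_min d0.
move=> y; rewrite lt_min => /andP[yd /hr Dy] Zy; have := hK y yd Dy Zy.
rewrite -(source_recursion Dy Zy l1 ab) nmM nmC mulrC ler_pM2r //.
by rewrite nm_gt0 gap_neq0.
Qed.

Lemma vanish_as_gaps_bounded x W : polydisc eps0 x -> open_nbhs x W ->
  vanish_as_gaps u Ah F W -> forall l a b, bounded_off Z x (fun y => F l y a b).
Proof.
move=> xp /open_nbhs_nbhs; rewrite nbhs_nearE => /nbhs_nmP[d d0 hd] van.
have [r r0 [xD dense]] := polydisc_ball xp; apply: (F_bounded r0 xD).
move=> l a b l1 ab uab _; have Wx : W x by apply: hd; rewrite subrr nm0.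
have [h1 h2] := van a b ab (ex_intro2 _ _ x Wx uab).
have [K hK] : exists K : R, forall y, W y -> ~ Z y ->
    nm (source l y a b) <= K * nm (u y 0 a - u y 0 b).
  rewrite /source; have [_|l2] := eqVneq l 1%N.
    by have [K hK] := h1; exists K => y Wy _; rewrite -ler_nm hK.
  have [|K hK] := h2 l; first by rewrite ltn_neqAle eq_sym l2.
  by exists K => y Wy Zy; rewrite -ler_nm hK.
apply: (source_bounded_off (K := K) d0 (D_polydisc xp)) => // y /hd Wy _.
exact: hK.
Qed.

Lemma bounded_vanish_as_gaps x : polydisc eps0 x ->
  (forall l a b, bounded_off Z x (fun y => F l y a b)) ->
  exists W, [/\ open_nbhs x W, W `<=` D & vanish_as_gaps u Ah F W].
Proof.
move=> xp hb; have [r r0 [xD dense]] := polydisc_ball xp.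
have [delta /andP[delta0 dr] ext] := uniform_extension r0 xD dense.
have WE y : ball x delta%:C y <-> nm (y - x) < delta.
  by rewrite -ball_normE /= distrC nmE ltcR.
have deltaC : 0 < delta%:C :> R[i] by rewrite ltcR.
have WD y : ball x delta%:C y -> D y.
  by move=> /WE yd; apply: xD; apply: lt_le_trans yd dr.
exists (ball x delta%:C); split=> //.
  by split; [exact: ball_open|exact: ballxx].
move=> a b ab _; split=> [|l l2].
  have [g [B hg]] := ext 1%N a b (hb 1%N a b).
  have B0 : 0 <= B.
    have [|_ + _] := hg x; first by rewrite subrr nm0.
    by apply: le_trans; apply: nm_ge0.
  exists B => y Wy; rewrite ler_nm; have Dy := WD y Wy; move/WE: Wy => yd.
  (* The bound on (i) is required on the locus as well; it is obtained off the locus and extended by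
     density. *)
  apply: (@dense_bound R V Z (fun y => Ah 1 y a b) (fun y => u y 0 a - u y 0 b)) => //.
  - exact/differentiable_ncont/hatA_differentiable.
  - exact/differentiable_ncont/gap_differentiable.
  - by move=> e; apply: dense; apply: lt_le_trans yd dr.
  exists (delta - nm (y - x)) => [|z zy Zz]; first by rewrite subr_gt0.
  have zd : nm (z - x) < delta by have := nm_sub z y x; lra.
  have Dz : D z by apply/WD/WE.
  have [_ gB gE] := hg z zd.
  by rewrite -(recursion1 Dz Zz ab) nmM nmC mulrC ler_wpM2r ?nm_ge0 // -gE.
have [g [B hg]] := ext l a b (hb l a b).
exists B => y [Wy Zy]; rewrite ler_nm; have Dy := WD y Wy; move/WE: Wy => yd.
have [_ gB gE] := hg y yd.
by rewrite -(recursion_obstruction a b Dy Zy l2) nmM nmC mulrC ler_wpM2r ?nm_ge0 // -gE.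
Qed.

Lemma bounded_zero_along S : S `<=` @polydisc R m eps0 ->
  (forall x, S x -> forall l a b, bounded_off Z x (fun y => F l y a b)) ->
  zero_along u Ah F S.
Proof.
move=> SP hb t a b St ab uab.
have [W [tW WD van]] := bounded_vanish_as_gaps (SP t St) (hb t St).
have Wt : W t := nbhs_singleton (open_nbhs_nbhs tW).
have [h1 h2] := van a b ab (ex_intro2 _ _ t Wt uab); split.
  have [K /(_ t Wt)] := h1; rewrite uab subrr normr0 mulr0 normr_le0.
  by move=> /eqP.
move=> l l2; have [K hK] := h2 l l2; apply/cvgrPdist_le => _ /gt0_realC[e e0 ->].
rewrite near_withinE; apply: (proj2 (@nbhs_nmP R 'rV[R[i]]_m t _)).
have K0 : 0 < `|K| + 1 by rewrite ltr_wpDl.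
have [d d0 hd] := differentiable_ncont (gap_differentiable a b (WD t Wt)) (divr_gt0 e0 K0).
have /nbhs_nmP[c c0 hc] := open_nbhs_nbhs tW.
exists (Num.min d c) => [|y]; first by rewrite lt_min d0.
rewrite lt_min => /andP[/hd yd /hc Wy] Zy.
rewrite sub0r normrN nmE lecR; have := hK y (conj Wy Zy); rewrite ler_nm => h.
rewrite uab subrr subr0 ler_pdivlMr // in yd; apply: (le_trans h); apply: le_trans yd.
rewrite mulrC ler_wpM2l ?nm_ge0 //; have := ler_norm K; lra.
Qed.

(** This instance serves to extend (ii) across the locus once the lower coefficients extend. *)
Lemma germ_class x : D x -> recursion_class (fun f => exists2 r : R, 0 < r & extends Z x r f).
Proof.
move=> Dx; have shrink r r' f : r' <= r -> extends Z x r f -> extends Z x r' f.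
  by move=> rr [P hP]; exists P => y yr; apply: hP; apply: lt_le_trans rr.
have both f g : (exists2 r : R, 0 < r & extends Z x r f) ->
    (exists2 r : R, 0 < r & extends Z x r g) ->
    exists r : R, [/\ 0 < r, extends Z x r f & extends Z x r g].
  move=> [r r0 fr] [s s0 gs]; exists (Num.min r s); rewrite lt_min r0 s0; split=> //.
    by apply: shrink fr; rewrite ge_min lexx.
  by apply: shrink gs; rewrite ge_min lexx orbT.
have [r r0 hr] := D_ball Dx.
split.
- by move=> f g hf hg; have [s [s0 fs gs]] := both _ _ hf hg; exists s => //; apply: extendsD.
- by move=> f g hf hg; have [s [s0 fs gs]] := both _ _ hf hg; exists s => //; apply: extendsM.
- move=> k a b; exists r => //; apply: (@extends_differentiable R V Z x r (fun y => Ah k y a b : R[i]^o)).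
  by move=> y /hr; apply: hatA_differentiable.
- by move=> c; exists 1 => //; apply: extends_cst.
- move=> f g fg [s s0 fs]; exists (Num.min r s); first by rewrite lt_min r0.
  apply: (@eq_extends R V Z x _ f); last by apply: shrink fs; rewrite ge_min lexx orbT.
  by move=> y; rewrite lt_min => /andP[/hr Dy _]; apply: fg.
Qed.

Lemma gap_differential a b x v : D x ->
  'd ((fun y => u y 0 a - u y 0 b) : V -> R[i]^o) x v = 'D_v u x 0 a - 'D_v u x 0 b :> R[i].
Proof.
move=> Dx; have du := holomorphic_differentiable (u_holo Dx).
rewrite (deriveE _ du); have [K hK] := differentiable_bound du.
have coord (w : 'rV[R[i]]_n) j : nm (w 0 j) <= nm w.
  by apply/ler_addgt0Pr => e e0; apply/ltW/nm_coord_lt; rewrite ltrDl.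
have [] // := @nm_differentiable R V _ ((fun y => u y 0 a - u y 0 b) : V -> R[i]^o) x
  (fun h => 'd u x h 0 a - 'd u x h 0 b) (2 * K) _ _ _.
- move=> c h k; rewrite linearP !mxE -[RHS]/(c * _ + _); ring.
- move=> h; rewrite (le_trans (nmB _ _)) //.
  have := coord ('d u x h) a; have := coord ('d u x h) b; have := hK h; lra.
- move=> e e0; have e2 : 0 < e / 2 by lra.
  have [d d0 hd] := differentiable_nm du e2; exists d => // y /hd.
  set w := u y - u x - 'd u x (y - x).
  have -> : u y 0 a - u y 0 b - (u x 0 a - u x 0 b) -
      ('d u x (y - x) 0 a - 'd u x (y - x) 0 b) = w 0 a - w 0 b :> R[i].
    by rewrite /w !mxE; ring.
  have := nmB (w 0 a) (w 0 b); have := coord w a; have := coord w b; lra.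
by move=> _ ->.
Qed.

(** By induction on l the lower coefficients extend, hence so does the numerator of F_l. The
    extension vanishes on the zero set of the gap, and [simple_zero_bound] makes it O(u_a - u_b).
    Vanishing is needed at all zeros near x, hence the openness of S. *)
Lemma zero_along_bounded S : S `<=` @polydisc R m eps0 -> open S ->
  simple_coalescence u S -> zero_along u Ah F S ->
  forall x, S x -> forall l a b, bounded_off Z x (fun y => F l y a b).
Proof.
move=> SP Sopen simp zero x Sx; have xp := SP x Sx.
have [r r0 [xD dense]] := polydisc_ball xp; have Dx := D_polydisc xp.
apply: (F_bounded r0 xD) => l a b l1 ab uab hF.
have [delta /andP[delta0 dr] ext] := uniform_extension r0 xD dense.
have [] := class_source (germ_class Dx) a b l1.
  move=> j c d jl; have [g [B hg]] := ext j c d (hF j c d jl).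
  by exists delta => //; exists g => y /hg[].
move=> s s0 [P hP].
have /nbhs_nmP[q q0 hq] : nbhs x S by apply: open_nbhs_nbhs.
pose rho := Num.min r (Num.min s q).
have rho0 : 0 < rho by rewrite !lt_min r0 s0.
have hrho y : nm (y - x) < rho -> [/\ nm (y - x) < r, nm (y - x) < s & nm (y - x) < q].
  by rewrite !lt_min => /and3P.
have [v hv] := simp x a b Sx ab uab.
have [|||||K [d d0 hK]] := @simple_zero_bound R m
    (fun y => u y 0 a - u y 0 b : R[i]^o) P x v rho rho0.
- by move=> y /hrho[/xD Dy _ _]; apply: gap_differentiable.
- by move=> y /hrho[_ ys _]; case: (hP y ys).
- by rewrite uab subrr.
- by rewrite gap_differential // subr_eq0.
- move=> y /hrho[yr ys yq] /eqP; rewrite subr_eq0 => /eqP uaby.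
  have [dP PE] := hP y ys; have Dy := xD y yr.
  (* The value of the extension on the locus is the limit of the numerator from outside, which is 0
     by hypothesis. *)
  apply: (@is_limit_off_uniq R V Z (fun z => source l z a b) y).
  + by move=> e; apply: dense.
  + move=> e e0; have [c c0 hc] := differentiable_ncont dP e0.
    exists (Num.min c (s - nm (y - x))) => [|z]; first by rewrite lt_min c0 subr_gt0.
    rewrite lt_min => /andP[zc zs] Zz.
    have [|_ /(_ Zz) <-] := hP z; last exact: hc.
    by have := nm_sub z y x; lra.
  + have [A0 O0] := zero y a b (hq y yq) ab uaby.
    rewrite /source; have [_|l2] := eqVneq l 1%N.
      move=> e e0; have [c c0 hc] := differentiable_ncont (hatA_differentiable 1 a b Dy) e0.
      by exists c => // z zc _; rewrite -[X in _ - X]A0; apply: hc.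
    move=> e e0; have l2' : (2 <= l)%N by rewrite ltn_neqAle eq_sym l2.
    have eC : 0 < e%:C :> R[i] by rewrite ltcR.
    have /cvgrPdist_le /(_ _ eC) := O0 l l2'.
    rewrite near_withinE => /(proj1 (@nbhs_nmP R 'rV[R[i]]_m y _))[c c0 hc]; exists c => // z zc Zz.
    by have := hc z zc Zz; rewrite distrC nmE lecR.
apply: (source_bounded_off (K := K) (d := Num.min d rho)) => //.
  by rewrite lt_min d0.
move=> y; rewrite lt_min => /andP[yd /hrho[_ ys _]] Dy Zy.
by have [_ <-//] := hP y ys; apply: hK.
Qed.

End FormalSolution.

Theorem proposition5p1 (R : realType) (m n : nat) (eps0 N0 : R)
    (D : set 'rV[R[i]]_m)
    (A : R[i]^o -> 'rV[R[i]]_m -> 'M[R[i]]_n)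
    (Aj : nat -> 'rV[R[i]]_m -> 'M[R[i]]_n)
    (G0 : 'rV[R[i]]_m -> 'M[R[i]]_n)
    (u : 'rV[R[i]]_m -> 'rV[R[i]]_n)
    (F : nat -> 'rV[R[i]]_m -> 'M[R[i]]_n)
    (eps0_gt0 : 0 < eps0) (N0_gt0 : 0 < N0)
    (* the data are holomorphic on an open D containing the closed polydisc *)
    (D_open : open D) (D_polydisc : @polydisc R m eps0 `<=` D)
    (A_holo : forall (z : R[i]^o) (t : 'rV[R[i]]_m), N0%:C <= `|z| -> D t ->
       holomorphic_at (fun p : R[i]^o * 'rV[R[i]]_m => A p.1 p.2) (z, t))
    (A_expansion :
       {uniform [set p : R[i]^o * 'rV[R[i]]_m |
                  N0%:C <= `|p.1| /\ @polydisc R m eps0 p.2],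
         (fun (N : nat) (p : R[i]^o * 'rV[R[i]]_m) =>
            \sum_(j < N) (p.1 : R[i]) ^- j *: Aj j p.2) @ \oo
         --> (fun p : R[i]^o * 'rV[R[i]]_m => A p.1 p.2)})
    (Aj_holo : forall j t, D t -> holomorphic_at (Aj j) t)
    (G0_holo : forall t, D t -> holomorphic_at G0 t)
    (G0_unit : forall t, D t -> G0 t \in unitmx)
    (u_holo : forall t, D t -> holomorphic_at u t)
    (A0_diag : forall t, D t -> hatA Aj G0 0 t = diag_mx (u t))
    (A0_at0 : Aj 0%N 0 = diag_mx (u 0)) (G0_at0 : G0 0 = 1%:M)
    (u_distinct : forall a b : 'I_n, a != b ->
       exists2 t, @polydisc R m eps0 t & u t 0 a != u t 0 b)
    (F_0 : forall t, D t -> ~ coalescence u t -> F 0%N t = 1%:M)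
    (F_formal : forall t, D t -> ~ coalescence u t ->
       formal_solution (Aj^~ t) (fun k => G0 t *m F k t)
         (diag_part (hatA Aj G0 1 t)) (diag_mx (u t))) :
  [/\ (* holomorphy at a point of the coalescence locus *)
      forall tD, @polydisc R m eps0 tD -> coalescence u tD ->
        (forall k, (1 <= k)%N ->
           holomorphic_off_on (coalescence u) (F k) [set tD]) <->
        (exists V, [/\ open_nbhs tD V, V `<=` D &
                       vanish_as_gaps u (hatA Aj G0) F V]),
      (* holomorphy on the whole polydisc: vanishing along the locus, to the
         order of u_a - u_b *)
      (forall k, (1 <= k)%N ->
         holomorphic_off_on (coalescence u) (F k) (@polydisc R m eps0)) <->
      (forall tD, @polydisc R m eps0 tD -> coalescence u tD ->
         exists V, [/\ open_nbhs tD V, V `<=` D &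
                       vanish_as_gaps u (hatA Aj G0) F V]),
      (* pointwise vanishing along the locus is necessary *)
      (forall k, (1 <= k)%N ->
         holomorphic_off_on (coalescence u) (F k) (@polydisc R m eps0)) ->
      zero_along u (hatA Aj G0) F (@polydisc R m eps0) &
      (* and it is sufficient where the u_a - u_b have only simple zeros *)
      simple_coalescence u (@open_polydisc R m eps0) ->
      zero_along u (hatA Aj G0) F (@open_polydisc R m eps0) ->
      forall k, (1 <= k)%N ->
        holomorphic_off_on (coalescence u) (F k) (@open_polydisc R m eps0)].
Proof.
have sub : @open_polydisc R m eps0 `<=` @polydisc R m eps0.
  by move=> t; apply: ltW.
have opn : open (@open_polydisc R m eps0).
  rewrite openE => t /= ht; apply: (proj2 (@nbhs_nmP R 'rV[R[i]]_m t _)).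
  exists (eps0 - nm t).
    by rewrite subr_gt0; move: ht; rewrite /open_polydisc /= nmE ltcR.
  move=> y yt; rewrite /open_polydisc /= nmE ltcR.
  by have := nm_sub y t 0; rewrite !subr0; lra.
have holo_bnd S : (forall k, (1 <= k)%N -> holomorphic_off_on (coalescence u) (F k) S) ->
    S `<=` @polydisc R m eps0 ->
    forall x, S x -> forall l a b, bounded_off (coalescence u) x (fun y => F l y a b).
  (* The hypothesis concerns k >= 1; F_0 is the identity off the locus. *)
  move=> hS SP x Sx [|l] a b; last exact: (holomorphic_bounded_off (hS l.+1 isT)).
  have [r r0 hr] := D_ball D_open (D_polydisc _ (SP x Sx)).
  exists (nm ((1%:M : 'M[R[i]]_n) a b)); exists r => // y /hr Dy Zy.
  by rewrite F_0.
have bnd_holo := bounded_off_holomorphic D_open Aj_holo G0_holo G0_unit u_holo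
  A0_diag F_0 F_formal D_polydisc u_distinct.
have bnd_van := bounded_vanish_as_gaps D_open Aj_holo G0_holo G0_unit u_holo
  A0_diag F_0 F_formal D_polydisc u_distinct.
have van_bnd := vanish_as_gaps_bounded D_open Aj_holo G0_holo G0_unit u_holo
  A0_diag F_0 F_formal D_polydisc u_distinct.
split.
- move=> tD tDp Zt; have tDS : [set tD] `<=` @polydisc R m eps0 by move=> _ ->.
  split=> [h|[W [tW WD van]] k k1].
    by apply: (bnd_van _ tDp); apply: (holo_bnd [set tD]).
  by apply: bnd_holo => // _ -> a b; apply: (van_bnd _ W).
- split=> [h t tp Zt|h k k1].
    by apply: (bnd_van _ tp); apply: (holo_bnd _ h).
  apply: bnd_holo => // x xp a b; have [Zx|Zx] := pselect (coalescence u x).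
    by have [W [xW WD van]] := h x xp Zx; apply: (van_bnd _ W).
  have [r r0 [xD dense]] := polydisc_ball D_open u_holo D_polydisc u_distinct xp.
  (* At a point off the locus there is no coalescing pair to treat. *)
  apply: (F_bounded D_open Aj_holo G0_holo G0_unit u_holo A0_diag F_0 F_formal r0 xD).
  by move=> l c d _ cd ucd; case: Zx; exists c, d.
- move=> h; apply: (bounded_zero_along D_open Aj_holo G0_holo G0_unit u_holo
    A0_diag F_0 F_formal D_polydisc u_distinct) => //.
  exact: holo_bnd.
- move=> simp zero k k1; apply: bnd_holo => // x xS a b.
  exact: (zero_along_bounded D_open Aj_holo G0_holo G0_unit u_holo
    A0_diag F_0 F_formal D_polydisc u_distinct sub opn simp zero).
Qed.
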